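(* Let $\alpha>0$, let $H$ and $F$ be probability distributions on a sample space $\mathcal X$, and let $X_1,X_2,\dots$ be i.i.d. with distribution $F$. Let $P_m^*\sim DP(\alpha_m^*H_m^* )$ be the posterior Dirichlet process given $X_1,\dots,X_m$, where $\alpha_m^*=\alpha+m$ and $H_m^*=\frac{\alpha}{\alpha+m}H+\frac{1}{\alpha+m}\sum_{i=1}^m\delta_{X_i}$. Let $\{A_1,\dots,A_k\}$ ($k\ge2$) be a finite measurable partition of $\mathcal X$ with $F(A_i)>0$ for all $i$, and define $$\mathcal D(P_m^*,H_m^* )=\alpha_m^*\sum_{i=1}^k\frac{(P_m^*(A_i)-H_m^*(A_i))^2}{H_m^*(A_i)},\qquad D_{KL}(P_m^*\|H_m^* )=\sum_{i=1}^kP_m^*(A_i)\log\frac{P_m^*(A_i)}{H_m^*(A_i)}.$$ Then, for almost every realization of $X_1,X_2,\dots$, conditionally on $X_1,\dots,X_m$, as $m\to\infty$, $$\mathcal D(P_m^*,H_m^* )\xrightarrow{d}\chi^2_{(k-1)},$$ and $2\alpha_m^*D_{KL}(P_m^*\|H_m^* )-\mathcal D(P_m^*,H_m^* )\to0$ in probability, so that $2\alpha_m^*D_{KL}(P_m^*\|H_m^* )\xrightarrow{d}\chi^2_{(k-1)}$ as well.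
   Context: $DP(\alpha H)$ denotes a Dirichlet process with concentration $\alpha>0$ and base distribution $H$: a random probability measure $P$ such that for every finite measurable partition $\{A_1,\dots,A_k\}$, $(P(A_1),\dots,P(A_k))\sim\mathrm{Dir}(\alpha H(A_1),\dots,\alpha H(A_k))$. $\chi^2_{(k-1)}$ is the chi-squared distribution with $k-1$ degrees of freedom. *)

(* Defs.v *)
From HB Require Import structures.
From mathcomp Require Import all_boot all_order all_algebra.
From mathcomp Require Import all_classical all_reals all_analysis.
From mathcomp Require Import measurable_realfun.
Set Implicit Arguments. Unset Strict Implicit. Unset Printing Implicit Defensive.
Import Order.TTheory GRing.Theory Num.Theory.
Import numFieldNormedType.Exports.
Local Open Scope classical_set_scope.
Local Open Scope ring_scope.

Section Defs.
Variable R : realType.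

Definition gamma_kernel (a : R) (x : R) : R := x `^ (a - 1) * expR (- x).
Definition Gammaf (a : R) : R :=
  Rintegral lebesgue_measure `]0%R, +oo[ (gamma_kernel a).

(* Z ~ Gamma(a,1); Gamma(0,1) is the point mass at 0 (Ferguson's convention) *)
Definition is_gamma d (Om : measurableType d) (Q : probability Om R)
    (Z : Om -> R) (a : R) : Prop :=
  0 <= a /\ measurable_fun setT Z /\
  forall B : set R, measurable B ->
    Q (Z @^-1` B) =
      (if a == 0 then (\1_B 0%R)%:E
       else (Rintegral lebesgue_measure (B `&` `]0%R, +oo[) (gamma_kernel a)
             / Gammaf a)%:E).

Definition indep_family d (Om : measurableType d) (Q : probability Om R)
    (k : nat) (Z : 'I_k -> Om -> R) : Prop :=
  forall B : 'I_k -> set R, (forall i, measurable (B i)) ->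
    Q (\bigcap_(i in [set: 'I_k]) (Z i @^-1` B i)) =
      (\prod_(i < k) Q (Z i @^-1` B i))%E.

(* equality of the joint laws of two random vectors (on rectangles, which
   generate the product sigma-algebra) *)
Definition same_joint_law d (Om : measurableType d) (Q : probability Om R)
    d' (Om' : measurableType d') (Q' : probability Om' R) (k : nat)
    (Y : Om -> 'I_k -> R) (W : Om' -> 'I_k -> R) : Prop :=
  forall B : 'I_k -> set R, (forall i, measurable (B i)) ->
    Q (\bigcap_(i in [set: 'I_k]) ((fun w => Y w i) @^-1` B i)) =
    Q' (\bigcap_(i in [set: 'I_k]) ((fun w => W w i) @^-1` B i)).

(* Y ~ Dir(a_1,...,a_k), Ferguson's definition: law of (Z_i / sum_j Z_j)
   with Z_i independent Gamma(a_i,1) *)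
Definition is_dirichlet d (Om : measurableType d) (Q : probability Om R)
    (k : nat) (Y : Om -> 'I_k -> R) (a : 'I_k -> R) : Prop :=
  (forall i, measurable_fun setT (fun w => Y w i)) /\
  exists (d' : measure_display) (Om' : measurableType d')
         (Q' : probability Om' R) (Z : 'I_k -> Om' -> R),
    indep_family Q' Z /\ (forall i, is_gamma Q' (Z i) (a i)) /\
    same_joint_law Q Q' Y (fun w i => Z i w / \sum_(j < k) Z j w).

Definition is_mpartition dX (X : measurableType dX) (k : nat)
    (A : 'I_k -> set X) : Prop :=
  (forall i, measurable (A i)) /\
  (forall i j, i != j -> A i `&` A j = set0) /\
  \bigcup_(i in [set: 'I_k]) A i = setT.

Definition is_DP d (Om : measurableType d) (Q : probability Om R)
    dX (X : measurableType dX) (P : Om -> probability X R)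
    (a : R) (G : set X -> R) : Prop :=
  (forall A, measurable A -> measurable_fun setT (fun w => (P w A : \bar R))) /\
  forall (k : nat) (A : 'I_k -> set X), is_mpartition A ->
    is_dirichlet Q (fun w i => fine (P w (A i))) (fun i => a * G (A i)).

Definition iid_seq d (Om : measurableType d) (Q : probability Om R)
    dX (X : measurableType dX) (Xs : nat -> Om -> X) (F : probability X R)
    : Prop :=
  (forall n, measurable_fun setT (Xs n)) /\
  forall (n : nat) (B : 'I_n -> set X), (forall i, measurable (B i)) ->
    Q (\bigcap_(i in [set: 'I_n]) (Xs i @^-1` B i)) =
      (\prod_(i < n) F (B i))%E.

Definition Hstar dX (X : measurableType dX) (alpha : R) (H : probability X R)
    (x : nat -> X) (m : nat) (A : set X) : R :=
  (alpha * fine (H A) + \sum_(j < m) \1_A (x j)) / (alpha + m%:R).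

Definition Dstat (k : nat) (a : R) (p h : 'I_k -> R) : R :=
  a * \sum_(i < k) (p i - h i) ^+ 2 / h i.

Definition KLdiv (k : nat) (p h : 'I_k -> R) : R :=
  \sum_(i < k) p i * ln (p i / h i).

Definition chi2_kernel (nu : nat) (t : R) : R :=
  t `^ (nu%:R / 2 - 1) * expR (- (t / 2)).
Definition chi2_expect (nu : nat) (f : R -> R) : R :=
  Rintegral lebesgue_measure `]0%R, +oo[ (fun t => f t * chi2_kernel nu t)
  / Rintegral lebesgue_measure `]0%R, +oo[ (chi2_kernel nu).

Definition cvg_dist_chi2 d (Om : measurableType d) (Q : probability Om R)
    (Y : nat -> Om -> R) (nu : nat) : Prop :=
  forall f : R -> R, continuous f -> (exists M : R, forall t, `|f t| <= M) ->
    (fun m => Rintegral Q setT (fun w => f (Y m w))) @ \oo --> chi2_expect nu f.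

Definition cvg_prob0 d (Om : measurableType d) (Q : probability Om R)
    (Y : nat -> Om -> R) : Prop :=
  forall eps : R, 0 < eps ->
    (fun m => Q [set w | eps < `|Y m w|]) @ \oo --> 0%E.

End Defs.

(* Main.v *)
Require Import Defs.
From HB Require Import structures.
From mathcomp Require Import all_boot all_order all_algebra.
From mathcomp Require Import all_classical all_reals all_analysis.
From mathcomp Require Import measurable_realfun ring lra.
Import Order.TTheory GRing.Theory Num.Theory.
Import numFieldNormedType.Exports.
Set Implicit Arguments. Unset Strict Implicit. Unset Printing Implicit Defensive.
Local Open Scope classical_set_scope.
Local Open Scope ring_scope.

(** Let Z_1, ..., Z_k be independent with Z_i ~ Gamma(a_i), let S = \sum_i Z_i
and a = \sum_i a_i, so that Z / S is Dirichlet, and let D be its scaled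
chi-squared divergence from (a_i / a)_i. Algebraically,
  \sum_i (Z_i - a_i)^2 / a_i = (S - a)^2 / a + (S / a)^2 D,
and S ~ Gamma(a) is independent of D. For each s >= 0 the Laplace transform at s
of (Z - a)^2 / a, Z ~ Gamma(a), tends to (1 + 2s)^(-1/2) as a -> +oo (Laplace's
method), and S / a -> 1; dividing, E[e^(-s D)] -> (1 + 2s)^(-(k-1)/2) as soon as
every a_i -> +oo, which is the Laplace transform of chi^2_(k-1). No law of large
numbers is needed: a_i -> +oo only says that almost surely the observations
visit A_i infinitely often. The independence of S and Z / S comes from tilting
by e^(-tS), which rescales Z and fixes Z / S, together with the determination of
a law on [0, +oo[ by its Laplace transform. Finally
|2 a KL - D| <= D^(3/2) / sqrt (min_i a_i) by the third order bound
|2 y ln y - (y^2 - 1)| <= |y - 1|^3, and D is tight. *)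

(** A Dirichlet vector is given only through the law of Z / S, so the transform of D has to be
    extracted from sums of independent Gammas: chi^2_(k-1) arises as the k-th power of the transform
    of one squared Gaussian, divided by one such factor. The obstacle is the random factor (S / a)^2
    in front of D, which keeps the transform of the right-hand side from factoring. Replacing it by
    1 costs at most min(1, 2 |1 - (S / a)^2|), uniformly in D, and this error involves S ~ Gamma(a)
    alone; what is left factors exactly. The cells may fill at different speeds, which is harmless
    because every factor has the same limit. Laws are treated as positive linear functionals on test
    functions, so that a single continuity theorem serves twice: for the convergence to chi^2, and,
    applied to a constant sequence, for identifying the law of S under a weight depending on Z /
    S. *)

(** * Bernstein approximation *)

(* [bernstein x n g] is \sum_k C(n, k) x^k (1 - x)^(n - k) g k; the recursion on
   n avoids the binomial coefficients altogether. *)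
Fixpoint bernstein (T : comNzRingType) (x : T) (n : nat) (g : nat -> T) : T :=
  if n is n'.+1 then bernstein x n' (fun k => x * g k.+1 + (1 - x) * g k)
  else g 0%N.

Section Bernstein.
Variable R : realType.

Lemma eq_bernstein (T : comNzRingType) (x : T) n (f g : nat -> T) :
  f =1 g -> bernstein x n f = bernstein x n g.
Proof.
elim: n f g => [|n IH] f g fg /=; first exact: fg.
by apply: IH => k; rewrite !fg.
Qed.

Lemma bernsteinD (T : comNzRingType) (x : T) n (f g : nat -> T) (c : T) :
  bernstein x n (fun k => f k + c * g k) =
  bernstein x n f + c * bernstein x n g.
Proof.
elim: n f g => [|n IH] f g //=.
by rewrite -IH; apply: eq_bernstein => k; ring.
Qed.

Lemma bernstein_cst (T : comNzRingType) (x c : T) n :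
  bernstein x n (fun=> c) = c.
Proof.
elim: n => [//|n IH] /=; rewrite -[RHS]IH.
by apply: eq_bernstein => k; ring.
Qed.

(** Squared bias plus variance of a Binomial(n, x) variable; this is the moment behind the Chebyshev
    estimate in [weierstrass_approximation]. *)
Lemma bernstein_sqr (T : comNzRingType) (x c : T) n :
  bernstein x n (fun k => (k%:R - c) ^+ 2) =
  (n%:R * x - c) ^+ 2 + n%:R * (x * (1 - x)).
Proof.
elim: n c => [|n IH] c /=; first by ring.
(* Averaging over one trial moves the centre from c to c - x and adds the Bernoulli variance x (1 -
   x), hence the induction over all c. *)
rewrite (@eq_bernstein _ _ _ _
  (fun k => (k%:R - (c - x)) ^+ 2 + (x * (1 - x)) * 1)); last first.
  by move=> k; rewrite -natr1; ring.
by rewrite bernsteinD IH bernstein_cst -natr1; ring.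
Qed.

Lemma le_bernstein (x : R) n (f g : nat -> R) : 0 <= x <= 1 ->
  (forall k, (k <= n)%N -> f k <= g k) -> bernstein x n f <= bernstein x n g.
Proof.
move=> /andP[x0 x1]; elim: n f g => [|n IH] f g fg /=; first exact: fg.
apply: IH => k kn; apply: lerD; apply: ler_wpM2l => //.
- exact: fg.
- by rewrite subr_ge0.
- by apply: fg; exact: leqW.
Qed.

(** The reason why [bernstein] lives over an arbitrary commutative ring: taken at 'X it is the
    Bernstein polynomial itself. *)
Lemma bernstein_horner (x : R) n (g : nat -> {poly R}) :
  (bernstein 'X n g).[x] = bernstein x n (fun k => (g k).[x]).
Proof.
elim: n g => [//|n IH] g /=.
by rewrite IH; apply: eq_bernstein => k; rewrite !hornerE.
Qed.

(** Heine's theorem, with only x confined to the segment: in [slutsky_dist] the point y is a value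
    of [K], which may fall outside it. *)
Lemma segment_unif_continuous (f : R -> R) (a b e : R) : 0 < e ->
  (forall x : R, a <= x <= b -> {for x, continuous f}) ->
  exists2 d : R, 0 < d &
    forall x y : R, a <= x <= b -> `|x - y| < d -> `|f x - f y| < e.
Proof.
move=> e0 cf.
have := @segment_compact R a b; rewrite compact_near_coveringP => /(_ _
  (0^'+ : set_system R) (fun d x => forall y, `|x - y| < d -> `|f x - f y| < e) _).
case.
  move=> x /=; rewrite in_itv/= => xab; have cfx := cf x xab.
  have e20 : 0 < e / 2 by rewrite divr_gt0.
  have /cvgrPdist_lt/(_ _ e20)/nbhs_ballP[r /= r0 hr] := cfx.
  exists (ball x (r / 2), [set d | d < r / 2]) => /=.
    split; first by apply: nbhsx_ballx; rewrite divr_gt0.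
    by apply: nbhs_right_lt; rewrite divr_gt0.
  move=> [z d] /= [xz dr] y zy.
  have xz' : `|x - z| < r / 2 by [].
  have h1 : `|f x - f z| < e / 2.
    by apply: hr => /=; rewrite /ball/= (lt_trans xz')//; lra.
  have h2 : `|f x - f y| < e / 2.
    apply: hr; rewrite /ball/= (_ : x - y = (x - z) + (z - y)); last by ring.
    by rewrite (le_lt_trans (ler_normD _ _))//; lra.
  rewrite (_ : f z - f y = (f x - f y) - (f x - f z)); last by ring.
  by rewrite (le_lt_trans (ler_normB _ _))//; lra.
move=> d /= d0 H; exists (d / 2); first by rewrite divr_gt0.
move=> x y xab xy.
have d20 : 0 < d / 2 by rewrite divr_gt0.
have H1 : ball 0 d (d / 2) by rewrite /ball/= sub0r normrN gtr0_norm//; lra.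
by apply: (H _ H1 d20 x) => //=; rewrite in_itv.
Qed.

(** Bernstein's proof: |f x - f (k / N)| lies below a quadratic in k, equal to e / 2 plus a multiple
    of (k - N x)^2, whose binomial mean is explicit. *)
Lemma weierstrass_approximation (f : R -> R) (M e : R) : 0 < e ->
  (forall x : R, 0 <= x <= 1 -> {for x, continuous f}) ->
  (forall x : R, 0 <= x <= 1 -> `|f x| <= M) ->
  exists p : {poly R}, forall x : R, 0 <= x <= 1 -> `|f x - p.[x]| <= e.
Proof.
move=> e0 cf fM.
have M0 : 0 <= M by apply: le_trans (fM 0 _); rewrite ?normr_ge0// lexx ler01.
have e20 : 0 < e / 2 by rewrite divr_gt0.
have [d d0 hd] := segment_unif_continuous e20 cf.
(* With this c, the trivial bound 2 M is at most c (x - k / N)^2 as soon as |x - k / N| >= d. *)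
pose c := 2 * M / d ^+ 2.
have c0 : 0 <= c by rewrite divr_ge0 ?exprn_ge0 ?mulr_ge0// ltW.
have [n hn] : exists n : nat, c * 2 / e < n.+1%:R.
  exists (Num.truncn (c * 2 / e)); have := truncnS_gt (c * 2 / e); apply.
set N := n.+1 in hn *.
have N0 : 0 < N%:R :> R by rewrite ltr0n.
exists (bernstein 'X N (fun k => (f (k%:R / N%:R))%:P)) => x x01.
have /andP[x0 x1] := x01.
rewrite bernstein_horner (@eq_bernstein _ _ _ _ (fun k => f (k%:R / N%:R)));
  last by move=> k; rewrite hornerC.
have key k : (k <= N)%N ->
    `|f x - f (k%:R / N%:R)| <=
      e / 2 + c / N%:R ^+ 2 * (k%:R - N%:R * x) ^+ 2.
  move=> kN.
  have k01 : 0 <= (k%:R / N%:R : R) <= 1.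
    rewrite divr_ge0//= ler_pdivrMr// mul1r ler_nat//.
  have -> : c / N%:R ^+ 2 * (k%:R - N%:R * x) ^+ 2 = c * (x - k%:R / N%:R) ^+ 2.
    by field; rewrite gt_eqF.
  have [xk|xk] := ltP `|x - k%:R / N%:R| d.
    rewrite (le_trans (ltW (hd _ _ x01 xk)))// lerDl mulr_ge0//.
    exact: sqr_ge0.
  rewrite (@le_trans _ _ (2 * M))//.
    rewrite (le_trans (ler_normB _ _))// mulr2n mulrDl !mul1r.
    by rewrite lerD// fM.
  apply: ler_wpDl; first exact: ltW.
  rewrite /c -mulrA ler_peMr ?mulr_ge0//.
  rewrite mulrC ler_pdivlMr ?exprn_gt0// mul1r -(real_normK (num_real (x - _))).
  by rewrite ler_sqr ?nnegrE//; exact: ltW.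
have up : f x - bernstein x N (fun k => f (k%:R / N%:R)) <= e /\
          bernstein x N (fun k => f (k%:R / N%:R)) - f x <= e.
  have B : bernstein x N (fun k => e / 2 + c / N%:R ^+ 2 * (k%:R - N%:R * x) ^+ 2)
      <= e.
    rewrite bernsteinD bernstein_cst bernstein_sqr subrr expr0n/= add0r.
    have -> : c / N%:R ^+ 2 * (N%:R * (x * (1 - x))) = c / N%:R * (x * (1 - x)).
      by field; rewrite gt_eqF.
    have xx : x * (1 - x) <= 1 by nra.
    have xx0 : 0 <= x * (1 - x) by nra.
    have cN : c / N%:R <= e / 2.
      rewrite ler_pdivrMr//; move: hn; rewrite ltr_pdivrMr// => hn.
      by move: hn; set t := N%:R; nra.
    have : c / N%:R * (x * (1 - x)) <= e / 2 * 1.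
      apply: ler_pM => //; rewrite divr_ge0//; exact: ltW.
    by lra.
  have h1 : f x - bernstein x N (fun k => f (k%:R / N%:R)) =
    bernstein x N (fun k => f x + (-1) * f (k%:R / N%:R)).
    by rewrite bernsteinD bernstein_cst; ring.
  have h2 : bernstein x N (fun k => f (k%:R / N%:R)) - f x =
    bernstein x N (fun k => f (k%:R / N%:R) + (-1) * f x).
    by rewrite bernsteinD bernstein_cst; ring.
  split.
  - rewrite h1 (le_trans _ B)//; apply: le_bernstein => // k kN.
    rewrite (le_trans _ (key _ kN))// mulN1r; exact: ler_norm.
  - rewrite h2 (le_trans _ B)//; apply: le_bernstein => // k kN.
    by rewrite (le_trans _ (key _ kN))// mulN1r distrC; exact: ler_norm.
rewrite ler_norml; lra.
Qed.

End Bernstein.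

(** * Continuity theorem for Laplace transforms *)

Section Laplace.
Variable R : realType.
Implicit Types (f g : R -> R) (E : (R -> R) -> R).

(** The bound is restricted to x >= 0 so that [expR (- (s * x))] qualifies; continuity on the whole
    line supplies measurability. *)
Definition bounded_nneg f := continuous f /\ exists M : R, forall x : R, 0 <= x -> `|f x| <= M.

(* The properties of f |-> E[f(X)], X >= 0, used below; no random variable is
   needed, so this also covers [chi2_expect] and Gamma integrals. *)
Definition nneg_expectation E :=
  [/\ forall f g c, bounded_nneg f -> bounded_nneg g ->
        E (fun x => f x + c * g x) = E f + c * E g,
      forall f, bounded_nneg f -> (forall x : R, 0 <= x -> 0 <= f x) -> 0 <= E f &
      E (cst 1) = 1].

Lemma bounded_nnegD f g c : bounded_nneg f -> bounded_nneg g ->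
  bounded_nneg (fun x => f x + c * g x).
Proof.
move=> [cf [M fM]] [cg [N gN]]; split.
  by move=> x; apply: cvgD; [exact: cf|apply: cvgM; [exact: cvg_cst|exact: cg]].
exists (M + `|c| * N) => x x0; rewrite (le_trans (ler_normD _ _))// normrM.
by apply: lerD; [exact: fM|apply: ler_wpM2l => //; exact: gN].
Qed.

Lemma bounded_nneg_cst c : bounded_nneg (cst c).
Proof. by split; [move=> x; exact: cvg_cst|exists `|c|]. Qed.

Lemma continuous_expNM (s : R) : continuous (fun x : R => expR (- (s * x))).
Proof.
move=> x; apply: continuous_comp; last exact: continuous_expR.
by apply: cvgN; apply: cvgM; [exact: cvg_cst|exact: cvg_id].
Qed.

Lemma bounded_nneg_expN (s : R) : 0 <= s -> bounded_nneg (fun x => expR (- (s * x))).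
Proof.
move=> s0; split; first exact: continuous_expNM.
exists 1 => x x0; rewrite ger0_norm ?expR_ge0// -[leRHS](@expR0 R) ler_expR.
by rewrite oppr_le0 mulr_ge0.
Qed.

Lemma bounded_nnegM f g : bounded_nneg f -> bounded_nneg g ->
  bounded_nneg (fun x => f x * g x).
Proof.
move=> [cf [M fM]] [cg [N gN]]; split.
  by move=> x; apply: cvgM; [exact: cf|exact: cg].
by exists (M * N) => x x0; rewrite normrM ler_pM// ?fM ?gN.
Qed.

Lemma bounded_nneg_poly (p : {poly R}) :
  bounded_nneg (fun x => p.[expR (- x)]).
Proof.
elim/poly_ind: p => [|p c IH].
  by under eq_fun do rewrite horner0; exact: bounded_nneg_cst.
under eq_fun do rewrite hornerMXaddC -[X in _ + X]mulr1.
apply: bounded_nnegD; last exact: bounded_nneg_cst.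
apply: bounded_nnegM => //.
have := bounded_nneg_expN (@ler01 R).
by under eq_fun do rewrite mul1r.
Qed.

Section nneg_expectation_theory.
Variables (E : (R -> R) -> R) (hE : nneg_expectation E).

Lemma nneg_expectation_cst c : E (cst c) = c.
Proof.
case: hE => EL _ E1.
have := EL _ _ (c - 1) (bounded_nneg_cst 1) (bounded_nneg_cst 1).
rewrite E1 (_ : (fun _ => _) = cst c); last by apply/funext => x /=; ring.
by move=> ->; ring.
Qed.

Lemma le_nneg_expectation f g : bounded_nneg f -> bounded_nneg g ->
  (forall x : R, 0 <= x -> f x <= g x) -> E f <= E g.
Proof.
case: hE => EL Epos _ bf bg fg.
rewrite -subr_ge0 -mulN1r -EL//; apply: Epos; first exact: bounded_nnegD.
by move=> x x0; rewrite mulN1r subr_ge0 fg.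
Qed.

Lemma nneg_expectationB f g : bounded_nneg f -> bounded_nneg g ->
  E (fun x => f x - g x) = E f - E g.
Proof.
case: hE => EL _ _ bf bg; rewrite -mulN1r -EL//.
by congr E; apply/funext => x; rewrite mulN1r.
Qed.

Lemma dist_nneg_expectation f g h : bounded_nneg f -> bounded_nneg g ->
  bounded_nneg h ->
  (forall x : R, 0 <= x -> `|f x - g x| <= h x) -> `|E f - E g| <= E h.
Proof.
move=> bf bg bh fgh; rewrite -nneg_expectationB// ler_norml; apply/andP; split.
  have -> : - E h = E (fun x => cst 0 x - h x).
    rewrite nneg_expectationB//; last exact: bounded_nneg_cst.
    by rewrite nneg_expectation_cst sub0r.
  apply: le_nneg_expectation => [||x x0].
  - have := bounded_nnegD (-1) (bounded_nneg_cst 0) bh.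
    by under eq_fun do rewrite mulN1r.
  - have := bounded_nnegD (-1) bf bg.
    by under eq_fun do rewrite mulN1r.
  - by have := fgh _ x0; rewrite ler_norml => /andP[+ _]; rewrite /= sub0r.
apply: le_nneg_expectation => //.
  have := bounded_nnegD (-1) bf bg.
  by under eq_fun do rewrite mulN1r.
by move=> x x0; have := fgh _ x0; rewrite ler_norml => /andP[].
Qed.

End nneg_expectation_theory.

(* Weierstrass in the variable u = e^{-x}; the factor e^{-delta x} makes the
   function of u continuous at u = 0. *)
Lemma expN_poly_approx f (delta e : R) : bounded_nneg f -> 0 < delta -> 0 < e ->
  exists p : {poly R}, forall x : R, 0 <= x ->
    `|f x * expR (- (delta * x)) - p.[expR (- x)]| <= e.
Proof.
move=> [cf [M fM]] delta0 e0.
have M0 : 0 <= M by apply: le_trans (fM 0 _).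
(* [G] is the damped function in the variable u = e^(-x), bounded by M u^delta, hence continuous at
   0 with value 0. *)
pose G u := if 0 < u then f (- ln u) * expR (delta * ln u) else 0.
have Gb u : 0 < u -> u <= 1 -> `|G u| <= M * expR (delta * ln u).
  move=> u0 u1; rewrite /G u0 normrM (ger0_norm (expR_ge0 _)).
  by rewrite ler_wpM2r ?expR_ge0// fM// oppr_ge0 ln_le0.
have [p hp] : exists p : {poly R}, forall u : R, 0 <= u <= 1 -> `|G u - p.[u]| <= e.
  apply: (@weierstrass_approximation _ _ M) => //.
  - move=> u /andP[]; rewrite le_eqVlt => /orP[/eqP <- _|u0 u1].
      apply/cvgrPdist_le => /= eps eps0.
      (* r = (eps / (M + 1))^(1 / delta), so v < r forces v^delta <= eps / (M + 1). *)
      pose r := expR (ln (eps / (M + 1)) / delta).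
      near=> v; rewrite {1}/G ltxx sub0r normrN.
      have [v0|v0] := ltP 0 v; last by rewrite /G ltNge v0/= normr0 ltW.
      have vr : v < r.
        near: v; exists r => /=; first exact: expR_gt0.
        by move=> z /=; rewrite sub0r normrN => /(le_lt_trans (ler_norm _)).
      have v1 : v <= 1.
        near: v; exists 1 => //=.
        by move=> z /=; rewrite sub0r normrN => /(le_lt_trans (ler_norm _))/ltW.
      rewrite (le_trans (Gb _ v0 v1))//.
      have : delta * ln v <= ln (eps / (M + 1)).
        rewrite -ler_pdivlMl// mulrC -[leRHS]expRK ler_ln ?posrE ?expR_gt0//.
        exact: ltW.
      rewrite -ler_expR lnK; last by rewrite posrE divr_gt0// ltr_wpDl.
      move=> h; rewrite (@le_trans _ _ (M * (eps / (M + 1))))//.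
        by rewrite ler_wpM2l.
      rewrite mulrCA ler_piMr//; first exact: ltW.
      by rewrite ler_pdivrMr ?ltr_wpDl// mul1r lerDl.
    have Geq : {near u, (fun v => f (- ln v) * expR (delta * ln v)) =1 G}.
      near=> v; rewrite /G (_ : 0 < v)//; near: v; exact: lt_nbhsr.
    apply: (cvg_trans (near_eq_cvg Geq)).
    rewrite {1}/G u0; apply: cvgM.
      apply: (@continuous_comp _ _ _ (fun v => - ln v) f); last exact: cf.
      by apply: cvgN; exact: continuous_ln.
    apply: (@continuous_comp _ _ _ (fun v => delta * ln v) (@expR R)).
      by apply: cvgM; [exact: cvg_cst|exact: continuous_ln].
    exact: continuous_expR.
  - move=> u /andP[]; rewrite le_eqVlt => /orP[/eqP <- _|u0 u1].
      by rewrite /G ltxx normr0.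
    rewrite (le_trans (Gb _ u0 u1))// ler_piMr// -[leRHS](@expR0 R) ler_expR.
    by rewrite pmulr_rle0// ln_le0.
exists p => x x0; have := hp (expR (- x)).
rewrite expR_ge0 -{1}(@expR0 R) ler_expR oppr_le0 x0 => /(_ isT).
by rewrite /G expR_gt0 expRK opprK mulrN.
Unshelve. all: by end_near. Qed.

Lemma cvg_nneg_expectation_poly (En : nat -> (R -> R) -> R) E (p : {poly R}) :
  (forall n, nneg_expectation (En n)) -> nneg_expectation E ->
  (forall s : R, 0 <= s ->
    En n (fun x => expR (- (s * x))) @[n --> \oo] --> E (fun x => expR (- (s * x)))) ->
  En n (fun x => p.[expR (- x)]) @[n --> \oo] --> E (fun x => p.[expR (- x)]).
Proof.
move=> hEn hE cvE.
(* The extra factor e^(-jx) carries the Horner recursion: multiplying p by 'X raises j by one, and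
   the constant term contributes c e^(-jx). *)
suff H : forall j : nat,
    En n (fun x => p.[expR (- x)] * expR (- (j%:R * x))) @[n --> \oo] -->
    E (fun x => p.[expR (- x)] * expR (- (j%:R * x))).
  have := H 0%N; under eq_fun do under eq_fun do rewrite mul0r oppr0 expR0 mulr1.
  by under [X in _ --> E X]eq_fun do rewrite mul0r oppr0 expR0 mulr1.
have bexp (j : nat) : bounded_nneg (fun x : R => expR (- (j%:R * x))).
  exact: bounded_nneg_expN.
elim/poly_ind: p => [|p c IH] j.
  have -> : (fun x : R => (0 : {poly R}).[expR (- x)] * expR (- (j%:R * x))) = cst 0.
    by apply/funext => x; rewrite horner0 mul0r.
  under eq_fun do rewrite nneg_expectation_cst//.
  by rewrite nneg_expectation_cst//; exact: cvg_cst.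
pose h := fun x : R => p.[expR (- x)] * expR (- (j.+1%:R * x)).
have -> : (fun x : R => (p * 'X + c%:P).[expR (- x)] * expR (- (j%:R * x))) =
    (fun x => h x + c * expR (- (j%:R * x))).
  apply/funext => x; rewrite /h hornerMXaddC.
  have -> : expR (- (j.+1%:R * x)) = expR (- x) * expR (- (j%:R * x)).
    by rewrite -expRD; congr expR; rewrite -natr1; ring.
  by ring.
have bh : bounded_nneg h by apply: bounded_nnegM => //; exact: bounded_nneg_poly.
case: (hE) => EL _ _; rewrite EL//.
under eq_fun => n do (case: (hEn n) => -> // _ _).
apply: cvgD; first exact: IH.
by apply: cvgM; [exact: cvg_cst|exact: cvE].
Qed.

(** Damping f by e^(-delta x) costs at most M (1 - E e^(-delta x)), and the damped function is
    uniformly close to a polynomial in e^(-x), whose expectations converge. The behaviour of the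
    transform of E at 0+ makes the cost small for E, hence, through convergence at the single point
    delta, for [En n]; this plays the part of tightness. *)
Theorem laplace_continuity (En : nat -> (R -> R) -> R) E f :
  (forall n, nneg_expectation (En n)) -> nneg_expectation E ->
  (forall s : R, 0 <= s ->
    En n (fun x => expR (- (s * x))) @[n --> \oo] --> E (fun x => expR (- (s * x)))) ->
  E (fun x => expR (- (s * x))) @[s --> 0^'+] --> (1 : R) ->
  bounded_nneg f -> En n f @[n --> \oo] --> E f.
Proof.
move=> hEn hE cvE E01 bf; have [cf [M fM]] := bf.
have M0 : 0 <= M by apply: le_trans (fM 0 _).
apply/cvgrPdist_le => /= eps eps0.
(* Budget in units of eps / 8: damping costs 1 for E and 2 for [En n], the polynomial costs 1 on
   each side, and convergence costs 1, which makes 6 in all. *)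
pose eta := eps / (8 * (M + 1)).
have M1 : 0 < M + 1 by rewrite ltr_wpDl.
have eta0 : 0 < eta by rewrite divr_gt0// mulr_gt0.
have Meta : M * eta <= eps / 8.
  rewrite /eta (_ : M * (eps / (8 * (M + 1))) = eps / 8 * (M / (M + 1))); last by field; rewrite gt_eqF.
  rewrite ler_piMr ?divr_ge0 ?(ltW eps0)//.
  by rewrite ler_pdivrMr// mul1r lerDl.
have [delta delta0 hdelta] : exists2 d : R, 0 < d &
    `|1 - E (fun x => expR (- (d * x)))| < eta.
  move/cvgrPdist_lt : E01 => /(_ _ eta0) /= H.
  near (0 : R)^'+ => d; exists d; near: d => //.
  exact: nbhs_right_gt.
have be := bounded_nneg_expN (ltW delta0).
pose g x := f x * expR (- (delta * x)).
have bg : bounded_nneg g by exact: bounded_nnegM.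
have e80 : 0 < eps / 8 by rewrite divr_gt0.
have [p hp] := expN_poly_approx bf delta0 e80.
have bp := bounded_nneg_poly p.
have tail E' : nneg_expectation E' ->
    `|E' f - E' g| <= M * (1 - E' (fun x => expR (- (delta * x)))).
  move=> hE'; have [EL' _ E1'] := hE'.
  rewrite (_ : M * _ = E' (fun x => M + (- M) * expR (- (delta * x)))); last first.
    by rewrite (EL' (cst M))// ?nneg_expectation_cst//;
       [ring | exact: bounded_nneg_cst].
  apply: dist_nneg_expectation => //.
    exact: (@bounded_nnegD (cst M) _ (- M) (bounded_nneg_cst M) be).
  move=> x x0; rewrite /g (_ : _ - _ = f x * (1 - expR (- (delta * x)))); last by ring.
  rewrite normrM (_ : M + _ = M * (1 - expR (- (delta * x)))); last by ring.
  have h1 : expR (- (delta * x)) <= 1.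
    by rewrite -(@expR0 R) ler_expR oppr_le0 mulr_ge0// ltW.
  rewrite (@ger0_norm R (1 - _)) ?subr_ge0//.
  by rewrite ler_wpM2r ?subr_ge0// fM.
have poly E' : nneg_expectation E' ->
    `|E' g - E' (fun x => p.[expR (- x)])| <= eps / 8.
  move=> hE'; rewrite -[leRHS](nneg_expectation_cst hE').
  apply: dist_nneg_expectation => //; exact: bounded_nneg_cst.
have cvp := @cvg_nneg_expectation_poly En E p hEn hE cvE.
have cve := cvE _ (ltW delta0).
near=> n.
have t1 := tail _ hE; have t2 := tail _ (hEn n).
have p1 := poly _ hE; have p2 := poly _ (hEn n).
have c1 : `|E (fun x => p.[expR (- x)]) - En n (fun x => p.[expR (- x)])| <= eps / 8.
  by near: n; move/cvgrPdist_le : cvp; apply.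
have c2 : `|E (fun x => expR (- (delta * x))) - En n (fun x => expR (- (delta * x)))|
    <= eta.
  by near: n; move/cvgrPdist_le : cve; apply.
move: t1 t2 p1 p2 c1 c2 hdelta; set a1 := E f; set a2 := E g.
set a3 := E (fun x => p.[_]); set a4 := E _; set b1 := En n f; set b2 := En n g.
set b3 := En n (fun x => p.[_]); set b4 := En n _ => t1 t2 p1 p2 c1 c2 hd.
have u1 : M * (1 - a4) <= eps / 8.
  apply: le_trans Meta; apply: ler_wpM2l => //.
  exact: le_trans (ler_norm _) (ltW hd).
have u2 : M * (1 - b4) <= 2 * (eps / 8).
  apply: (@le_trans _ _ (M * (2 * eta))); last by rewrite mulrCA ler_pM2l.
  apply: ler_wpM2l => //.
  by move: hd c2; rewrite ltr_norml ler_norml => /andP[? ?] /andP[? ?]; lra.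
move: t1 t2 p1 p2 c1; rewrite !ler_norml.
move=> /andP[? ?] /andP[? ?] /andP[? ?] /andP[? ?] /andP[? ?].
by apply/andP; split; lra.
Unshelve. all: by end_near. Qed.

End Laplace.

(** * Logarithmic inequalities *)

Section LogBounds.
Variable R : realType.
Implicit Types x y u w b c : R.

Lemma is_derive1V (f : R -> R) x df : f x != 0 -> is_derive x 1 f df ->
  is_derive x 1 (fun t => (f t)^-1) (- (f x ^- 2 * df)).
Proof.
move=> fx0 dfx; have dfx' : derivable f x 1 by exact: ex_derive.
apply: DeriveDef; first exact: derivableV.
by rewrite deriveV// derive_val -mulNr.
Qed.

(** The right-hand side is sinh (ln u). The difference vanishes at 1 and has derivative (1 - 1/x)^2
    / 2. *)
Lemma ln_le_sinh u : 1 <= u -> ln u <= (u - u^-1) / 2.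
Proof.
move=> u1.
have d x : 0 < x -> is_derive x 1 (fun t => (t - t^-1) / 2 - ln t)
    ((1 + x^-1 ^+ 2) / 2 - x^-1).
  move=> x0; have x00 : x != 0 by rewrite gt_eqF.
  have dx := is_derive1_ln x0.
  have dV := @is_derive1V id x 1 x00 (is_derive_id x 1).
  have dh := is_deriveB (is_deriveZ 2^-1 (is_deriveB (is_derive_id x 1) dV)) dx.
  rewrite (_ : (fun t => _) = 2^-1 \*: (id - (fun t => t^-1)) - @ln R); last first.
    by apply/funext => t; rewrite /= !fctE mulrC.
  apply: is_derive_eq => /=.
  by rewrite mulr1 opprK -exprVn /GRing.scale/=; ring.
rewrite -subr_ge0 (_ : 0 = (1 - 1^-1) / 2 - ln 1); last first.
  by rewrite ln1 invr1; ring.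
apply: (@ger0_derive1_ndecry _ (fun t => (t - t^-1) / 2 - ln t) 1) => //.
- move=> x; rewrite in_itv/= andbT => x1.
  by have dx := d x (lt_trans ltr01 x1); exact: ex_derive.
- move=> x; rewrite in_itv/= andbT => x1.
  rewrite derive1E; have dx := d x (lt_trans ltr01 x1).
  rewrite derive_val (_ : _ - _ = (1 - x^-1) ^+ 2 / 2); last first.
    by set t := x^-1; field.
  by rewrite divr_ge0 ?sqr_ge0.
- apply: derivable_within_continuous => x; rewrite in_itv/= andbT => x1.
  by have dx := d x (lt_le_trans ltr01 x1); exact: ex_derive.
Qed.

(** The left-hand side is 2 tanh (ln u / 2). The difference has derivative (x - 1)^2 / (x (x +
    1)^2). Like the sinh bound, it agrees with ln to second order at 1, so the two together leave an
    error of third order. *)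
Lemma ln_ge_mobius u : 1 <= u -> 2 * (u - 1) / (u + 1) <= ln u.
Proof.
move=> u1.
have d x : 0 < x -> is_derive x 1 (fun t => ln t + 4 * (t + 1)^-1)
    (x^-1 - 4 * (x + 1)^-1 ^+ 2).
  move=> x0; have x10 : x + 1 != 0 by rewrite gt_eqF// addr_gt0.
  have dx := is_derive1_ln x0.
  have dV := @is_derive1V (id + cst (1 : R)) x _ x10
    (is_deriveD (is_derive_id x 1) (is_derive_cst (1 : R) x 1)).
  have dh := is_deriveD dx (is_deriveZ 4 dV).
  rewrite (_ : (fun t => _) = @ln R + 4 \*: (fun t => ((id + cst (1 : R)) t)^-1)); last first.
    by apply/funext => t; rewrite /= !fctE.
  apply: is_derive_eq => /=.
  by rewrite addr0 mulr1 -exprVn fctE /GRing.scale/=; ring.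
have -> : 2 * (u - 1) / (u + 1) = 2 - 4 * (u + 1)^-1.
  by field; rewrite gt_eqF// addr_gt0// (lt_le_trans ltr01).
rewrite lerBlDr (_ : 2 = ln 1 + 4 * (1 + 1)^-1); last by rewrite ln1; field.
apply: (@ger0_derive1_ndecry _ (fun t => ln t + 4 * (t + 1)^-1) 1) => //.
- move=> x; rewrite in_itv/= andbT => x1.
  by have dx := d x (lt_trans ltr01 x1); exact: ex_derive.
- move=> x; rewrite in_itv/= andbT => x1.
  rewrite derive1E; have dx := d x (lt_trans ltr01 x1).
  have x0 := lt_trans ltr01 x1.
  rewrite derive_val (_ : _ - _ = (x - 1) ^+ 2 / (x * (x + 1) ^+ 2)); last first.
    by field; rewrite !gt_eqF// addr_gt0.
  by apply: divr_ge0; [exact: sqr_ge0|apply: mulr_ge0; [exact: ltW|exact: sqr_ge0]].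
- apply: derivable_within_continuous => x; rewrite in_itv/= andbT => x1.
  by have dx := d x (lt_le_trans ltr01 x1); exact: ex_derive.
Qed.

(** Both sides change sign under u -> 1/u, so the bound on the other side of 1 is reversed; the same
    holds for [ln_le_mobius]. *)
Lemma ln_ge_sinh u : 0 < u <= 1 -> (u - u^-1) / 2 <= ln u.
Proof.
move=> /andP[u0 u1]; have := @ln_le_sinh u^-1.
rewrite invf_ge1// => /(_ u1); rewrite lnV ?posrE// invrK; lra.
Qed.

Lemma ln_le_mobius u : 0 < u <= 1 -> ln u <= 2 * (u - 1) / (u + 1).
Proof.
move=> /andP[u0 u1]; have := @ln_ge_mobius u^-1.
rewrite invf_ge1// => /(_ u1); rewrite lnV ?posrE//.
have -> : 2 * (u^-1 - 1) / (u^-1 + 1) = - (2 * (u - 1) / (u + 1)).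
  by field; rewrite !gt_eqF ?addr_gt0.
lra.
Qed.

(** Multiplied by 2y, the sinh bound becomes exactly y^2 - 1, and the rational one differs from it
    by (y - 1)^3 / (y + 1), where y + 1 >= 1. The estimate is global in y, so cells of small or zero
    mass are included. *)
Lemma entropy_third_order y : 0 <= y ->
  `|2 * y * ln y - (y ^+ 2 - 1)| <= `|y - 1| ^+ 3.
Proof.
rewrite le_eqVlt => /orP[/eqP <-|y0].
  by rewrite mulr0 mul0r expr0n/= !sub0r opprK normrN normr1 expr1n.
have y10 : y + 1 != 0 by rewrite gt_eqF// addr_gt0.
have E1 : 2 * y * ((y - y^-1) / 2) = y ^+ 2 - 1 by field; rewrite gt_eqF.
have E2 : 2 * y * (2 * (y - 1) / (y + 1)) = y ^+ 2 - 1 - (y - 1) ^+ 3 / (y + 1).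
  by field.
have y20 : 0 < 2 * y by rewrite mulr_gt0.
have [y1|y1] := leP 1 y.
  have h1 : 2 * y * ln y <= y ^+ 2 - 1 by rewrite -E1 ler_pM2l// ln_le_sinh.
  have h2 : y ^+ 2 - 1 - (y - 1) ^+ 3 / (y + 1) <= 2 * y * ln y.
    by rewrite -E2 ler_pM2l// ln_ge_mobius.
  have h3 : (y - 1) ^+ 3 / (y + 1) <= (y - 1) ^+ 3.
    rewrite ler_pdivrMr ?addr_gt0// ler_peMr ?exprn_ge0 ?subr_ge0//; lra.
  rewrite (ger0_norm (_ : 0 <= y - 1)) ?subr_ge0// ler_norml.
  have : 0 <= (y - 1) ^+ 3 by rewrite exprn_ge0 ?subr_ge0.
  by move=> ?; apply/andP; split; lra.
have y01 : 0 < y <= 1 by rewrite y0 ltW.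
have h1 : y ^+ 2 - 1 <= 2 * y * ln y by rewrite -E1 ler_pM2l// ln_ge_sinh.
have h2 : 2 * y * ln y <= y ^+ 2 - 1 - (y - 1) ^+ 3 / (y + 1).
  by rewrite -E2 ler_pM2l// ln_le_mobius.
have -> : `|y - 1| = 1 - y by rewrite ler0_norm; lra.
have h3 : (1 - y) ^+ 3 / (y + 1) <= (1 - y) ^+ 3.
  rewrite ler_pdivrMr ?addr_gt0// ler_peMr ?exprn_ge0//; lra.
have E3 : (y - 1) ^+ 3 / (y + 1) = - ((1 - y) ^+ 3 / (y + 1)) by field.
have : 0 <= (1 - y) ^+ 3 by rewrite exprn_ge0//; lra.
by move=> ?; rewrite ler_norml; apply/andP; split; lra.
Qed.

(** Uniform in x because t e^(-t) <= 1. For c >= 1/2 the mean value bound gives |1 - c| / min(1, c),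
    at most 2 |1 - c|; for c < 1/2 the right-hand side exceeds 1. *)
Lemma dist_expN_le x c : 0 <= x -> 0 <= c ->
  `|expR (- x) - expR (- (c * x))| <= 2 * `|1 - c|.
Proof.
move=> x0 c0.
have main a b' : 0 <= a -> a <= b' ->
    0 <= expR (- a) - expR (- b') /\ expR (- a) - expR (- b') <= expR (- a) * (b' - a).
  move=> a0 ab; split; first by rewrite subr_ge0 ler_expR lerN2.
  have -> : expR (- b') = expR (- a) * expR (a - b') by rewrite -expRD; congr expR; ring.
  have := expR_ge1Dx (a - b'); have := expR_ge0 (- a).
  set p := expR _; set q := expR _ => *; nra.
have xe : x * expR (- x) <= 1.
  have := expR_ge1Dx x; rewrite expRN => h.
  by rewrite ler_pdivrMr ?expR_gt0// mul1r; lra.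
have [c1|c1] := leP 1 c.
  have [h1 h2] : _ /\ _ := main x (c * x) x0 (ler_peMl x0 c1).
  rewrite ger0_norm// ler0_norm; last lra.
  rewrite (le_trans h2)// (_ : _ * _ = (x * expR (- x)) * (c - 1)); last by ring.
  have : (x * expR (- x)) * (c - 1) <= 1 * (c - 1) by rewrite ler_wpM2r//; lra.
  lra.
have [h1 h2] : _ /\ _ := main (c * x) x (mulr_ge0 c0 x0) (ler_piMl x0 (ltW c1)).
rewrite distrC ger0_norm// ger0_norm; last lra.
have cxe : c * x * expR (- (c * x)) <= 1.
  have := expR_ge1Dx (c * x); rewrite expRN => h.
  by rewrite ler_pdivrMr ?expR_gt0// mul1r; lra.
have [c2|c2] := leP (2^-1) c.
  rewrite (le_trans h2)// (_ : _ * _ = (x * expR (- (c * x))) * (1 - c)); last by ring.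
  rewrite ler_wpM2r//; first lra.
  rewrite (@le_trans _ _ (2 * (c * x * expR (- (c * x)))))//; last by lra.
  have : 0 <= x * expR (- (c * x)) by rewrite mulr_ge0// expR_ge0.
  set t := _ * _ => t0; rewrite (_ : c * x * _ = c * t); last by rewrite /t; ring.
  nra.
have : expR (- (c * x)) <= 1.
  by rewrite -(@expR0 R) ler_expR oppr_le0 mulr_ge0.
have := expR_ge0 (- x); lra.
Qed.

(** Logarithm of z^b e^(-z) at z = b + w sqrt b, relative to its maximum, which is at z = b. *)
Definition gamma_exponent b w := b * (ln (1 + w / Num.sqrt b) - w / Num.sqrt b).

(** Supplies a dominating function independent of b. It is only linear in |w| because the right tail
    of a Gamma law is exponential: there the exponent is at most - w^2 / (2 (1 + w)). On the left it
    is at most - w^2 / 2. *)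
Lemma gamma_exponent_le b w : 1 <= b -> - Num.sqrt b < w ->
  gamma_exponent b w <= (1 - `|w|) / 2.
Proof.
move=> b1 bw; have b0 : 0 < b by rewrite (lt_le_trans ltr01).
have s0 : 0 < Num.sqrt b by rewrite sqrtr_gt0.
have s1 : 1 <= Num.sqrt b by rewrite -[leLHS]sqrtr1 ler_wsqrtr.
have sb : Num.sqrt b ^+ 2 = b by rewrite sqr_sqrtr// ltW.
rewrite /gamma_exponent; set s := Num.sqrt b in bw s0 s1 sb *.
pose x := w / s.
have x1 : 0 < 1 + x.
  by rewrite /x -[X in X + _](@divff _ s) ?gt_eqF// -mulrDl divr_gt0//; lra.
have wE : w = x * s by rewrite /x divfK ?gt_eqF.
rewrite -/x -sb wE.
have [x0|x0] := leP 0 x.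
  have h := @ln_le_sinh (1 + x); rewrite lerDl in h.
  rewrite ger0_norm; last by rewrite mulr_ge0// ltW.
  apply: (@le_trans _ _ (s ^+ 2 * (- x ^+ 2 / (2 * (1 + x))))).
    rewrite ler_wpM2l ?sqr_ge0//.
    have -> : - x ^+ 2 / (2 * (1 + x)) = (1 + x - (1 + x)^-1) / 2 - x.
      by field; rewrite gt_eqF.
    by rewrite lerD2r h.
  rewrite mulrA ler_pdivrMr ?mulr_gt0//.
  have : 0 <= x * (s - 1) by rewrite mulr_ge0//; lra.
  move=> h1; have h2 : 0 <= x * s by rewrite mulr_ge0// ltW.
  nra.
have h := @ln_le_mobius (1 + x); rewrite x1/= in h.
rewrite ltr0_norm; last by rewrite pmulr_llt0.
apply: (@le_trans _ _ (s ^+ 2 * (- x ^+ 2 / 2))).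
  rewrite ler_wpM2l ?sqr_ge0//.
  apply: (@le_trans _ _ (2 * (1 + x - 1) / (1 + x + 1) - x)).
    by rewrite lerD2r h//; lra.
  have -> : 2 * (1 + x - 1) / (1 + x + 1) - x = - x ^+ 2 / (2 + x).
    by field; rewrite !gt_eqF//; lra.
  rewrite !mulNr lerN2 ler_wpM2l ?sqr_ge0// lef_pV2 ?posrE//; lra.
nra.
Qed.

(** Quantitative Laplace expansion: with x = w / sqrt b, both bounds on ln (1 + x) differ from x -
    x^2 / 2 by at most |x|^3 when |x| <= 1/2. *)
Lemma gamma_exponent_dist b w : 0 < b -> `|w| <= Num.sqrt b / 2 ->
  `|gamma_exponent b w + w ^+ 2 / 2| <= `|w| ^+ 3 / Num.sqrt b.
Proof.
move=> b0.
have s0 : 0 < Num.sqrt b by rewrite sqrtr_gt0.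
have sb : Num.sqrt b ^+ 2 = b by rewrite sqr_sqrtr// ltW.
rewrite /gamma_exponent; set s := Num.sqrt b in s0 sb *.
pose x := w / s; have wE : w = x * s by rewrite /x divfK ?gt_eqF.
rewrite -/x -sb wE (normrM x s) (gtr0_norm s0) => xle.
have {}xle : `|x| <= 2^-1 by move: xle; rewrite mulrC ler_pM2l.
have /andP[xl xr] : - 2^-1 <= x <= 2^-1 by rewrite -ler_norml.
have xx0 := sqr_ge0 x.
have -> : (`|x| * s) ^+ 3 / s = s ^+ 2 * (`|x| * x ^+ 2).
  by rewrite -(real_normK (num_real x)); field; rewrite gt_eqF.
have -> : s ^+ 2 * (ln (1 + x) - x) + (x * s) ^+ 2 / 2 =
  s ^+ 2 * (ln (1 + x) - x + x ^+ 2 / 2) by ring.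
rewrite normrM (ger0_norm (sqr_ge0 s)).
apply: ler_wpM2l; first exact: sqr_ge0.
have E1 : (1 + x - (1 + x)^-1) / 2 - x + x ^+ 2 / 2 = x / (2 * (1 + x)) * x ^+ 2.
  by field; rewrite gt_eqF//; lra.
have E2 : 2 * (1 + x - 1) / (1 + x + 1) - x + x ^+ 2 / 2 = x / (2 * (2 + x)) * x ^+ 2.
  by field; rewrite !gt_eqF//; lra.
have B1 : `|x / (2 * (1 + x)) * x ^+ 2| <= `|x| * x ^+ 2.
  rewrite normrM (ger0_norm (sqr_ge0 _)) ler_wpM2r ?sqr_ge0//.
  rewrite normrM ler_piMr// ger0_norm ?invr_ge0; last lra.
  by rewrite invf_le1; lra.
have B2 : `|x / (2 * (2 + x)) * x ^+ 2| <= `|x| * x ^+ 2.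
  rewrite normrM (ger0_norm (sqr_ge0 _)) ler_wpM2r ?sqr_ge0//.
  rewrite normrM ler_piMr// ger0_norm ?invr_ge0; last lra.
  by rewrite invf_le1; lra.
rewrite -E1 in B1; rewrite -E2 in B2.
have [x0|x0] := leP 0 x.
  have h := @ln_le_sinh (1 + x); rewrite lerDl in h; move/(_ x0) in h.
  have h' := @ln_ge_mobius (1 + x); rewrite lerDl in h'; move/(_ x0) in h'.
  move: B1 B2; rewrite !ler_norml => /andP[? ?] /andP[? ?].
  by apply/andP; split; lra.
have x01 : 0 < 1 + x <= 1 by apply/andP; split; lra.
have h := ln_le_mobius x01; have h' := ln_ge_sinh x01.
move: B1 B2; rewrite !ler_norml => /andP[? ?] /andP[? ?].
by apply/andP; split; lra.
Qed.

End LogBounds.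

(** * Equality of weighted laws *)

Section WeightedLaw.
Local Open Scope ereal_scope.
Context d (T : measurableType d) d' (T' : measurableType d') (R : realType).
Variables (mu : {measure set T -> \bar R}) (kap : T -> R) (Y : T -> T').
Hypotheses (mkap : measurable_fun setT kap) (kap0 : forall x, (0 <= kap x)%R).
Hypothesis mY : measurable_fun setT Y.

(** Image under [Y] of the measure with density [kap] with respect to [mu]. The hypotheses are
    arguments so that the measure structure can be attached to the function itself. Tilting, affine
    substitution and independence all become equalities between two such laws. *)
Definition weighted_law of measurable_fun setT kap & (forall x, (0 <= kap x)%R) &
  measurable_fun setT Y := fun B : set T' => \int[mu]_(x in Y @^-1` B) (kap x)%:E.

Local Notation nu := (weighted_law mkap kap0 mY).

Let nu0 : nu set0 = 0.
Proof. by rewrite /weighted_law preimage_set0 integral_set0. Qed.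

Let nu_ge0 B : 0 <= nu B.
Proof. by apply: integral_ge0 => x _; rewrite lee_fin. Qed.

Let nu_sigma : semi_sigma_additive nu.
Proof.
move=> F mF tF mUF; rewrite /weighted_law preimage_bigcup.
have mYF i : measurable (Y @^-1` F i).
  by rewrite -[X in measurable X]setTI; exact: mY.
apply: (@semi_sigma_additive_nng_induced _ _ _ mu (EFin \o kap)) => //=.
- exact/measurable_EFinP.
- by apply/trivIsetP => i j _ _ ij; rewrite -preimage_setI;
    move/trivIsetP : tF => -> //; rewrite preimage_set0.
- exact: bigcup_measurable.
Qed.

HB.instance Definition _ := isMeasure.Build _ _ _ nu nu0 nu_ge0 nu_sigma.

Import HBNNSimple.

(** True by definition for indicators, then for simple functions by linearity and in general by
    monotone convergence on both sides. *)
Lemma ge0_integral_weighted_law (f : T' -> \bar R) :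
  measurable_fun setT f -> (forall y, 0 <= f y) ->
  \int[nu]_y f y = \int[mu]_x ((kap x)%:E * f (Y x)).
Proof.
move=> mf f0; pose h := nnsfun_approx measurableT mf.
have hcvg y : (h n y)%:E @[n --> \oo] --> f y by apply: cvg_nnsfun_approx.
have hnd y : {homo (fun n => (h n y)%:E) : a b / (a <= b)%N >-> a <= b}.
  by move=> a b ab; rewrite lee_fin; exact/lefP/nd_nnsfun_approx.
have mYB B : measurable B -> measurable (Y @^-1` B).
  by move=> mB; rewrite -[X in measurable X]setTI; exact: mY.
have -> : \int[nu]_y f y = limn (fun n => \int[nu]_y (h n y)%:E).
  rewrite -monotone_convergence//.
  - by apply: eq_integral => y _; apply/esym/cvg_lim.
  - by move=> n; exact/measurable_EFinP/measurable_funP.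
  - by move=> n y _; rewrite lee_fin.
have mhY n : measurable_fun setT (fun x => (h n (Y x))%:E).
  by apply/measurable_EFinP; apply: measurableT_comp => //; exact/measurable_funP.
have -> : \int[mu]_x ((kap x)%:E * f (Y x)) =
    limn (fun n => \int[mu]_x ((kap x)%:E * (h n (Y x))%:E)).
  rewrite -monotone_convergence//.
  - apply: eq_integral => x _; apply/esym/cvg_lim => //.
    by apply: cvgeZl.
  - by move=> n; apply: emeasurable_funM => //; exact/measurable_EFinP.
  - by move=> n x _; rewrite mule_ge0// lee_fin.
  - by move=> x _ a b ab; rewrite lee_wpmul2l// ?lee_fin//; exact: hnd.
congr (limn _); apply/funext => n.
under [LHS]eq_integral do rewrite fimfunE -fsumEFin//.
rewrite ge0_integral_fsum//; last 2 first.
- by move=> r; apply/measurable_EFinP/measurable_funM => //.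
- by move=> r y _; exact: nnfun_muleindic_ge0.
under [RHS]eq_integral => x _.
  rewrite fimfunE -fsumEFin// ge0_mule_fsumr; last first.
    by move=> r; exact: nnfun_muleindic_ge0.
  over.
have mB r : measurable (h n @^-1` [set r]) by [].
have mBY r : measurable_fun setT (fun x => \1_(h n @^-1` [set r]) (Y x) : R).
  by apply: (measurableT_comp _ mY) => //.
rewrite ge0_integral_fsum//; last 2 first.
- move=> r; apply: emeasurable_funM; apply/measurable_EFinP => //.
  by apply: measurable_funM.
- by move=> r x _; apply: mule_ge0; [rewrite lee_fin|exact: nnfun_muleindic_ge0].
apply: eq_fsbigr => r /[!inE] -[y _ hy].
have r0 : (0 <= r)%R by rewrite -hy.
under eq_integral do rewrite EFinM.
rewrite ge0_integralZl; [|by []|exact/measurable_EFinP|by move=> x _; rewrite lee_fin|by rewrite lee_fin].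
rewrite integral_indic// setIT.
transitivity (\int[mu]_x (r%:E * ((kap x)%:E * (\1_(h n @^-1` [set r]) (Y x))%:E))).
  rewrite ge0_integralZl; [|by []| | |by rewrite lee_fin]; last 2 first.
  - by apply: emeasurable_funM; apply/measurable_EFinP.
  - by move=> x _; rewrite mule_ge0 ?lee_fin.
  congr (_ * _); rewrite /= /weighted_law [LHS]integral_mkcond; apply: eq_integral => x _.
  rewrite patchE -EFinM indicE.
  have -> : (Y x \in h n @^-1` [set r]) = (x \in Y @^-1` (h n @^-1` [set r])) by [].
  by case: ifP => _; rewrite ?mulr1 ?mulr0.
by apply: eq_integral => x _; rewrite EFinM muleCA.
Qed.

End WeightedLaw.

Section EqualLaws.
Local Open Scope ereal_scope.
Context (R : realType).
Context d1 (T1 : measurableType d1) (mu1 : {measure set T1 -> \bar R}).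
Context d2 (T2 : measurableType d2) (mu2 : {measure set T2 -> \bar R}).
Context d' (T' : measurableType d').
Variables (kap1 : T1 -> R) (Y1 : T1 -> T') (kap2 : T2 -> R) (Y2 : T2 -> T').
Hypotheses (mkap1 : measurable_fun setT kap1) (kap10 : forall x, (0 <= kap1 x)%R).
Hypotheses (mkap2 : measurable_fun setT kap2) (kap20 : forall x, (0 <= kap2 x)%R).
Hypotheses (mY1 : measurable_fun setT Y1) (mY2 : measurable_fun setT Y2).

Lemma eq_weighted_law (f : T' -> \bar R) :
  (forall B, measurable B -> \int[mu1]_(x in Y1 @^-1` B) (kap1 x)%:E =
                             \int[mu2]_(x in Y2 @^-1` B) (kap2 x)%:E) ->
  measurable_fun setT f -> (forall y, 0 <= f y) ->
  \int[mu1]_x ((kap1 x)%:E * f (Y1 x)) = \int[mu2]_x ((kap2 x)%:E * f (Y2 x)).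
Proof.
move=> H mf f0.
rewrite -(ge0_integral_weighted_law mu1 mkap1 kap10 mY1)//.
rewrite -(ge0_integral_weighted_law mu2 mkap2 kap20 mY2)//.
by apply: eq_measure_integral => A mA _; exact: H.
Qed.

(** Dynkin's uniqueness theorem: [G] is a generating pi-system containing the whole space, on which
    the common mass is finite. It is used with rectangles. *)
Lemma eq_weighted_law_pi (G : set (set T')) (f : T' -> \bar R) :
  @measurable _ T' = <<s G >> -> setI_closed G -> G setT ->
  \int[mu1]_x (kap1 x)%:E < +oo ->
  (forall B, G B -> \int[mu1]_(x in Y1 @^-1` B) (kap1 x)%:E =
                    \int[mu2]_(x in Y2 @^-1` B) (kap2 x)%:E) ->
  measurable_fun setT f -> (forall y, 0 <= f y) ->
  \int[mu1]_x ((kap1 x)%:E * f (Y1 x)) = \int[mu2]_x ((kap2 x)%:E * f (Y2 x)).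
Proof.
move=> mG GI GT foo H; apply: eq_weighted_law => B mB.
apply: (@measure_unique _ _ _ G (fun=> setT) mG GI _ _
  (weighted_law mu1 mkap1 kap10 mY1) (weighted_law mu2 mkap2 kap20 mY2)) => //.
by apply/seteqP; split => // x _; exists 0%N.
Qed.

End EqualLaws.

Section Affine.
Local Open Scope ereal_scope.
Context (R : realType).
Local Notation leb := (@lebesgue_measure R).

(** The image of c dx under x -> b + c x gives ]u, v] the mass v - u, hence is Lebesgue measure. *)
Lemma ge0_integral_affine (b c : R) (f : R -> \bar R) : (0 < c)%R ->
  measurable_fun setT f -> (forall y, 0 <= f y) ->
  \int[leb]_y f y = \int[leb]_x (c%:E * f (b + c * x)%R).
Proof.
move=> c0 mf f0.
have mY : measurable_fun setT
    ((fun x : R => b + c * x)%R : measurableTypeR R -> measurableTypeR R).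
  by apply: measurable_funD => //; exact: measurable_funM.
have mk : measurable_fun setT (fun _ : R => c) by [].
have k0 (x : R) : (0 <= c)%R by exact: ltW.
rewrite -(ge0_integral_weighted_law leb mk k0 mY)//.
apply: eq_measure_integral => A mA _.
apply: lebesgue_measure_unique => // _ [[u v] /= _ <-].
rewrite /= /weighted_law (_ : _ @^-1` _ = `]((u - b) / c)%R, ((v - b) / c)%R]%classic); last first.
  by apply/seteqP; split => x /=;
    rewrite !in_itv/= ltr_pdivrMr// ler_pdivlMr// ltrBlDl lerBrDl [(x * c)%R]mulrC.
rewrite integral_cst//.
rewrite lebesgue_measure_itv/= (lebesgue_measure_itv `]((u - b) / c)%R, ((v - b) / c)%R])/= !lte_fin.
rewrite ltr_pM2r ?invr_gt0// ltrD2r; case: ifP => _; last by rewrite mule0.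
by rewrite -!EFinB -EFinM; congr EFin; field; rewrite gt_eqF.
Qed.

End Affine.

(** * Independence and laws of random vectors *)

Section Bounded.
Context d (T : measurableType d) (R : realType) (Q : probability T R).
Implicit Types f g : T -> R.

Lemma bounded_prob_integrable f M : measurable_fun setT f ->
  (forall x, `|f x| <= M) -> Q.-integrable setT (EFin \o f).
Proof.
move=> mf fM; apply: (@le_integrable _ _ _ Q setT measurableT _ (cst M%:E)) => //.
- exact/measurable_EFinP.
- by move=> x _ /=; rewrite lee_fin (le_trans (fM x))// ler_norm.
- exact: finite_measure_integrable_cst.
Qed.

Lemma EFin_prob_Rintegral f M : measurable_fun setT f ->
  (forall x, `|f x| <= M) ->
  (Rintegral Q setT f)%:E = (\int[Q]_x (f x)%:E)%E.
Proof.
move=> mf fM; rewrite /Rintegral fineK//.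
by apply: integrable_fin_num => //; exact: bounded_prob_integrable mf fM.
Qed.

Lemma Rintegral_prob_cst (c : R) : Rintegral Q setT (fun=> c) = c.
Proof. rewrite Rintegral_cst//; set q := fine _.
have -> : q = 1 by exact: (congr1 fine (probability_setT Q)).
by rewrite mulr1. Qed.

End Bounded.

Section ProdMeasurable.
Context d (T : measurableType d) (R : realType).

Lemma measurable_prod_bigop (I : Type) (r : seq I) (P : pred I) (h : I -> T -> R) :
  (forall i, measurable_fun setT (h i)) ->
  measurable_fun setT (fun x => \prod_(i <- r | P i) h i x).
Proof.
move=> mh; elim: r => [|i r IH].
  by under eq_fun do rewrite big_nil; exact: measurable_cst.
under eq_fun do rewrite big_cons; case: (P i) => //.
exact: measurable_funM.
Qed.

Lemma measurable_sum_bigop (I : Type) (r : seq I) (P : pred I) (h : I -> T -> R) :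
  (forall i, measurable_fun setT (h i)) ->
  measurable_fun setT (fun x => \sum_(i <- r | P i) h i x).
Proof.
move=> mh; elim: r => [|i r IH].
  by under eq_fun do rewrite big_nil; exact: measurable_cst.
under eq_fun do rewrite big_cons; case: (P i) => //.
exact: measurable_funD.
Qed.

End ProdMeasurable.

Section IndependentProduct.
Context d (T : measurableType d) (R : realType) (Q : probability T R).
Variables (k : nat) (Z : 'I_k -> T -> R).
Hypotheses (mZ : forall i, measurable_fun setT (Z i)) (iZ : indep_family Q Z).

Lemma indep_Rintegral_prod (g : 'I_k -> R -> R) :
  (forall i, measurable_fun setT (g i)) -> (forall i x, 0 <= g i x <= 1) ->
  Rintegral Q setT (fun w => \prod_(i < k) g i (Z i w)) =
  \prod_(i < k) Rintegral Q setT (fun w => g i (Z i w)).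
Proof.
(* Independence is given for sets only. Outside s the functions are indicators, and the induction
   frees one coordinate at a time. *)
suff H : forall (s : seq 'I_k) (g : 'I_k -> R -> R),
    (forall i, measurable_fun setT (g i)) -> (forall i x, 0 <= g i x <= 1) ->
    (forall i, i \notin s -> exists2 B, measurable B & g i = \1_B) ->
    Rintegral Q setT (fun w => \prod_(i < k) g i (Z i w)) =
    \prod_(i < k) Rintegral Q setT (fun w => g i (Z i w)).
  by move=> mg g01; apply: (H (enum 'I_k)) => // i; rewrite mem_enum.
elim => [|x s IH] {}g mg g01 gB.
  have /choice[B hB] : forall i, exists B, measurable B /\ g i = \1_B.
    by move=> i; case: (gB i isT) => B mB gi; exists B.
  have mB i : measurable (B i) by case: (hB i).
  have gE i : g i = \1_(B i) by case: (hB i).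
  have mZB i : measurable (Z i @^-1` B i).
    by rewrite -[X in measurable X]setTI; exact: mZ.
  have -> : (fun w => \prod_(i < k) g i (Z i w)) =
      \1_(\bigcap_(i in [set: 'I_k]) (Z i @^-1` B i)).
    apply/funext => w; rewrite indicE; case: (boolP (w \in _)) => [|].
      rewrite inE (_ : true%:R = 1)// => H; apply: big1 => i _.
      have BiZ : B i (Z i w) by exact: (H i).
      by rewrite gE indicE (mem_set BiZ).
    rewrite notin_setE => /existsNP[i /not_implyP[_ /= nB]].
    by rewrite (bigD1 i)//= gE indicE (memNset nB) mul0r.
  rewrite /Rintegral integral_indic//; last first.
    by apply: fin_bigcap_measurable => //; exact: finite_finset.
  rewrite setIT; apply: (eq_trans (congr1 fine (iZ mB))).
  have -> : (\prod_(i < k) Q (Z i @^-1` B i) =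
      \prod_(i < k) (fine (Q (Z i @^-1` B i)))%:E)%E.
    by apply: eq_bigr => i _; rewrite fineK// fin_num_measure.
  rewrite prodEFin/=; apply: eq_bigr => i _.
  rewrite gE (_ : integral _ _ _ = \int[Q]_w (\1_(Z i @^-1` B i) w)%:E)%E//.
  by rewrite integral_indic// setIT.
have Zg01 i w : 0 <= g i (Z i w) <= 1 by exact: g01.
have prod01 (P : pred 'I_k) (h : 'I_k -> R) : (forall i, 0 <= h i <= 1) ->
    0 <= \prod_(i < k | P i) h i <= 1.
  move=> h01; rewrite prodr_ge0 ?prodr_ile1//= => i _; by case/andP: (h01 i).
have mgZ i : measurable_fun setT (fun w => g i (Z i w)).
  exact: measurableT_comp.
pose kap w := \prod_(i < k | i != x) g i (Z i w).
pose c := \prod_(i < k | i != x) Rintegral Q setT (fun w => g i (Z i w)).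
have mkap : measurable_fun setT kap by exact: measurable_prod_bigop.
have kap0 w : 0 <= kap w by have /andP[] := prod01 (fun i => i != x) _ (Zg01 ^~ w).
have kap1 w : kap w <= 1 by have /andP[] := prod01 (fun i => i != x) _ (Zg01 ^~ w).
have R01 i : 0 <= Rintegral Q setT (fun w => g i (Z i w)).
  by apply: Rintegral_ge0 => w _; case/andP: (Zg01 i w).
have c0 (w : T) : 0 <= c by apply: prodr_ge0.
have mZB B : measurable B -> measurable (Z x @^-1` B).
  by move=> mB; rewrite -[X in measurable X]setTI; exact: mZ.
(* [Z x] has the same law under the weight [kap] and under the constant [c]: on a Borel set B this
   is the induction hypothesis with the indicator of B in place of [g x]. *)
have key : (\int[Q]_w ((kap w)%:E * (g x (Z x w))%:E) =
    \int[Q]_w (c%:E * (g x (Z x w))%:E))%E.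
  apply: (@eq_weighted_law _ _ _ Q _ _ Q _ _ kap (Z x) (fun=> c) (Z x) _ _ _ _ _ _
    (EFin \o g x)) => //=.
  - move=> B mB.
    pose g' i := if i == x then \1_B else g i.
    have mg' i : measurable_fun setT (g' i) by rewrite /g'; case: ifP.
    have g'01 i y : 0 <= g' i y <= 1.
      by rewrite /g'; case: ifP => // _; rewrite indicE; case: (_ \in _); rewrite ?lexx ?ler01.
    have := IH g' mg' g'01.
    rewrite (bigD1 x)//= (_ : \prod_(i < k | i != x) _ = c); last first.
      by apply: eq_bigr => i ix; rewrite /g' (negbTE ix).
    have -> : (fun w => \prod_(i < k) g' i (Z i w)) = (fun w => kap w * \1_B (Z x w)).
      apply/funext => w; rewrite (bigD1 x)//= {1}/g' eqxx mulrC; congr (_ * _).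
      by apply: eq_bigr => i ix; rewrite /g' (negbTE ix).
    rewrite /g' eqxx => H.
    have {}H := H _; rewrite [LHS]integral_mkcond [RHS]integral_mkcond.
    have iE (f : T -> R) : ((EFin \o f) \_ (Z x @^-1` B) =
        fun w => (f w * \1_B (Z x w))%:E)%E.
      apply/funext => w; rewrite patchE indicE.
      have -> : (Z x w \in B) = (w \in Z x @^-1` B) by [].
      by case: ifP; rewrite ?mulr1 ?mulr0.
    rewrite !iE.
    have mI : measurable_fun setT (fun w => \1_B (Z x w) : R) by exact: measurableT_comp.
    have I1 w : `|\1_B (Z x w) : R| <= 1.
      by rewrite indicE; case: (_ \in _); rewrite ?normr1 ?normr0.
    rewrite -(@EFin_prob_Rintegral _ _ _ _ _ 1); last 2 first.
    + exact: measurable_funM.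
    + by move=> w; rewrite normrM mulr_ile1// ger0_norm.
    rewrite -(@EFin_prob_Rintegral _ _ _ _ _ `|c|); last 2 first.
    + exact: measurable_funM.
    + by move=> w; rewrite normrM ler_piMr.
    rewrite H; last first.
      move=> i is_; rewrite /g'; case: ifPn => [_|ix]; first by exists B.
      by apply: gB; rewrite inE negb_or ix.
    rewrite RintegralZl//; first by rewrite mulrC.
    exact: bounded_prob_integrable mI I1.
  - exact/measurable_EFinP.
  - by move=> y; rewrite lee_fin; case/andP: (g01 x y).
rewrite [RHS](bigD1 x)//= -/c mulrC.
have -> : (fun w => \prod_(i < k) g i (Z i w)) = (fun w => kap w * g x (Z x w)).
  by apply/funext => w; rewrite (bigD1 x)//= mulrC.
have n1 w : `|g x (Z x w)| <= 1.
  by have /andP[a b] := Zg01 x w; rewrite ger0_norm.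
rewrite -RintegralZl//; last exact: bounded_prob_integrable (mgZ x) n1.
by rewrite /Rintegral; congr fine.
Qed.

End IndependentProduct.

Section VectorLaw.
Context (R : realType) (k : nat).

Definition rectangles : set (set ('I_k -> R)) :=
  [set C | exists2 B : 'I_k -> set R, (forall i, measurable (B i)) &
     C = \bigcap_(i in [set: 'I_k]) ((fun y => y i) @^-1` B i)].

(** The sigma-algebra is generated by exactly the sets on which [same_joint_law] compares two
    vectors, so such an equality extends to all measurable functions of the vector. *)
Definition vec := g_sigma_algebraType rectangles.

Lemma rectangles_setI : setI_closed rectangles.
Proof.
move=> _ _ [B mB ->] [C mC ->]; exists (fun i => B i `&` C i).
  by move=> i; exact: measurableI.
apply/seteqP; split => y.
  by move=> [h1 h2] i _; split; [exact: h1|exact: h2].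
by move=> h; split => i _; have [] := h i I.
Qed.

Lemma rectangles_setT : rectangles setT.
Proof. by exists (fun=> setT) => //; apply/seteqP; split => y. Qed.

Lemma measurable_coord i : measurable_fun setT (fun y : vec => y i).
Proof.
move=> _ B mB; rewrite setTI; apply: sub_sigma_algebra.
exists (fun j => if j == i then B else setT).
  by move=> j; case: ifP.
apply/seteqP; split => y /=; first by move=> By j _ /=; case: eqP => // ->.
by move=> /(_ i I) /=; rewrite eqxx.
Qed.

Lemma measurable_vec d (T : measurableType d) (Y : T -> vec) :
  (forall i, measurable_fun setT (fun w => Y w i)) -> measurable_fun setT Y.
Proof.
move=> mY; apply: (@measurability _ _ T vec setT Y rectangles) => //.
move=> _ [_ [B mB ->] <-]; rewrite setTI preimage_bigcap.
apply: fin_bigcap_measurable; first exact: finite_finset.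
by move=> i _; have := mY i measurableT _ (mB i); rewrite setTI.
Qed.

Lemma same_joint_law_integral d (T : measurableType d) (Q : probability T R)
  d' (T' : measurableType d') (Q' : probability T' R)
  (Y : T -> vec) (W : T' -> vec) (f : vec -> R) :
  (forall i, measurable_fun setT (fun w => Y w i)) ->
  (forall i, measurable_fun setT (fun w => W w i)) ->
  same_joint_law Q Q' Y W -> measurable_fun setT f -> (forall y, 0 <= f y) ->
  Rintegral Q setT (fun w => f (Y w)) = Rintegral Q' setT (fun w => f (W w)).
Proof.
move=> mY mW YW mf f0.
have /= := @eq_weighted_law_pi R _ _ Q _ _ Q' _ vec (fun=> 1) Y (fun=> 1) W
  (measurable_cst _) (fun=> ler01) (measurable_cst _) (fun=> ler01)
  (measurable_vec mY) (measurable_vec mW) rectangles (EFin \o f) erefl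
  rectangles_setI rectangles_setT.
have H1 : (\int[Q]_x 1%:E < +oo :> \bar R)%E.
  by rewrite integral_cst//= mul1e probability_setT ltry.
move=> /(_ H1); under eq_integral do rewrite mul1e.
under [in X in _ -> _ -> _ -> _ = X]eq_integral do rewrite mul1e.
move=> H; rewrite /Rintegral H//.
- move=> _ [B mB ->].
  have mC d0 (U : measurableType d0) (V : U -> vec) :
      (forall i, measurable_fun setT (fun w => V w i)) ->
      measurable (V @^-1` (\bigcap_(i in [set: 'I_k]) ((fun y => y i) @^-1` B i))).
    move=> mV; rewrite -[X in measurable X]setTI; apply: (measurable_vec mV) => //.
    by apply: sub_sigma_algebra; exists B.
  rewrite !integral_cst//; [|exact: mC..].
  by rewrite !mul1e !preimage_bigcap; exact: YW.
- exact/measurable_EFinP.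
Qed.

End VectorLaw.

(** * The Gamma kernel *)

Section GammaLaw.
Context (R : realType).
Local Notation leb := (@lebesgue_measure R).
Implicit Types a b t x z : R.

(** The kernel extended by 0, so that affine substitutions can be made over the whole line. *)
Definition pos_gamma a z : R := if 0 < z then gamma_kernel a z else 0.

Lemma pos_gamma_ge0 a z : 0 <= pos_gamma a z.
Proof. by rewrite /pos_gamma; case: ifP => // _; rewrite mulr_ge0 ?powR_ge0 ?expR_ge0. Qed.

Lemma measurable_gamma_kernel a : measurable_fun setT (@gamma_kernel R a).
Proof.
apply: measurable_funM; first exact: measurable_powR.
apply: continuous_measurable_fun => z.
by apply: (@continuous_comp _ _ _ -%R (@expR R));
  [exact: opp_continuous|exact: continuous_expR].
Qed.

Lemma pos_gamma_restrict a : pos_gamma a = (gamma_kernel a) \_ `]0, +oo[%classic.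
Proof.
apply/funext => z; rewrite patchE /pos_gamma.
case: ifPn => [z0|z0]; first by rewrite mem_set//= in_itv/= z0.
by rewrite memNset//= in_itv/= andbT; exact/negP.
Qed.

Lemma measurable_pos_gamma a : measurable_fun setT (pos_gamma a).
Proof.
rewrite pos_gamma_restrict; have mI : measurable (`]0, +oo[%classic : set R) by exact: measurable_itv.
have [+ _] := measurable_restrictT (@gamma_kernel R a) mI; apply.
by apply: measurable_funTS; exact: measurable_gamma_kernel.
Qed.

(** Exponential tilting of a Gamma kernel is a dilation; the factor t is kept apart because it is
    the Jacobian of z -> t z. *)
Lemma pos_gamma_scale a t z : 0 < t ->
  expR (- ((t - 1) * z)) * pos_gamma a z = t `^ (- a) * (t * pos_gamma a (t * z)).
Proof.
move=> t0; rewrite /pos_gamma pmulr_rgt0//; case: ifP => [z0|_]; last by rewrite !mulr0.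
rewrite /gamma_kernel powRM ?(ltW t0) ?(ltW z0)//.
have -> : t `^ (- a) * (t * (t `^ (a - 1) * z `^ (a - 1) * expR (- (t * z)))) =
  (t `^ (- a) * t `^ 1 * t `^ (a - 1)) * (z `^ (a - 1) * expR (- (t * z))).
  by rewrite powRr1 ?ltW//; ring.
have tn : t != 0 by rewrite gt_eqF.
rewrite -powRD; last by rewrite tn implybT.
rewrite -powRD; last by rewrite tn implybT.
rewrite (_ : - a + 1 + (a - 1) = 0); last by ring.
rewrite powRr0 mul1r mulrCA -expRD; congr (_ * expR _); ring.
Qed.

(** The kernel is below the derivative [f] of the bounded function [F], which controls the
    singularity at 0 and the tail at once. *)
Lemma integral_pos_gamma_lty a : 0 < a -> (\int[leb]_z (pos_gamma a z)%:E < +oo)%E.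
Proof.
move=> a0.
(* From (a + 1) e^(z / (a + 1)) >= 1 + z follows e^(-z) <= ((a + 1) / (1 + z))^(a + 1); the division
   by a offsets the factor a from differentiating (z / (1 + z))^a. *)
pose C := (a + 1) `^ (a + 1) / a.
pose F z := C * (z / (1 + z)) `^ a.
pose f z := C * (a * z `^ (a - 1) * (1 + z) `^ (- (a + 1))).
have C0 : 0 <= C by rewrite divr_ge0 ?powR_ge0// ltW.
have kf z : 0 < z -> gamma_kernel a z <= f z.
  move=> z0; rewrite /f /C /gamma_kernel.
  have z1 : 0 < 1 + z by rewrite addr_gt0.
  have a1 : 0 < a + 1 by rewrite addr_gt0.
  rewrite (_ : _ / a * _ = z `^ (a - 1) * ((a + 1) `^ (a + 1) * (1 + z) `^ (- (a + 1)))).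
    rewrite ler_wpM2l ?powR_ge0// powRN ler_pdivlMr ?powR_gt0//.
    rewrite expRN mulrC ler_pdivrMr ?expR_gt0//.
    rewrite (_ : expR z = expR (z / (a + 1)) `^ (a + 1)); last first.
      by rewrite -expRM divfK// gt_eqF.
    rewrite -powRM ?expR_ge0 ?(ltW a1)//.
    have /= := @ge0_ler_powR R (a + 1) (ltW a1) (1 + z) ((a + 1) * expR (z / (a + 1))).
    rewrite !nnegrE (ltW z1) mulr_ge0 ?expR_ge0 ?(ltW a1)// => mono; apply: mono => //.
    have := expR_ge1Dx (z / (a + 1)) => h.
    apply: (@le_trans _ _ ((a + 1) * (1 + z / (a + 1)))); last by rewrite ler_pM2l.
    by rewrite mulrDr mulr1 [_ * (z / _)]mulrC divfK ?gt_eqF//; lra.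
  by field; rewrite gt_eqF.
have dF z : 0 < z -> is_derive z 1 F (f z).
  move=> z0; have z1 : 1 + z != 0 by rewrite gt_eqF// addr_gt0.
  have dV := @is_derive1V R (cst 1 + id) z _ z1
    (is_deriveD (is_derive_cst (1 : R) z 1) (is_derive_id z 1)).
  have dq := is_deriveM (is_derive_id z 1) dV.
  have q0 : 0 < (id * (fun t : R => ((cst 1 + id) t)^-1)) z.
    by rewrite fctE/= divr_gt0// addr_gt0.
  have dp := is_derive1_powR a q0.
  have H := is_deriveZ C (is_derive1_comp dp dq).
  rewrite (_ : F = C \*: ((fun x : R => x `^ a) \o
      (id * (fun t : R => ((cst 1 + id) t)^-1)))); last by apply/funext => t.
  apply: is_derive_eq; rewrite /f; congr (_ * _).
  rewrite fctE /=  add0r /GRing.scale/= !mulr1 fctE/=.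
  have z10 : 0 < 1 + z by rewrite addr_gt0.
  rewrite powRM ?invr_ge0 ?(ltW z0) ?(ltW z10)// -(powR_inv1 (ltW z10)) -powRrM.
  rewrite (_ : z * _ + _ = (1 + z) `^ (-2)); last first.
    by rewrite (powR_inv1 (ltW z10)) (powR_invn 2 (ltW z10)); field.
  rewrite -!mulrA; do 2 congr (_ * _).
  rewrite -powRD ?z1 ?implybT//; congr (_ `^ _); ring.
have mk := measurable_gamma_kernel a.
(* The fundamental theorem is applied on compact intervals away from 0; starting at 2 keeps them
   nondegenerate. *)
pose I n : set R := `[(n.+2%:R)^-1, n.+2%:R]%classic.
have I0 n z : I n z -> 0 < z.
  by rewrite /I/= in_itv/= => /andP[+ _]; apply: lt_le_trans; rewrite invr_gt0.
have IU : \bigcup_n I n = `]0, +oo[%classic.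
  apply/seteqP; split => z /=.
    by move=> [n _ /I0]; rewrite in_itv/= andbT.
  rewrite in_itv/= andbT => z0.
  exists (maxn (Num.truncn z) (Num.truncn z^-1)) => //.
  rewrite /I/= in_itv/=; set m := maxn _ _.
  have h (y : R) : 0 < y -> (Num.truncn y <= m)%N -> y <= m.+2%:R.
    move=> y0 ym; apply: ltW; have t1 := truncnS_gt y; apply: (lt_le_trans t1).
    by rewrite ler_nat ltnS (leq_trans ym).
  apply/andP; split; last by apply: h => //; exact: leq_maxl.
  rewrite -[leRHS]invrK lef_pV2 ?posrE ?invr_gt0//.
  by apply: h; rewrite ?invr_gt0//; exact: leq_maxr.
have nI : nondecreasing_seq I.
  move=> n m nm; apply/subsetPset => z /=; rewrite /I/= !in_itv/= => /andP[h1 h2].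
  apply/andP; split; last by rewrite (le_trans h2)// ler_nat.
  by rewrite (le_trans _ h1)// lef_pV2 ?posrE// ler_nat.
have k0 z : 0 <= gamma_kernel a z by rewrite mulr_ge0 ?powR_ge0 ?expR_ge0.
have cv : (\int[leb]_(z in I n) (gamma_kernel a z)%:E @[n --> \oo] -->
    \int[leb]_(z in \bigcup_n I n) (gamma_kernel a z)%:E)%E.
  apply: ge0_nondecreasing_set_cvg_integral => //.
  - by move=> n; exact: measurable_itv.
  - by move=> n; apply: measurable_funTS; exact/measurable_EFinP.
  - by move=> n z _; rewrite lee_fin.
have -> : (\int[leb]_z (pos_gamma a z)%:E =
    \int[leb]_(z in \bigcup_n I n) (gamma_kernel a z)%:E)%E.
  rewrite IU [RHS]integral_mkcond; apply: eq_integral => z _.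
  by rewrite pos_gamma_restrict !patchE; case: ifP.
apply: (@le_lt_trans _ _ C%:E); last exact: ltry.
rewrite -(cvg_lim _ cv)//; apply: lime_le; first by apply/cvg_ex; eexists; exact: cv.
apply: nearW => n.
have In : (n.+2%:R)^-1 < n.+2%:R :> R.
  rewrite (@lt_trans _ _ 1)// ?ltr1n// invf_lt1// ltr1n//.
have cf : {within I n, continuous f}.
  apply: derivable_within_continuous => z; rewrite in_itv/= => zI.
  have z0 := I0 n z; rewrite /I/= in_itv/= zI in z0; have {}z0 := z0 isT.
  have z1 : 0 < (1 + id) z by rewrite fctE/= addr_gt0.
  have d1 := is_derive1_powR (a - 1) z0.
  have d2 := is_derive1_comp (is_derive1_powR (- (a + 1)) z1)
     (is_deriveD (is_derive_cst (1 : R) z 1) (is_derive_id z 1)).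
  have D := is_deriveZ C (is_deriveM (is_deriveZ a d1) d2).
  rewrite (_ : f = C \*: ((a \*: (fun x : R => x `^ (a - 1))) *
    ((fun x : R => x `^ (- (a + 1))) \o (cst 1 + id)))); last by apply/funext => t.
  exact: (@ex_derive _ _ _ _ _ _ _ D).
apply: (@le_trans _ _ (\int[leb]_(z in I n) (f z)%:E)%E).
  have mI : measurable (I n : set (measurableTypeR R)) by exact: measurable_itv.
  have mk' : measurable_fun (I n) (EFin \o gamma_kernel a).
    by apply: measurable_funTS; exact/measurable_EFinP.
  have mf : measurable_fun (I n) (EFin \o f).
    by apply/measurable_EFinP; apply: subspace_continuous_measurable_fun.
  by apply: (@ge0_le_integral _ _ _ leb _ mI) => // z Iz; rewrite /= lee_fin;
    first [exact: k0 | exact: kf (I0 _ _ Iz) | exact: le_trans (k0 z) (kf _ (I0 _ _ Iz))].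
rewrite (@continuous_FTC2 _ f F)//.
- rewrite -EFinB lee_fin /F -mulrBr ler_piMr//.
  rewrite lerBlDr (@le_trans _ _ 1)// ?lerDl ?powR_ge0//.
  have n0 : 0 < 1 + n.+2%:R :> R by rewrite addr_gt0.
  have /= mono := @ge0_ler_powR R a (ltW a0) (n.+2%:R / (1 + n.+2%:R)) 1.
  rewrite powR1 in mono; apply: mono; rewrite ?nnegrE ?divr_ge0 ?(ltW n0)//.
  by rewrite ler_pdivrMr// mul1r lerDr.
- have dF' z : 0 < z -> derivable F z 1.
    by move=> z0; exact: (@ex_derive _ _ _ _ _ _ _ (dF z z0)).
  have cF z : 0 < z -> {for z, continuous F}.
    by move=> z0; apply: differentiable_continuous; apply/derivable1_diffP; exact: dF'.
  split.
  + by move=> z zI; apply: dF'; apply: (I0 n); exact: subset_itv_oo_cc.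
  + by apply: cvg_at_right_filter; apply: cF; rewrite invr_gt0.
  + by apply: cvg_at_left_filter; apply: cF.
- move=> z zI; have zI' : I n z by exact: subset_itv_oo_cc.
  by rewrite derive1E; have := dF z (I0 _ _ zI') => ?; rewrite derive_val.
Qed.
End GammaLaw.

(** * Normalised weighted integrals as expectation functionals *)

Section WeightedExpectation.
Context d (T : measurableType d) (R : realType) (mu : {measure set T -> \bar R}).
Variables (kap : T -> R) (Y : T -> R).
Hypotheses (kap0 : forall x, 0 <= kap x) (ikap : mu.-integrable setT (EFin \o kap)).
Hypothesis mY : measurable_fun setT Y.
Hypothesis Y0 : forall x, kap x != 0 -> 0 <= Y x.

(** One form for Gamma and chi-squared laws ([mu] Lebesgue, [Y] the identity), for the law of D
    (weight 1) and for S reweighted by a function of Z / S. Hence [Y] is required to be nonnegative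
    only where the weight does not vanish. *)
Definition weighted_expectation (f : R -> R) : R :=
  Rintegral mu setT (fun x => f (Y x) * kap x) / Rintegral mu setT kap.

Let mkap : measurable_fun setT kap.
Proof. by have /measurable_int/measurable_EFinP := ikap. Qed.

Lemma integrable_mul_weight (g : T -> R) M : measurable_fun setT g ->
  (forall x, kap x != 0 -> `|g x| <= M) ->
  mu.-integrable setT (EFin \o (fun x => g x * kap x)).
Proof.
move=> mg gM.
have iM : mu.-integrable setT (EFin \o (fun x => M * kap x)).
  rewrite (_ : _ \o _ = (fun x => M%:E * (EFin \o kap) x)%E); last first.
    by apply/funext => x.
  exact: integrableZl.
apply: le_integrable iM => //.
- by apply/measurable_EFinP; exact: measurable_funM.
- move=> x _; rewrite /= lee_fin normrM (ger0_norm (kap0 x)).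
  have [->|kx] := eqVneq (kap x) 0; first by rewrite !mulr0 normr0.
  have M0 : 0 <= M by exact: le_trans (gM x kx).
  by rewrite (@ger0_norm _ (M * kap x)) ?mulr_ge0// ler_wpM2r// gM.
Qed.

Lemma nneg_expectation_weighted : 0 < Rintegral mu setT kap ->
  nneg_expectation weighted_expectation.
Proof.
move=> K0.
have ib f : bounded_nneg f -> mu.-integrable setT (EFin \o (fun x => f (Y x) * kap x)).
  move=> [cf [M fM]]; apply: (integrable_mul_weight (M := M)).
    by apply: measurableT_comp => //; exact: continuous_measurable_fun.
  by move=> x /Y0; exact: fM.
rewrite /weighted_expectation; split.
- move=> f g c bf bg; rewrite mulrA -mulrDl; congr (_ / _).
  under eq_Rintegral do rewrite mulrDl -mulrA.
  rewrite RintegralD//.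
  + by congr (_ + _); rewrite RintegralZl//; exact: ib.
  + exact: ib.
  + pose h := EFin \o (fun x => g (Y x) * kap x).
    by apply: (@integrableZl _ _ _ mu _ measurableT c h); exact: ib.
- move=> f bf f0; rewrite divr_ge0 ?(ltW K0)//; apply: Rintegral_ge0 => x _.
  have [->|kx] := eqVneq (kap x) 0; first by rewrite mulr0.
  by rewrite mulr_ge0// f0// Y0.
- by under eq_Rintegral do rewrite mul1r; rewrite divff// gt_eqF.
Qed.

End WeightedExpectation.

Section GammaExpectation.
Context (R : realType).
Local Notation leb := (@lebesgue_measure R).
Implicit Types a b s t x z : R.

Lemma GammafE a : Gammaf a = Rintegral leb setT (@pos_gamma R a).
Proof. by rewrite /Gammaf Rintegral_mkcond -pos_gamma_restrict. Qed.

Lemma integrable_pos_gamma a : 0 < a -> leb.-integrable setT (EFin \o @pos_gamma R a).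
Proof.
move=> a0; apply/integrableP; split.
  by apply/measurable_EFinP; exact: measurable_pos_gamma.
under eq_integral do rewrite /= ger0_norm ?pos_gamma_ge0//.
exact: integral_pos_gamma_lty.
Qed.

Lemma integral_pos_gamma a : 0 < a ->
  (\int[leb]_z (pos_gamma a z)%:E = (Gammaf a)%:E)%E.
Proof.
move=> a0; rewrite GammafE /Rintegral fineK//.
by apply: integrable_fin_num => //; exact: integrable_pos_gamma.
Qed.

Lemma Gammaf_gt0 a : 0 < a -> 0 < Gammaf a.
Proof.
move=> a0; rewrite -lte_fin -integral_pos_gamma//.
(* Lower bound of the kernel on [1, 2], where 0 <= ln z <= 2. *)
pose c := expR (- (2 * `|a - 1|)) * expR (- 2).
have c0 : 0 < c by rewrite mulr_gt0 ?expR_gt0.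
apply: (@lt_le_trans _ _ (\int[leb]_(z in `[1%R, 2%R]) (c%:E))%E).
  rewrite integral_cst//= lebesgue_measure_itv/= lte_fin ltr1n/= -EFinB -EFinM lte_fin.
  by rewrite mulr_gt0//; lra.
rewrite integral_mkcond; apply: ge0_le_integral => //=.
- by move=> z _; rewrite patchE; case: ifP => // _; rewrite lee_fin ltW.
- by apply/(measurable_restrictT _ _).1.
- by apply/measurable_EFinP; exact: measurable_pos_gamma.
- move=> z _; rewrite patchE; case: ifPn => [|_]; last first.
    by rewrite lee_fin pos_gamma_ge0.
  rewrite inE/= in_itv/= => /andP[z1 z2]; rewrite lee_fin.
  have z0 : 0 < z by exact: lt_le_trans z1.
  rewrite /pos_gamma z0 /gamma_kernel /c ler_pM ?expR_ge0//; last by rewrite ler_expR lerN2.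
  rewrite /powR gt_eqF// ler_expR.
  have l0 : 0 <= ln z by exact: ln_ge0.
  have l2 : ln z <= 2 by rewrite (le_trans (ltW (ln_sublinear z0))).
  have : - `|a - 1| <= a - 1 by rewrite lerNl -normrN ler_norm.
  have := normr_ge0 (a - 1); nra.
Qed.

Definition gamma_expectation a : (R -> R) -> R :=
  weighted_expectation leb (pos_gamma a) id.

Lemma nneg_expectation_gamma a : 0 < a -> nneg_expectation (gamma_expectation a).
Proof.
move=> a0; apply: nneg_expectation_weighted.
- exact: pos_gamma_ge0.
- exact: integrable_pos_gamma.
- exact: measurable_id.
- by move=> z; rewrite /pos_gamma; case: ifP => [/ltW//|_]; rewrite eqxx.
- by rewrite -GammafE; exact: Gammaf_gt0.
Qed.

Lemma ge0_integral_pos_gamma_tilt a s (f : R -> R) : 0 <= s ->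
  measurable_fun setT f -> (forall z, 0 <= f z) ->
  (\int[leb]_z (f z * expR (- (s * z)) * pos_gamma a z)%:E =
   ((1 + s) `^ (- a))%:E * \int[leb]_y (f ((1 + s)^-1 * y) * pos_gamma a y)%:E)%E.
Proof.
move=> s0 mf f0; have s1 : 0 < 1 + s by rewrite ltr_wpDr.
have mg : measurable_fun setT (fun y => (f ((1 + s)^-1 * y) * pos_gamma a y)).
  apply: measurable_funM; last exact: measurable_pos_gamma.
  by apply: measurableT_comp => //; exact: measurable_funM.
rewrite (@ge0_integral_affine R 0 (1 + s) (fun y => (f ((1 + s)^-1 * y) * pos_gamma a y)%:E))//.
- rewrite -ge0_integralZl//; last 3 first.
  + apply: measurable_funeM; apply/measurable_EFinP.
    have mY : measurable_fun setT (fun x : R => 0 + (1 + s) * x).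
      by apply: measurable_funD => //; exact: measurable_funM.
    exact: (measurableT_comp mg mY).
  + by move=> z _; rewrite -EFinM lee_fin mulr_ge0 ?(ltW s1)// mulr_ge0// pos_gamma_ge0.
  + by rewrite lee_fin powR_ge0.
  apply: eq_integral => z _; rewrite -!EFinM add0r mulKf ?gt_eqF//.
  congr EFin; rewrite -mulrA.
  have := @pos_gamma_scale R a (1 + s) z s1.
  by rewrite (_ : 1 + s - 1 = s) => [->|]; ring.
- exact/measurable_EFinP.
- by move=> y; rewrite lee_fin mulr_ge0// pos_gamma_ge0.
Qed.

Lemma gamma_expectation_expN a s : 0 < a -> 0 <= s ->
  gamma_expectation a (fun z => expR (- (s * z))) = (1 + s) `^ (- a).
Proof.
move=> a0 s0; rewrite /gamma_expectation /weighted_expectation -GammafE.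
have := @ge0_integral_pos_gamma_tilt a s (cst 1) s0 (measurable_cst _) (fun=> ler01).
under eq_integral do rewrite mul1r.
under [in X in _ = (_ * X)%E -> _]eq_integral do rewrite mul1r.
rewrite integral_pos_gamma// -EFinM /Rintegral => -> /=.
by rewrite mulfK// gt_eqF// Gammaf_gt0.
Qed.

End GammaExpectation.

(** * Asymptotics of Gamma laws *)

Section GammaAsymptotics.
Context (R : realType).
Local Notation leb := (@lebesgue_measure R).
Implicit Types a b s t x z w : R.

(* Density of (Z - b) / sqrt b, up to a constant, for Z ~ Gamma(b + 1, 1). *)
Definition gamma_profile b w : R :=
  if - Num.sqrt b < w then expR (gamma_exponent b w) else 0.

Lemma gamma_profile_ge0 b w : 0 <= gamma_profile b w.
Proof. by rewrite /gamma_profile; case: ifP => // _; exact: expR_ge0. Qed.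

(** The prefactor b^b e^(-b) cancels in the quotient defining [gamma_expectation], leaving only the
    profile. *)
Lemma pos_gamma_profile b w : 0 < b ->
  pos_gamma (b + 1) (b + Num.sqrt b * w) = b `^ b * expR (- b) * gamma_profile b w.
Proof.
move=> b0; have s0 : 0 < Num.sqrt b by rewrite sqrtr_gt0.
have sb : Num.sqrt b ^+ 2 = b by rewrite sqr_sqrtr// ltW.
have E : (0 < b + Num.sqrt b * w) = (- Num.sqrt b < w).
  by rewrite -{1}sb expr2 -mulrDr pmulr_rgt0// -ltrBlDl sub0r.
rewrite /pos_gamma /gamma_profile E; case: ifP => [sw|_]; last by rewrite mulr0.
rewrite /gamma_kernel addrK /gamma_exponent.
have x1 : 0 < 1 + w / Num.sqrt b.
  by rewrite -(pmulr_rgt0 _ s0) mulrDr mulr1 mulrC divfK ?gt_eqF//; lra.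
have -> : b + Num.sqrt b * w = b * (1 + w / Num.sqrt b).
  by rewrite -{1 3}sb; field; rewrite gt_eqF.
rewrite powRM ?(ltW b0) ?(ltW x1)// -!mulrA; congr (_ * _).
rewrite {1}/powR gt_eqF// -!expRD; congr expR; ring.
Qed.

Lemma gamma_profile_le b w : 1 <= b ->
  gamma_profile b w <= expR (2^-1) * expR (- (2^-1 * `|w|)).
Proof.
move=> b1; rewrite /gamma_profile; case: ifP => [sw|_]; last first.
  by rewrite mulr_ge0// expR_ge0.
rewrite -expRD ler_expR (le_trans (gamma_exponent_le b1 sw))//; lra.
Qed.

Lemma measurable_gamma_profile b : 0 < b -> measurable_fun setT (gamma_profile b).
Proof.
move=> b0; have c0 : b `^ b * expR (- b) != 0.
  by rewrite gt_eqF// mulr_gt0 ?powR_gt0 ?expR_gt0.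
rewrite (_ : gamma_profile b = (fun w =>
    (b `^ b * expR (- b))^-1 * pos_gamma (b + 1) (b + Num.sqrt b * w))).
  apply: measurable_funM => //.
  apply: (measurableT_comp (measurable_pos_gamma (b + 1))).
  by apply: measurable_funD => //; exact: measurable_funM.
by apply/funext => w; rewrite pos_gamma_profile// mulKf.
Qed.

Lemma integrable_expN_norm s : 0 < s ->
  leb.-integrable setT (EFin \o (fun w : R => expR (- (s * `|w|)))).
Proof.
move=> s0.
have cf : continuous (fun w : R => expR (- (s * `|w|))).
  move=> w; apply: continuous_comp; last exact: continuous_expR.
  apply: cvgN; apply: cvgM; first exact: cvg_cst.
  exact: (@norm_continuous _ R).
apply/integrableP; split.
  by apply/measurable_EFinP; exact: continuous_measurable_fun.
under eq_integral do rewrite /= ger0_norm ?expR_ge0//.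
rewrite ge0_symfun_integralT//; last by move=> w /=; rewrite normrN.
rewrite (_ : integral _ _ _ = (s^-1)%:E * \int[leb]_x (exponential_pdf s x)%:E)%E.
  by rewrite integral_exponential_pdf// mule1 -EFinM ltry.
rewrite -ge0_integralZl//; last 3 first.
- by apply/measurable_EFinP; exact: measurable_exponential_pdf.
- by move=> x _; rewrite lee_fin exponential_pdf_ge0// ltW.
- by rewrite lee_fin invr_ge0 ltW.
rewrite [LHS]integral_mkcond; apply: eq_integral => x _; rewrite patchE -EFinM.
have [x0|x0] := leP 0 x.
  by rewrite mem_set// exponential_pdfE// /= mulKf ?gt_eqF// ger0_norm// mulNr.
by rewrite memNset ?lt0_exponential_pdf ?mulr0//=; apply/negP; rewrite -ltNge.
Qed.

Lemma cvg_gamma_profile (bn : nat -> R) w : bn n @[n --> \oo] --> +oo ->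
  gamma_profile (bn n) w @[n --> \oo] --> expR (- (w ^+ 2 / 2)).
Proof.
move=> bny.
have sq (M : R) : \forall n \near \oo, M <= Num.sqrt (bn n).
  have /cvgryPge/(_ (Num.max M 0 ^+ 2)) := bny; apply: filterS => n hn.
  rewrite (@le_trans _ _ (Num.max M 0)) ?le_max ?lexx//.
  by rewrite -(ger0_norm (_ : 0 <= Num.max M 0)) -?sqrtr_sqr ?ler_wsqrtr// le_max lexx orbT.
have H : gamma_exponent (bn n) w @[n --> \oo] --> - (w ^+ 2 / 2).
  apply/cvgrPdist_le => /= e e0.
  near=> n.
  have s0 : 0 < Num.sqrt (bn n).
    by rewrite (@lt_le_trans _ _ 1)//; near: n; exact: sq.
  have b0 : 0 < bn n by rewrite -sqrtr_gt0.
  rewrite distrC opprK (le_trans (@gamma_exponent_dist _ _ _ b0 _))//.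
    rewrite ler_pdivlMr//; near: n; exact: sq.
  rewrite ler_pdivrMr// mulrC -ler_pdivrMr//; near: n; exact: sq.
apply: (cvg_trans _ (continuous_cvg _ (@continuous_expR R _) H)).
apply: near_eq_cvg; near=> n; rewrite /gamma_profile ifT//.
rewrite ltrNl (le_lt_trans (ler_norm _))// normrN.
have : `|w| + 1 <= Num.sqrt (bn n) by near: n; exact: sq.
lra.
Unshelve. all: by end_near. Qed.

(** The substitution w -> sqrt (1 + 2s) w; its Jacobian is where the exponent -1/2 of the
    chi-squared transform originates. *)
Lemma integral_gauss_scale s : 0 <= s ->
  Rintegral leb setT (fun w => expR (- (s * w ^+ 2)) * expR (- (w ^+ 2 / 2))) =
  (1 + 2 * s) `^ (- 2^-1) * Rintegral leb setT (fun w => expR (- (w ^+ 2 / 2))).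
Proof.
move=> s0; have s1 : 0 < 1 + 2 * s by rewrite ltr_wpDr// mulr_ge0.
set c := Num.sqrt (1 + 2 * s).
have c0 : 0 < c by rewrite sqrtr_gt0.
have cE : c ^+ 2 = 1 + 2 * s by rewrite sqr_sqrtr// ltW.
have mg : measurable_fun setT (fun w : R => expR (- (w ^+ 2 / 2))).
  apply: continuous_measurable_fun => w; apply: continuous_comp; last exact: continuous_expR.
  by apply: cvgN; apply: cvgM; [exact: exprn_continuous|exact: cvg_cst].
have := @ge0_integral_affine R 0 c (fun w => (expR (- (w ^+ 2 / 2)))%:E) c0.
have H1 : measurable_fun setT (fun w : R => (expR (- (w ^+ 2 / 2)))%:E) by exact/measurable_EFinP.
have H2 (y : R) : (0 <= (expR (- (y ^+ 2 / 2)))%:E)%E by rewrite lee_fin expR_ge0.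
move=> /(_ H1 H2) H.
rewrite /Rintegral H powRN powR12_sqrt ?(ltW s1)// -/c.
have mJ : measurable_fun setT (fun x : R => (expR (- ((0 + c * x) ^+ 2 / 2)))%:E).
  apply/measurable_EFinP; apply: (measurableT_comp mg).
  by apply: measurable_funD => //; exact: measurable_funM.
rewrite ge0_integralZl//; last by rewrite lee_fin ltW.
have -> : (\int[leb]_w (expR (- (s * w ^+ 2)) * expR (- (w ^+ 2 / 2)))%:E =
    \int[leb]_x (expR (- ((0 + c * x) ^+ 2 / 2)))%:E)%E.
  apply: eq_integral => x _; rewrite -expRD add0r exprMn cE; congr (expR _)%:E.
  by field.
set J := (\int[leb]_x (expR (- ((0 + c * x) ^+ 2 / 2)))%:E)%E.
have : (0 <= J)%E by apply: integral_ge0 => x _; rewrite lee_fin expR_ge0.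
case: J => [r| |]//=; first by rewrite mulKf// gt_eqF.
by rewrite mulr_infty gtr0_sg// mul1e/= mulr0.
Qed.

End GammaAsymptotics.

Section GammaLimit.
Context (R : realType).
Local Notation leb := (@lebesgue_measure R).
Implicit Types a b s t x z w : R.

Local Notation dom := (fun w : R => expR (2^-1) * expR (- (2^-1 * `|w|))).

Let integrable_dom : leb.-integrable setT (EFin \o dom).
Proof.
have h : 0 < 2^-1 :> R by rewrite invr_gt0.
exact: (@integrableZl _ _ _ leb _ measurableT _ _ (integrable_expN_norm h)).
Qed.

Lemma integrable_gamma_profile b (g : R -> R) : 1 <= b -> measurable_fun setT g ->
  (forall z, 0 <= g z <= 1) ->
  leb.-integrable setT (EFin \o (fun w => g w * gamma_profile b w)).
Proof.
move=> b1 mg g01; apply: le_integrable integrable_dom => //.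
  apply/measurable_EFinP; apply: measurable_funM => //.
  by apply: measurable_gamma_profile; rewrite (lt_le_trans ltr01).
move=> w _; rewrite /= lee_fin [leRHS]ger0_norm ?mulr_ge0 ?expR_ge0//.
have /andP[g0 g1] := g01 w.
rewrite ger0_norm ?mulr_ge0 ?gamma_profile_ge0//.
rewrite (le_trans _ (gamma_profile_le w b1))// ler_piMl// gamma_profile_ge0//.
Qed.

Lemma gamma_expectation_profile b (g : R -> R) : 1 <= b -> measurable_fun setT g ->
  (forall z, 0 <= g z <= 1) ->
  gamma_expectation (b + 1) g =
  Rintegral leb setT (fun w => g (b + Num.sqrt b * w) * gamma_profile b w) /
  Rintegral leb setT (gamma_profile b).
Proof.
move=> b1 mg g01; have b0 : 0 < b by rewrite (lt_le_trans ltr01).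
have s0 : 0 < Num.sqrt b by rewrite sqrtr_gt0.
pose K := Num.sqrt b * (b `^ b * expR (- b)).
have K0 : 0 < K by rewrite !mulr_gt0 ?powR_gt0 ?expR_gt0.
have main (f : R -> R) : measurable_fun setT f -> (forall z, 0 <= f z <= 1) ->
    Rintegral leb setT (fun z => f z * pos_gamma (b + 1) z) =
    K * Rintegral leb setT (fun w => f (b + Num.sqrt b * w) * gamma_profile b w).
  move=> mf f01.
  have mY : measurable_fun setT (fun w : R => b + Num.sqrt b * w).
    by apply: measurable_funD => //; exact: measurable_funM.
  rewrite -RintegralZl//; last first.
    apply: (@integrable_gamma_profile b (fun w => f (b + Num.sqrt b * w))) => //.
    exact: measurableT_comp.
  rewrite /Rintegral; congr fine.
  rewrite (@ge0_integral_affine R b (Num.sqrt b)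
    (fun z => (f z * pos_gamma (b + 1) z)%:E))//.
  - apply: eq_integral => w _; rewrite -EFinM pos_gamma_profile// /K; congr EFin; ring.
  - apply/measurable_EFinP; apply: measurable_funM => //.
    exact: measurable_pos_gamma.
  - move=> z; rewrite lee_fin mulr_ge0 ?pos_gamma_ge0//; by case/andP: (f01 z).
rewrite /gamma_expectation /weighted_expectation main//.
have c01 (z : R) : 0 <= (cst 1 z : R) <= 1 by rewrite /= lexx ler01.
have := main (cst 1) (measurable_cst _) c01.
rewrite (_ : (fun z => cst 1 z * _) = pos_gamma (b + 1)); last first.
  by apply/funext => z; rewrite /= mul1r.
rewrite (_ : (fun w => cst 1 (b + _) * _) = gamma_profile b); last first.
  by apply/funext => z; rewrite /= mul1r.
move=> ->.
by rewrite -mulf_div divff ?mul1r// gt_eqF.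
Qed.

Lemma integral_gauss_gt0 : 0 < Rintegral leb setT (fun w : R => expR (- (w ^+ 2 / 2))).
Proof.
have := @integral_normal_pdf R 0 1; rewrite normal_pdfE ?oner_neq0//.
under eq_integral do rewrite EFinM.
rewrite ge0_integralZl//; last 3 first.
- by apply/measurable_EFinP; exact: measurable_normal_fun.
- by move=> x _; rewrite lee_fin normal_fun_ge0.
- by rewrite lee_fin normal_peak_ge0.
have p0 : 0 < normal_peak 1 :> R by rewrite normal_peak_gt0// oner_neq0.
rewrite (_ : integral _ _ _ = \int[leb]_w (expR (- (w ^+ 2 / 2)))%:E)%E; last first.
  by apply: eq_integral => x _; rewrite /normal_fun subr0 expr1n mulNr.
rewrite /Rintegral; have : (0 <= \int[leb]_w (expR (- (w ^+ 2 / 2)))%:E)%E.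
  by apply: integral_ge0 => x _; rewrite lee_fin expR_ge0.
case: (integral _ _ _) => [r| |]//=.
  rewrite lee_fin le_eqVlt => /orP[/eqP <-|//]; rewrite mule0 => -[/eqP].
  by rewrite eq_sym oner_eq0.
by rewrite mulr_infty gtr0_sg// mul1e.
Qed.

(** Laplace's method centred at the mode an - 1: after the substitution, dominated convergence is
    applied to numerator and denominator separately. Letting g vary with n covers both the centred
    square and the ratio S / a. *)
Lemma gamma_expectation_cvg (an : nat -> R) (g : nat -> R -> R) (G : R -> R) :
  an n @[n --> \oo] --> +oo ->
  (forall n, measurable_fun setT (g n)) -> (forall n z, 0 <= g n z <= 1) ->
  (forall w, g n (an n - 1 + Num.sqrt (an n - 1) * w) @[n --> \oo] --> G w) ->
  gamma_expectation (an n) (g n) @[n --> \oo] -->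
  Rintegral leb setT (fun w => G w * expR (- (w ^+ 2 / 2))) /
  Rintegral leb setT (fun w => expR (- (w ^+ 2 / 2))).
Proof.
move=> any mg g01 gG.
(* Truncation at 1 makes the domination valid for every n; eventually [bn n] equals [an n - 1]. *)
pose bn n := Num.max (an n - 1) 1.
have b1 n : 1 <= bn n by rewrite le_max lexx orbT.
have b0 n : 0 < bn n by rewrite (lt_le_trans ltr01).
have bE : \forall n \near \oo, bn n = an n - 1.
  have /cvgryPge/(_ 2) := any; apply: filterS => n hn.
  by rewrite /bn max_l//; lra.
have bny : bn n @[n --> \oo] --> +oo.
  apply/cvgryPge => A; have /cvgryPge/(_ (A + 1)) := any; apply: filterS => n hn.
  by rewrite le_max; apply/orP; left; lra.
have dct (f : nat -> R -> R) (L : R -> R) :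
    (forall n, measurable_fun setT (f n)) -> (forall n z, 0 <= f n z <= 1) ->
    (forall w, f n w @[n --> \oo] --> L w) ->
    Rintegral leb setT (fun w => f n w * gamma_profile (bn n) w) @[n --> \oo] -->
    Rintegral leb setT (fun w => L w * expR (- (w ^+ 2 / 2))).
  move=> mf f01 fL.
  have mfu n : measurable_fun (setT : set (measurableTypeR R)) (fun w => (f n w * gamma_profile (bn n) w)%:E).
    have H : measurable_fun setT (fun w => f n w * gamma_profile (bn n) w).
      by apply: measurable_funM => //; exact: measurable_gamma_profile.
    by apply/measurable_EFinP; exact: H.
  have cfu (w : R) : setT w ->
      (f n w * gamma_profile (bn n) w)%:E @[n --> \oo] -->
      (L w * expR (- (w ^+ 2 / 2)))%:E.
    move=> _; apply: cvg_EFin; first exact: nearW.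
    by apply: cvgM; [exact: fL|exact: cvg_gamma_profile].
  have bfu n (w : R) : setT w ->
      (`|(f n w * gamma_profile (bn n) w)%:E| <= (EFin \o dom) w)%E.
    move=> _; have /andP[f0 f1] := f01 n w.
    rewrite /= lee_fin ger0_norm ?mulr_ge0 ?gamma_profile_ge0//.
    by rewrite (le_trans _ (gamma_profile_le w (b1 n)))// ler_piMl// gamma_profile_ge0.
  have fin : forall w : R, setT w -> (EFin \o dom) w \is a fin_num by [].
  pose fu (n : nat) (w : measurableTypeR R) := (f n w * gamma_profile (bn n) w)%:E.
  pose Lu (w : measurableTypeR R) := (L w * expR (- (w ^+ 2 / 2)))%:E.
  have iL := @lebesgue_integral_dominated_convergence.dominated_integrable _ _ R leb setT
    measurableT fu Lu (EFin \o dom) mfu cfu integrable_dom bfu.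
  have cL := @dominated_cvg _ _ R leb setT
    measurableT fu Lu (EFin \o dom) mfu cfu fin integrable_dom bfu.
  apply: fine_cvg; rewrite fineK//.
  exact: integrable_fin_num iL.
have N0 := integral_gauss_gt0.
pose h n w := g n (bn n + Num.sqrt (bn n) * w).
have mh n : measurable_fun setT (h n).
  apply: measurableT_comp => //.
  by apply: measurable_funD => //; exact: measurable_funM.
have hG w : h n w @[n --> \oo] --> G w.
  apply: cvg_trans (gG w); apply: near_eq_cvg; near=> n.
  by rewrite /h (_ : bn n = an n - 1)//; near: n.
have c1 := dct h G mh (fun n z => g01 n _) hG.
have c2 := dct (fun _ => cst 1) (cst 1) (fun n => measurable_cst _) _ (fun w => cvg_cst _).
have {}c2 : Rintegral leb setT (gamma_profile (bn n)) @[n --> \oo] -->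
   Rintegral leb setT (fun w : R => expR (- (w ^+ 2 / 2))).
  have c01 (n : nat) (z : R) : 0 <= (cst 1 z : R) <= 1 by rewrite /= lexx ler01.
  have := c2 c01; rewrite (_ : (fun w => cst 1 w * _) =
    (fun w : R => expR (- (w ^+ 2 / 2)))); last by apply/funext => z; rewrite /= mul1r.
  have -> : (fun n => Rintegral leb setT (fun w => (cst 1 : R -> R) w * gamma_profile (bn n) w)) =
      (fun n => Rintegral leb setT (gamma_profile (bn n))).
    by apply/funext => n; apply: eq_Rintegral => z _; rewrite /= mul1r.
  by move=> H; apply: H.
have Nn0 := lt0r_neq0 N0.
have c3 : (fun n => (Rintegral leb setT (gamma_profile (bn n)))^-1) @ \oo -->
    (Rintegral leb setT (fun w => expR (- (w ^+ 2 / 2))))^-1 by exact: cvgV.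
apply: (cvg_trans _ (cvgM c1 c3)); apply: near_eq_cvg; near=> n.
have <- : bn n + 1 = an n.
  by rewrite (_ : bn n = an n - 1) ?subrK//; near: n.
by rewrite gamma_expectation_profile.
Unshelve. all: by end_near. Qed.

End GammaLimit.

Section GammaSquareLimit.
Context (R : realType).
Local Notation leb := (@lebesgue_measure R).
Implicit Types a b s t x z w : R.

Definition centred_square a z := (z - a) ^+ 2 / a.

(** Turns limits as a -> +oo into continuity at 0 in the variable t = 1 / a. *)
Lemma cvg_pinfty_comp_inv (an : nat -> R) (phi : R -> R) : an n @[n --> \oo] --> +oo ->
  {for 0, continuous phi} -> phi (an n)^-1 @[n --> \oo] --> phi 0.
Proof.
move=> any cphi.
have near_ge M : \forall n \near \oo, M <= an n by have /cvgryPge/(_ M) := any.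
have H : (an n)^-1 @[n --> \oo] --> (0 : R).
  apply/cvgrPdist_le => e e0; near=> n.
  have h : e^-1 <= an n by near: n; exact: near_ge.
  have a0 : 0 < an n by rewrite (lt_le_trans _ h)// invr_gt0.
  rewrite sub0r normrN ger0_norm ?invr_ge0 ?(ltW a0)//.
  by rewrite -[leRHS]invrK lef_pV2 ?posrE ?invr_gt0.
exact: continuous_cvg _ cphi H.
Unshelve. all: by end_near. Qed.

Lemma sqrt_pred a : 1 <= a ->
  Num.sqrt (a - 1) = Num.sqrt a * Num.sqrt (1 - a^-1) /\ Num.sqrt a * Num.sqrt a^-1 = 1.
Proof.
move=> a1; have a0 : 0 < a by rewrite (lt_le_trans ltr01).
rewrite -!sqrtrM ?(ltW a0)// divff ?gt_eqF// sqrtr1; split => //.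
by congr Num.sqrt; rewrite mulrBr mulr1 divff ?gt_eqF.
Qed.

Let cvg_sqrt (f : R -> R) t : {for t, continuous f} ->
  {for t, continuous (fun x => Num.sqrt (f x))}.
Proof. by move=> cf; apply: continuous_comp => //; exact: sqrt_continuous. Qed.

Let continuous_sqrt1B : {for (0 : R), continuous (fun t : R => Num.sqrt (1 - t))}.
Proof. by apply: cvg_sqrt; apply: cvgB; [exact: cvg_cst|exact: cvg_id]. Qed.

Lemma gamma_centred_square_cvg (an : nat -> R) s : 0 <= s ->
  (forall n, 0 < an n) -> an n @[n --> \oo] --> +oo ->
  gamma_expectation (an n) (fun z => expR (- (s * centred_square (an n) z)))
    @[n --> \oo] --> (1 + 2 * s) `^ (- 2^-1).
Proof.
move=> s0 a0 any.
have near_ge M : \forall n \near \oo, M <= an n by have /cvgryPge/(_ M) := any.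
have -> : (1 + 2 * s) `^ (- 2^-1) =
    Rintegral leb setT (fun w => expR (- (s * w ^+ 2)) * expR (- (w ^+ 2 / 2))) /
    Rintegral leb setT (fun w => expR (- (w ^+ 2 / 2))).
  by rewrite integral_gauss_scale// mulfK// gt_eqF// integral_gauss_gt0.
apply: (@gamma_expectation_cvg R an (fun n z => expR (- (s * centred_square (an n) z)))) => //.
- move=> n; apply: continuous_measurable_fun => z.
  apply: continuous_comp; last exact: continuous_expR.
  apply: cvgN; apply: cvgM; first exact: cvg_cst.
  apply: cvgM; last exact: cvg_cst.
  apply: (@continuous_comp _ _ _ (fun z => z - an n) (fun x => x ^+ 2)); last exact: exprn_continuous.
  by apply: cvgB; [exact: cvg_id|exact: cvg_cst].
- move=> n z; rewrite expR_ge0/= -(@expR0 R) ler_expR oppr_le0 mulr_ge0//.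
  by rewrite divr_ge0 ?sqr_ge0// ltW.
- move=> w.
  (* For z = a - 1 + sqrt (a - 1) w and t = 1 / a, (z - a) / sqrt a = sqrt (1 - t) w - sqrt t. *)
  pose phi t := expR (- (s * (Num.sqrt (1 - t) * w - Num.sqrt t) ^+ 2)).
  have -> : expR (- (s * w ^+ 2)) = phi 0.
    by rewrite /phi subr0 sqrtr1 sqrtr0 mul1r subr0.
  have cphi : {for 0, continuous phi}.
    apply: continuous_comp; last exact: continuous_expR.
    apply: cvgN; apply: cvgM; first exact: cvg_cst.
    apply: (@continuous_comp _ _ _ (fun t => Num.sqrt (1 - t) * w - Num.sqrt t) (fun x => x ^+ 2));
      last exact: exprn_continuous.
    apply: cvgB; last exact: sqrt_continuous.
    by apply: cvgM; [exact: continuous_sqrt1B|exact: cvg_cst].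
  apply: cvg_trans (cvg_pinfty_comp_inv any cphi); apply: near_eq_cvg; near=> n.
  have a1 : 1 <= an n by near: n; exact: near_ge.
  rewrite /phi /centred_square; congr (expR (- (s * _))).
  have [-> e1] := sqrt_pred a1.
  have sa : Num.sqrt (an n) ^+ 2 = an n by rewrite sqr_sqrtr// ltW.
  have sa0 : 0 < Num.sqrt (an n) by rewrite sqrtr_gt0.
  set q := Num.sqrt (an n) in e1 sa sa0 *; set r := Num.sqrt _; set u := Num.sqrt _ in e1 *.
  rewrite (_ : _ - an n = q * (r * w - u)); last first.
    by rewrite mulrBr e1; ring.
  by rewrite exprMn sa [RHS]mulrC mulKf// gt_eqF.
Unshelve. all: by end_near. Qed.

Lemma gamma_ratio_cvg (an : nat -> R) : an n @[n --> \oo] --> +oo ->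
  gamma_expectation (an n) (fun z => Num.min 1 (2 * `|1 - (z / an n) ^+ 2|))
    @[n --> \oo] --> (0 : R).
Proof.
move=> any.
have near_ge M : \forall n \near \oo, M <= an n by have /cvgryPge/(_ M) := any.
have -> : (0 : R) = Rintegral leb setT (fun w => cst 0 w * expR (- (w ^+ 2 / 2))) /
    Rintegral leb setT (fun w => expR (- (w ^+ 2 / 2))).
  under eq_Rintegral do rewrite mul0r.
  by rewrite /Rintegral integral0 /= mul0r.
apply: (@gamma_expectation_cvg R an (fun n z => Num.min 1 (2 * `|1 - (z / an n) ^+ 2|)) (cst 0)) => //.
- move=> n; apply: measurable_minr => //.
  apply: measurable_funM => //; apply: measurableT_comp => //.
  by apply: measurable_funB => //; apply: measurable_funX; exact: measurable_funM.
- by move=> n z; rewrite le_min ler01 mulr_ge0//= ge_min lexx.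
- move=> w.
  (* Same substitution: z / a = 1 - t + sqrt (1 - t) sqrt t w. *)
  pose phi t := Num.min 1 (2 * `|1 - (1 - t + Num.sqrt (1 - t) * Num.sqrt t * w) ^+ 2|).
  have -> : cst 0 w = phi 0.
    by rewrite /phi sqrtr0 mulr0 mul0r subr0 addr0 expr1n subrr normr0 mulr0 min_r.
  have cphi : {for 0, continuous phi}.
    apply: (@continuous_min _ _ (cst 1) (fun t => 2 * `|1 - (1 - t + Num.sqrt (1 - t) * Num.sqrt t * w) ^+ 2|)); first exact: cvg_cst.
    apply: cvgM; first exact: cvg_cst.
    apply: cvg_norm; apply: cvgB; first exact: cvg_cst.
    apply: (@continuous_comp _ _ _ (fun t => 1 - t + Num.sqrt (1 - t) * Num.sqrt t * w) (fun x => x ^+ 2));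
      last exact: exprn_continuous.
    apply: cvgD; first by apply: cvgB; [exact: cvg_cst|exact: cvg_id].
    apply: cvgM; last exact: cvg_cst.
    by apply: cvgM; [exact: continuous_sqrt1B|exact: sqrt_continuous].
  apply: cvg_trans (cvg_pinfty_comp_inv any cphi); apply: near_eq_cvg; near=> n.
  have a1 : 1 <= an n by near: n; exact: near_ge.
  have a0 : 0 < an n by rewrite (lt_le_trans ltr01).
  rewrite /phi; congr (Num.min _ (_ * `|_ - _ ^+ 2|)).
  have [-> e1] := sqrt_pred a1.
  have sa : Num.sqrt (an n) ^+ 2 = an n by rewrite sqr_sqrtr// ltW.
  have ia : (an n)^-1 = Num.sqrt (an n)^-1 ^+ 2 by rewrite sqr_sqrtr// invr_ge0 ltW.
  have iq : Num.sqrt (an n) / an n = Num.sqrt (an n)^-1.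
    by rewrite [X in _ * X]ia expr2 mulrA e1 mul1r.
  rewrite !mulrDl divff ?gt_eqF// mulNr mul1r; congr (_ + _).
  by rewrite -iq; ring.
Unshelve. all: by end_near. Qed.

End GammaSquareLimit.

(** * Dirichlet vectors as normalised Gamma vectors *)

Section GammaIntegral.
Context (R : realType).
Local Notation leb := (@lebesgue_measure R).

Lemma eq_gamma_expectation (a : R) (f g : R -> R) :
  (forall z, 0 < z -> f z = g z) -> gamma_expectation a f = gamma_expectation a g.
Proof.
move=> fg; rewrite /gamma_expectation /weighted_expectation; congr (_ / _).
apply: eq_Rintegral => z _; rewrite /pos_gamma; case: ifP => [z0|_].
  by rewrite fg.
by rewrite !mulr0.
Qed.

Lemma gamma_expectation_tilt (a s : R) (f : R -> R) : 0 <= s ->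
  measurable_fun setT f -> (forall z, 0 <= f z) ->
  gamma_expectation a (fun z => f z * expR (- (s * z))) =
  (1 + s) `^ (- a) * gamma_expectation a (fun y => f ((1 + s)^-1 * y)).
Proof.
move=> s0 mf f0; rewrite /gamma_expectation /weighted_expectation mulrA.
congr (_ / _); rewrite /Rintegral ge0_integral_pos_gamma_tilt//.
set I := integral _ _ _; have I0 : (0 <= I)%E.
  by apply: integral_ge0 => z _; rewrite lee_fin mulr_ge0// pos_gamma_ge0.
case: I I0 => [r| |]//= _; rewrite mulr0.
have : 0 < (1 + s) `^ (- a) by rewrite powR_gt0// ltr_wpDr.
by move=> c0; rewrite mulr_infty gtr0_sg// mul1e.
Qed.

Lemma gamma_law_integral d (T : measurableType d) (Q : probability T R)
    (Z : T -> R) (a : R) (f : R -> R) : is_gamma Q Z a -> 0 < a ->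
  measurable_fun setT f -> (forall z, 0 <= f z) ->
  Rintegral Q setT (fun w => f (Z w)) = gamma_expectation a f.
Proof.
move=> [_ [mZ lZ]] a0 mf f0.
have G0 := Gammaf_gt0 a0.
pose kap (z : measurableTypeR R) := pos_gamma a z / Gammaf a.
have mkap : measurable_fun setT kap.
  by apply: measurable_funM => //; exact: measurable_pos_gamma.
have kap0 z : 0 <= kap z by rewrite divr_ge0 ?pos_gamma_ge0// ltW.
have mid : measurable_fun setT (id : measurableTypeR R -> R) by exact: measurable_id.
have := @eq_weighted_law R _ _ Q _ _ leb _ _ (fun=> 1) Z kap id (measurable_cst _)
  (fun=> ler01) mkap kap0 mZ mid (EFin \o f) _.
have HB (B : set R) : measurable B -> (\int[Q]_(x in Z @^-1` B) 1%:E =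
    \int[leb]_(z in id @^-1` B) (kap z)%:E)%E.
  move=> mB; have mZB : measurable (Z @^-1` B).
    by rewrite -[X in measurable X]setTI; exact: mZ.
  rewrite integral_cst// mul1e; apply: (eq_trans (lZ _ mB)).
  rewrite gt_eqF// Rintegral_mkcond.
  rewrite (_ : gamma_kernel a \_ (B `&` `]0, +oo[%classic) =
    (fun z => pos_gamma a z * \1_B z)); last first.
    apply/funext => z; rewrite pos_gamma_restrict !patchE in_setI indicE.
    by case: (z \in B); case: (z \in _); rewrite ?mulr0 ?mulr1.
  have iB : leb.-integrable setT (EFin \o (fun z => \1_B z * pos_gamma a z)).
    apply: (@integrable_mul_weight _ _ R leb (pos_gamma a) (pos_gamma_ge0 a)
      (integrable_pos_gamma a0) _ 1).
      exact: measurable_indic.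
    by move=> z _; rewrite indicE; case: (_ \in _); rewrite ?normr1 ?normr0.
  rewrite EFinM /Rintegral fineK; last first.
    apply: integrable_fin_num => //.
    rewrite (_ : (fun z => (pos_gamma a z * _)%:E) =
      EFin \o (fun z => \1_B z * pos_gamma a z))//.
    by apply/funext => z; rewrite /= mulrC.
  rewrite muleC -ge0_integralZl//; last 3 first.
  - apply/measurable_EFinP; apply: measurable_funM; first exact: measurable_pos_gamma.
    exact: measurable_indic.
  - by move=> z _; rewrite lee_fin mulr_ge0// pos_gamma_ge0.
  - by rewrite lee_fin invr_ge0 ltW.
  rewrite [RHS]integral_mkcond; apply: eq_integral => z _; rewrite patchE indicE.
  have -> : (z \in id @^-1` B) = (z \in B) by [].
  by case: (z \in B); rewrite -EFinM ?mulr0// mulr1 mulrC.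
move=> /(_ HB); under eq_integral do rewrite mul1e.
have mEf : measurable_fun setT (EFin \o f) by exact/measurable_EFinP.
have Ef0 y : (0 <= (EFin \o f) y)%E by rewrite lee_fin.
move=> /(_ mEf Ef0) H; rewrite /Rintegral H.
rewrite /gamma_expectation /weighted_expectation -GammafE /Rintegral.
rewrite (_ : integral _ _ _ = ((Gammaf a)^-1)%:E * \int[leb]_z (f z * pos_gamma a z)%:E)%E.
  set I := integral _ _ _; have I0 : (0 <= I)%E.
    by apply: integral_ge0 => z _; rewrite lee_fin mulr_ge0// pos_gamma_ge0.
  case: I I0 => [r| |]//= _; first by rewrite mulrC.
  by rewrite mul0r mulr_infty gtr0_sg ?invr_gt0// mul1e.
rewrite -ge0_integralZl//; last 3 first.
- by apply/measurable_EFinP; apply: measurable_funM => //; exact: measurable_pos_gamma.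
- by move=> z _; rewrite lee_fin mulr_ge0// pos_gamma_ge0.
- by rewrite lee_fin invr_ge0 ltW.
by apply: eq_integral => z _; rewrite /= -!EFinM /kap; congr EFin; ring.
Qed.

End GammaIntegral.

(** The formula x |x|^(-2) also reproduces the convention 0^-1 = 0, so measurability holds on the
    whole line. *)
Lemma measurable_invr (R : realType) : measurable_fun setT (@GRing.inv R).
Proof.
rewrite (_ : @GRing.inv R = fun x => x * `|x| `^ (- 2%:R)).
  apply: measurable_funM => //.
  by apply: (measurableT_comp (measurable_powR _)); exact: normr_measurable.
apply/funext => x; rewrite powR_invn// -exprVn.
have [->|x0] := eqVneq x 0; first by rewrite invr0 mul0r.
by rewrite exprVn real_normK ?num_real// expr2 invfM mulVKf.
Qed.

Section DirichletRep.
Context (R : realType) (k : nat).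

(** Positivity is demanded at every point, which makes S > 0 and the division by S unconditional. *)
Definition pos_gamma_family d (T : measurableType d) (Q : probability T R)
    (Z : 'I_k -> T -> R) (a : 'I_k -> R) :=
  [/\ forall i, measurable_fun setT (Z i), indep_family Q Z,
      forall i w, 0 < Z i w &
      forall i (f : R -> R), measurable_fun setT f -> (forall z, 0 <= f z) ->
        Rintegral Q setT (fun w => f (Z i w)) = gamma_expectation (a i) f].

Definition simplex_proj (y : vec R k) : vec R k := fun i => y i / \sum_(j < k) y j.

Lemma measurable_simplex_proj : measurable_fun setT simplex_proj.
Proof.
apply: measurable_vec => i; rewrite /simplex_proj.
apply: measurable_funM; first exact: measurable_coord.
apply: (@measurableT_comp _ _ _ _ _ _ (@GRing.inv R)).
  exact: measurable_invr.
by apply: measurable_sum_bigop => j; exact: measurable_coord.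
Qed.

Lemma dirichlet_pos_gamma_family d (T : measurableType d) (Q : probability T R)
    (Y : T -> 'I_k -> R) (a : 'I_k -> R) :
  is_dirichlet Q Y a -> (forall i, 0 < a i) ->
  exists d' (T' : measurableType d') (Q' : probability T' R) (Z : 'I_k -> T' -> R),
    pos_gamma_family Q' Z a /\
    forall f : vec R k -> R, measurable_fun setT f -> (forall y, 0 <= f y) ->
      Rintegral Q setT (fun w => f (Y w)) =
      Rintegral Q' setT (fun w => f (simplex_proj (fun i => Z i w))).
Proof.
move=> [mY [d' [T' [Q' [Z [iZ [gZ YZ]]]]]]] a0.
(* Alters each Gamma variable on the null event Z <= 0; acting coordinatewise, it preserves
   independence. *)
pose pz (z : R) := if 0 < z then z else 1.
have mpz : measurable_fun setT pz.
  apply: measurable_fun_ifT => //.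
  by apply: measurable_fun_ltr.
have mZ i : measurable_fun setT (Z i) by have [_ []] := gZ i.
have mpZ i : measurable_fun setT (fun w => pz (Z i w)) by exact: measurableT_comp.
have aeZ : {ae Q', forall w, forall i, 0 < Z i w}.
  apply: filter_forall => i.
  exists (Z i @^-1` `]-oo, 0]); split.
  - by rewrite -[X in measurable X]setTI; exact: mZ.
  - have [_ [_ ->]] := gZ i; last exact: measurable_itv.
    rewrite gt_eqF// (_ : _ `&` _ = set0) ?Rintegral_set0 ?mul0r//.
    rewrite -subset0 => z /= []; rewrite !in_itv/= andbT => h1 h2.
    by have := lt_le_trans h2 h1; rewrite ltxx.
  - by move=> w /= /negP; rewrite -leNgt in_itv.
exists d', T', Q', (fun i w => pz (Z i w)); split.
  split => //.
  - move=> B mB; have := iZ (fun i => pz @^-1` B i) _; apply => i.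
    by rewrite -[X in measurable X]setTI; exact: mpz.
  - by move=> i w; rewrite /pz; case: ifP.
  - move=> i f mf f0.
    rewrite (gamma_law_integral (f := f \o pz) (gZ i) (a0 i))//=.
      by apply: eq_gamma_expectation => z z0; rewrite /= /pz z0.
    exact: measurableT_comp.
move=> f mf f0.
have mV (V : 'I_k -> T' -> R) : (forall i, measurable_fun setT (V i)) ->
    measurable_fun setT (fun w => simplex_proj (fun i => V i w)).
  move=> mV; apply: (@measurableT_comp _ _ _ _ _ _ simplex_proj).
    exact: measurable_simplex_proj.
  exact: measurable_vec.
have mVi (V : 'I_k -> T' -> R) : (forall i, measurable_fun setT (V i)) ->
    forall i, measurable_fun setT (fun w => simplex_proj (fun i => V i w) i).
  by move=> mV' i; exact: (measurableT_comp (measurable_coord i) (mV V mV')).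
rewrite (@same_joint_law_integral R k _ _ Q _ _ Q' Y
  (fun w => simplex_proj (fun i => Z i w)) f)//; last exact: mVi.
rewrite /Rintegral; congr fine; apply: ae_eq_integral => //.
- by apply/measurable_EFinP; exact: (measurableT_comp mf (mV _ mZ)).
- by apply/measurable_EFinP; exact: (measurableT_comp mf (mV _ mpZ)).
- apply: filterS aeZ => w Zw _ /=; congr (f (simplex_proj _))%:E.
  by apply/funext => i; rewrite /pz Zw.
Qed.

End DirichletRep.

Lemma sum_ord_gt0 (R : realType) (k : nat) (f : 'I_k -> R) : (0 < k)%N ->
  (forall i, 0 < f i) -> 0 < \sum_(i < k) f i.
Proof.
move=> k0 f0; rewrite (bigD1 (Ordinal k0))//= ltr_wpDr//.
by apply: sumr_ge0 => i _; exact: (ltW (f0 i)).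
Qed.

Section GammaFamily.
Context (R : realType) (k : nat) d (T : measurableType d) (Q : probability T R).
Variables (Z : 'I_k -> T -> R) (a : 'I_k -> R).
Hypotheses (hZ : pos_gamma_family Q Z a) (a0 : forall i, 0 < a i) (k0 : (0 < k)%N).
Local Notation leb := (@lebesgue_measure R).

Let mZ i : measurable_fun setT (Z i). Proof. by case: hZ. Qed.
Let iZ : indep_family Q Z. Proof. by case: hZ. Qed.
Let Z0 i w : 0 < Z i w. Proof. by case: hZ. Qed.
Let lZ i (f : R -> R) : measurable_fun setT f -> (forall z, 0 <= f z) ->
  Rintegral Q setT (fun w => f (Z i w)) = gamma_expectation (a i) f.
Proof. by case: hZ => _ _ _; apply. Qed.

Let S w := \sum_(i < k) Z i w.
Let A := \sum_(i < k) a i.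
Let V w : vec R k := fun i => Z i w.

Let S0 w : 0 < S w. Proof. exact: sum_ord_gt0. Qed.
Let A0 : 0 < A. Proof. exact: sum_ord_gt0. Qed.

Let mS : measurable_fun setT S. Proof. exact: measurable_sum_bigop. Qed.
Let mV : measurable_fun setT V. Proof. exact: measurable_vec. Qed.

Lemma powR_sum_exponent (x : R) : 0 < x ->
  \prod_(i < k) x `^ (- a i) = x `^ (- A).
Proof.
move=> x0; rewrite /powR gt_eqF// -expR_sum; congr expR.
by rewrite -mulr_suml sumrN.
Qed.

(* Tilting independent Gamma(a_i) variables by e^{-sS} is the same as dividing
   them by 1 + s, which leaves the direction Z / S unchanged. *)
Lemma gamma_family_tilt (s : R) (phi : vec R k -> R) : 0 <= s ->
  measurable_fun setT phi -> (forall y, 0 <= phi y <= 1) ->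
  Rintegral Q setT (fun w => expR (- (s * S w)) * phi (simplex_proj (V w))) =
  (1 + s) `^ (- A) * Rintegral Q setT (fun w => phi (simplex_proj (V w))).
Proof.
move=> s0 mphi phi01; have s1 : 0 < 1 + s by rewrite ltr_wpDr.
have c0 : 0 < (1 + s) `^ (- A) by exact: powR_gt0.
pose V2 w : vec R k := fun i => (1 + s)^-1 * Z i w.
have mV2 : measurable_fun setT V2.
  by apply: measurable_vec => i; exact: measurable_funM.
have V2E w : simplex_proj (V2 w) = simplex_proj (V w).
  apply/funext => i; rewrite /simplex_proj /V2 -mulr_sumr invfM mulrACA.
  by rewrite invrK mulVf ?mul1r// gt_eqF.
pose kap w := expR (- (s * S w)).
have mkap : measurable_fun setT kap.
  apply: measurableT_comp => //; apply: measurableT_comp => //.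
  exact: measurable_funM.
have kap01 w : 0 <= kap w <= 1.
  rewrite expR_ge0/= -(@expR0 R) ler_expR oppr_le0 mulr_ge0//; exact: ltW.
have kap0 w : 0 <= kap w by case/andP: (kap01 w).
have kap1 w : `|kap w| <= 1 by rewrite ger0_norm//; case/andP: (kap01 w).
have mf : measurable_fun setT (fun y : vec R k => phi (simplex_proj y)).
  by apply: (measurableT_comp mphi); exact: measurable_simplex_proj.
have mfV : measurable_fun setT (fun w => phi (simplex_proj (V w))).
  exact: (measurableT_comp mf mV).
have n1 y : `|phi y| <= 1 by have /andP[? ?] := phi01 y; rewrite ger0_norm.
have := @eq_weighted_law_pi R _ _ Q _ _ Q _ _ kap V (fun=> (1 + s) `^ (- A)) V2
  mkap kap0 (measurable_cst _) (fun=> ltW c0) mV mV2 (@rectangles R k)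
  (EFin \o (fun y => phi (simplex_proj y))) erefl (@rectangles_setI R k)
  (@rectangles_setT R k).
have fin : (\int[Q]_w (kap w)%:E < +oo)%E.
  by rewrite -(EFin_prob_Rintegral Q mkap kap1) ltry.
move=> /(_ fin) H.
have {H}H : (\int[Q]_w ((kap w)%:E * (phi (simplex_proj (V w)))%:E) =
    \int[Q]_w (((1 + s) `^ (- A))%:E * (phi (simplex_proj (V2 w)))%:E))%E.
  apply: H; last 2 first.
  - by apply/measurable_EFinP.
  - by move=> y; rewrite lee_fin; case/andP: (phi01 (simplex_proj y)).
  move=> _ [B mB ->].
  have mpre (W : T -> vec R k) : measurable_fun setT W ->
      measurable (W @^-1` (\bigcap_(i in [set: 'I_k]) ((fun y => y i) @^-1` B i))).
    move=> mW; rewrite -[X in measurable X]setTI; apply: mW => //.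
    by apply: sub_sigma_algebra; exists B.
  have indE (W : T -> vec R k) w :
      (\1_(W @^-1` (\bigcap_(i in [set: 'I_k]) ((fun y => y i) @^-1` B i))) w : R) =
      \prod_(i < k) \1_(B i) (W w i).
    rewrite indicE; case: (boolP (w \in _)) => [|].
      rewrite inE (_ : true%:R = 1)// => H; apply/esym/big1 => i _.
      have BiZ : B i (W w i) by exact: (H i).
      by rewrite indicE (mem_set BiZ).
    rewrite notin_setE => /existsNP[i /not_implyP[_ /= nB]].
    by rewrite (bigD1 i)//= indicE (memNset nB) mul0r.
  have ind01 (C : set R) (z : R) : 0 <= (\1_C z : R) <= 1.
    by rewrite indicE; case: (_ \in _); rewrite ?lexx ?ler01.
  have toR (g : T -> R) (W : T -> vec R k) : (forall w, 0 <= g w) ->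
      (\int[Q]_(w in W @^-1` (\bigcap_(i in [set: 'I_k]) ((fun y => y i) @^-1` B i)))
        (g w)%:E = \int[Q]_w (g w * \prod_(i < k) \1_(B i) (W w i))%:E)%E.
    move=> g0; rewrite integral_mkcond; apply: eq_integral => w _.
    rewrite patchE -indE indicE.
    by case: (w \in _); rewrite ?mulr1 ?mulr0.
  rewrite !toR//; last by move=> w; exact: ltW.
  have mI i : measurable_fun setT (\1_(B i) : R -> R) by exact: measurable_indic.
  have mBs i : measurable_fun setT (fun z : R => \1_(B i) ((1 + s)^-1 * z) : R).
    by apply: (measurableT_comp (mI i)); exact: measurable_funM.
  (* The absolute value keeps [g1] in [0, 1] on all of R, as [indep_Rintegral_prod] demands; it
     disappears because Z > 0. *)
  pose g1 i z := \1_(B i) z * expR (- (s * `|z|)) : R.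
  have mg1 i : measurable_fun setT (g1 i).
    apply: measurable_funM => //; apply: measurableT_comp => //; apply: measurableT_comp => //.
    by apply: measurable_funM => //; exact: normr_measurable.
  have g101 i z : 0 <= g1 i z <= 1.
    have /andP[i0 i1] := ind01 (B i) z; rewrite mulr_ge0 ?expR_ge0//= mulr_ile1 ?expR_ge0//.
    by rewrite -(@expR0 R) ler_expR oppr_le0 mulr_ge0.
  rewrite (_ : (fun w => (kap w * _)%:E) = (fun w => (\prod_(i < k) g1 i (Z i w))%:E)); last first.
    apply/funext => w; rewrite big_split/= mulrC; congr (_ * _)%:E.
    rewrite /kap /S mulr_sumr -sumrN expR_sum; apply: eq_bigr => i _.
    by rewrite gtr0_norm.
  rewrite -(@EFin_prob_Rintegral _ _ _ Q _ 1); last 2 first.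
  - by apply: measurable_prod_bigop => i; exact: measurableT_comp.
  - move=> w; rewrite ger0_norm ?prodr_ge0 ?prodr_ile1// => i _;
      first [exact: g101|by case/andP: (g101 i (Z i w))].
  rewrite indep_Rintegral_prod//.
  transitivity ((1 + s) `^ (- A) * Rintegral Q setT
    (fun w => \prod_(i < k) (\1_(B i) ((1 + s)^-1 * Z i w) : R)))%:E; last first.
    rewrite -RintegralZl//; last first.
      apply: (@bounded_prob_integrable _ _ _ Q _ 1).
        by apply: measurable_prod_bigop => i; exact: (measurableT_comp (mBs i)).
      move=> w; rewrite ger0_norm ?prodr_ge0 ?prodr_ile1// => i _;
        first [exact: ind01|by case/andP: (ind01 (B i) ((1 + s)^-1 * Z i w))].
    apply: (@EFin_prob_Rintegral _ _ _ Q _ ((1 + s) `^ (- A))).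
      apply: measurable_funM => //.
      by apply: measurable_prod_bigop => i; exact: (measurableT_comp (mBs i)).
    move=> w; rewrite normrM (gtr0_norm c0) ler_piMr ?(ltW c0)//.
    rewrite ger0_norm ?prodr_ge0 ?prodr_ile1// => i _;
      first [exact: ind01|by case/andP: (ind01 (B i) ((1 + s)^-1 * Z i w))].
  congr EFin; rewrite (@indep_Rintegral_prod _ _ _ Q k Z mZ iZ
    (fun i z => \1_(B i) ((1 + s)^-1 * z)))//.
  rewrite -powR_sum_exponent// -big_split/=; apply: eq_bigr => i _.
  have i0 z : 0 <= (\1_(B i) z : R) by case/andP: (ind01 (B i) z).
  rewrite (@lZ i (g1 i) (mg1 i)); last by move=> z; case/andP: (g101 i z).
  rewrite (@lZ i (fun z => \1_(B i) ((1 + s)^-1 * z)) (mBs i)); last by move=> z; exact: i0.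
  rewrite -gamma_expectation_tilt//.
  by apply: eq_gamma_expectation => z z0; rewrite /g1 gtr0_norm.
rewrite -RintegralZl//; last first.
  exact: (@bounded_prob_integrable _ _ _ Q _ 1 mfV (fun w => n1 (simplex_proj (V w)))).
rewrite /Rintegral; congr fine; apply: (eq_trans H).
by apply: eq_integral => w _; rewrite V2E EFinM.
Qed.

(** Under the weight phi (Z / S), tilting shows that S still has transform (1 + s)^(-A), so its law
    is Gamma(A) whatever phi is. Strict positivity of phi makes the weight normalisable; phi = 1
    gives the law of S itself. *)
Lemma gamma_family_indep (g : R -> R) (phi : vec R k -> R) : bounded_nneg g ->
  measurable_fun setT phi -> (forall y, 0 < phi y <= 1) ->
  Rintegral Q setT (fun w => g (S w) * phi (simplex_proj (V w))) =
  gamma_expectation A g * Rintegral Q setT (fun w => phi (simplex_proj (V w))).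
Proof.
move=> bg mphi phi01.
pose kap w := phi (simplex_proj (V w)).
have mkap : measurable_fun setT kap.
  apply: (measurableT_comp mphi).
  exact: (measurableT_comp (@measurable_simplex_proj R k) mV).
have kap0 w : 0 < kap w by case/andP: (phi01 (simplex_proj (V w))).
have kap1 w : `|kap w| <= 1.
  by rewrite gtr0_norm//; case/andP: (phi01 (simplex_proj (V w))).
have ikap := bounded_prob_integrable Q mkap kap1.
have K0 : 0 < Rintegral Q setT kap.
  have Kge : 0 <= Rintegral Q setT kap.
    by apply: Rintegral_ge0 => w _; exact: (ltW (kap0 w)).
  rewrite lt_neqAle Kge andbT.
  apply/eqP => /esym H.
  have HE : (\int[Q]_w `|(kap w)%:E| = 0)%E.
    under eq_integral do rewrite gee0_abs ?lee_fin ?(ltW (kap0 _))//.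
    by rewrite -(EFin_prob_Rintegral Q mkap kap1) H.
  have mE : measurable_fun setT (EFin \o kap) by exact/measurable_EFinP.
  have /(_ HE) := (ae_eq_integral_abs Q measurableT mE).1.
  move=> [N [mN N0 HN]]; have : (Q setT <= Q N)%E.
    apply: le_measure; rewrite ?inE// => w _; apply: HN => /= /(_ I) /= [] k00.
    by have := kap0 w; rewrite k00 ltxx.
  move: N0; rewrite /= => ->; rewrite (@probability_setT _ _ _ Q) lee_fin ler10//.
pose E1 := weighted_expectation Q kap S.
have hE1 : nneg_expectation E1.
  apply: nneg_expectation_weighted => //; first by move=> w; exact: (ltW (kap0 w)).
  by move=> w _; exact: (ltW (S0 w)).
have hE2 := nneg_expectation_gamma A0.
have E1exp (s : R) : 0 <= s ->
    E1 (fun x => expR (- (s * x))) = gamma_expectation A (fun x => expR (- (s * x))).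
  move=> s0; rewrite gamma_expectation_expN// /E1 /weighted_expectation.
  rewrite gamma_family_tilt//; first by rewrite mulfK// gt_eqF.
  by move=> y; have /andP[/ltW -> ->] := phi01 y.
(* For a constant sequence the continuity theorem is a uniqueness theorem for Laplace transforms. *)
have cv : (fun _ : nat => E1 g) @ \oo --> gamma_expectation A g.
  apply: (@laplace_continuity R (fun=> E1) (gamma_expectation A) g) => //.
    by move=> s s0; rewrite E1exp//; exact: cvg_cst.
  have : (fun s : R => (1 + s) `^ (- A)) @ 0^'+ --> (1 : R).
    rewrite -[X in _ --> X](_ : (1 + 0) `^ (- A) = 1); last by rewrite addr0 powR1.
    apply: cvg_at_right_filter.
    have p : 0 < 1 + 0 :> R by rewrite addr0.
    apply: (@continuous_comp _ _ _ (fun s : R => 1 + s) (fun x => x `^ (- A))).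
      by apply: cvgD; [exact: cvg_cst|exact: cvg_id].
    apply: differentiable_continuous; apply/derivable1_diffP.
    exact: (@ex_derive _ _ _ _ _ _ _ (is_derive1_powR (- A) p)).
  apply: cvg_trans; apply: near_eq_cvg; near=> s.
  by rewrite gamma_expectation_expN//; near: s; exact: nbhs_right_ge.
have /= E : E1 g = gamma_expectation A g.
  rewrite -(cvg_lim (@Rhausdorff R) cv); apply/esym/cvg_lim => //.
  exact: cvg_cst.
by rewrite -E /E1 /weighted_expectation divfK// gt_eqF.
Unshelve. all: by end_near. Qed.

End GammaFamily.

(** * Laplace transform of the divergence of a Dirichlet vector *)

Section DirichletLaplace.
Context (R : realType) (k : nat).
Implicit Types (a h : 'I_k -> R) (y : vec R k).

Lemma Dstat_ge0 (A : R) (p h : 'I_k -> R) : 0 <= A -> (forall i, 0 <= h i) ->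
  0 <= Dstat A p h.
Proof.
by move=> A0 h0; rewrite mulr_ge0// sumr_ge0// => i _; rewrite divr_ge0// sqr_ge0.
Qed.

Lemma measurable_Dstat d (T : measurableType d) (A : R) (h : 'I_k -> R) (p : T -> 'I_k -> R) :
  (forall i, measurable_fun setT (fun w => p w i)) ->
  measurable_fun setT (fun w => Dstat A (p w) h).
Proof.
move=> mp; apply: measurable_funM => //; apply: measurable_sum_bigop => i.
by apply: measurable_funM => //; apply: measurable_funX; exact: measurable_funB.
Qed.

(** Pythagoras for the inner product with weights 1 / a_i: z - a is the sum of (S / A - 1) a and z -
    (S / A) a, which are orthogonal because both z and (S / A) a have total S. *)
Lemma sum_centred_square a (z : 'I_k -> R) : (0 < k)%N -> (forall i, 0 < a i) ->
  (forall i, 0 < z i) ->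
  let A := \sum_(i < k) a i in let S := \sum_(i < k) z i in
  \sum_(i < k) centred_square (a i) (z i) =
  centred_square A S + (S / A) ^+ 2 * Dstat A (simplex_proj z) (fun i => a i / A).
Proof.
move=> k0 a0 z0 A S.
have A0 : 0 < A by exact: sum_ord_gt0.
have S0 : 0 < S by exact: sum_ord_gt0.
have -> : \sum_(i < k) centred_square (a i) (z i) = \sum_(i < k) z i ^+ 2 / a i - 2 * S + A.
  rewrite mulr_sumr -sumrB -big_split/=; apply: eq_bigr => i _.
  by rewrite /centred_square; field; rewrite gt_eqF.
have -> : (S / A) ^+ 2 * Dstat A (simplex_proj z) (fun i => a i / A) =
    \sum_(i < k) z i ^+ 2 / a i - S ^+ 2 / A.
  rewrite /Dstat mulrA mulr_sumr.
  rewrite (eq_bigr (fun i => z i ^+ 2 / a i + (- 2 * S / A) * z i + (S / A) ^+ 2 * a i)); last first.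
    move=> i _; rewrite /simplex_proj -/S; field.
    by rewrite !gt_eqF.
  rewrite !big_split/= -!mulr_sumr -/A -/S; field.
  by rewrite gt_eqF.
rewrite /centred_square; field; by rewrite gt_eqF.
Qed.

Lemma continuous_centred_square (A : R) : continuous (centred_square A).
Proof.
move=> z; apply: cvgM; last exact: cvg_cst.
apply: (@continuous_comp _ _ _ (fun z => z - A) (fun x => x ^+ 2)); last exact: exprn_continuous.
by apply: cvgB; [exact: cvg_id|exact: cvg_cst].
Qed.

Lemma expN_le1 (x : R) : 0 <= x -> expR (- x) <= 1.
Proof. by move=> x0; rewrite -(@expR0 R) ler_expR oppr_le0. Qed.

Lemma bounded_nneg_expN_centred_square (A s : R) : 0 < A -> 0 <= s ->
  bounded_nneg (fun z => expR (- (s * centred_square A z))).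
Proof.
move=> A0 s0; split.
  move=> z; apply: continuous_comp; last exact: continuous_expR.
  by apply: cvgN; apply: cvgM; [exact: cvg_cst|exact: continuous_centred_square].
exists 1 => z _; rewrite ger0_norm ?expR_ge0// expN_le1// mulr_ge0//.
by rewrite divr_ge0 ?sqr_ge0// ltW.
Qed.

Lemma bounded_nneg_ratio (A : R) :
  bounded_nneg (fun z => Num.min 1 (2 * `|1 - (z / A) ^+ 2|)).
Proof.
split.
  move=> z.
  suff c : {for z, continuous (fun z : R => 2 * `|1 - (z / A) ^+ 2|)}.
    exact: (@continuous_min R R (cst 1) (fun z : R => 2 * `|1 - (z / A) ^+ 2|) z (cvg_cst _) c).
  apply: cvgM; first exact: cvg_cst.
  apply: cvg_norm; apply: cvgB; first exact: cvg_cst.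
  apply: (@continuous_comp R R R (fun z => z / A) (fun x => x ^+ 2)); last exact: exprn_continuous.
  by apply: cvgM; [exact: cvg_id|exact: cvg_cst].
exists 1 => z _; rewrite ger0_norm; first by rewrite ge_min lexx.
by rewrite le_min ler01 mulr_ge0.
Qed.

(** The first product is the transform of the full sum of squares; the second is what it would be
    without the factor (S / A)^2, split by independence. Pointwise the integrands differ as e^(-(S /
    A)^2 x) and e^(-x) do, with x = s D, up to a factor at most 1. *)
Lemma dirichlet_laplace_ineq d (T : measurableType d) (Q : probability T R)
    (Y : T -> 'I_k -> R) (a : 'I_k -> R) (s : R) :
  (0 < k)%N -> is_dirichlet Q Y a -> (forall i, 0 < a i) -> 0 <= s ->
  forall A, A = \sum_(i < k) a i ->
  `| \prod_(i < k) gamma_expectation (a i) (fun z => expR (- (s * centred_square (a i) z)))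
   - gamma_expectation A (fun z => expR (- (s * centred_square A z))) *
     Rintegral Q setT (fun w => expR (- (s * Dstat A (Y w) (fun i => a i / A)))) |
  <= gamma_expectation A (fun z => Num.min 1 (2 * `|1 - (z / A) ^+ 2|)).
Proof.
move=> k0 dY a0 s0 _ ->; set A := \sum_(i < k) a i.
have A0 : 0 < A by exact: sum_ord_gt0.
have h0 i : 0 <= a i / A by rewrite divr_ge0// ltW.
have [d' [T' [Q' [Z [hZ YZ]]]]] := dirichlet_pos_gamma_family dY a0.
have [mZ iZ Z0 lZ] := hZ.
pose phi y := expR (- (s * Dstat A y (fun i => a i / A))).
have mphi : measurable_fun setT phi.
  apply: measurableT_comp => //; apply: measurableT_comp => //; apply: measurable_funM => //.
  by apply: measurable_Dstat => i; exact: measurable_coord.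
have phi01 y : 0 < phi y <= 1.
  by rewrite expR_gt0/= expN_le1// mulr_ge0// Dstat_ge0// ltW.
have phi0 y : 0 <= phi y by exact: expR_ge0.
have YE : Rintegral Q setT (fun w => expR (- (s * Dstat A (Y w) (fun i => a i / A)))) =
    Rintegral Q' setT (fun w => phi (simplex_proj (fun i => Z i w))).
  exact: (YZ phi mphi phi0).
have bg := bounded_nneg_expN_centred_square A0 s0.
have br := bounded_nneg_ratio A.
have := gamma_family_indep hZ a0 k0 bg mphi phi01.
rewrite -/A -YE => <-.
(* With phi = 1 the error term becomes an expectation over S, on the same space as the other two. *)
have c1 : (forall y : vec R k, 0 < (cst 1 : vec R k -> R) y <= 1) by move=> y; rewrite /= ltr01 lexx.
have := gamma_family_indep hZ a0 k0 br (measurable_cst (1 : R)) c1.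
rewrite Rintegral_prob_cst mulr1 -/A => <-.
pose g i z := expR (- (s * centred_square (a i) z)).
have g01 i z : 0 <= g i z <= 1.
  by rewrite expR_ge0 expN_le1// mulr_ge0// divr_ge0 ?sqr_ge0// ltW.
have mg i : measurable_fun setT (g i).
  by have [c _] := bounded_nneg_expN_centred_square (a0 i) s0; exact: continuous_measurable_fun.
have -> : \prod_(i < k) gamma_expectation (a i) (fun z => expR (- (s * centred_square (a i) z))) =
    Rintegral Q' setT (fun w => \prod_(i < k) g i (Z i w)).
  rewrite indep_Rintegral_prod//; apply: eq_bigr => i _; rewrite lZ//.
  by move=> z; case/andP: (g01 i z).
pose S w := \sum_(i < k) Z i w.
have S0 w : 0 < S w by exact: sum_ord_gt0.
have mS : measurable_fun setT S by exact: measurable_sum_bigop.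
have mV : measurable_fun setT (fun w => simplex_proj (fun i => Z i w)).
  apply: (measurableT_comp (@measurable_simplex_proj R k)).
  exact: measurable_vec.
pose G w := expR (- (s * centred_square A (S w))) * phi (simplex_proj (fun i => Z i w)).
have G01 w : 0 <= G w <= 1.
  rewrite mulr_ge0 ?expR_ge0//= mulr_ile1 ?expR_ge0//.
    by rewrite expN_le1// mulr_ge0// divr_ge0 ?sqr_ge0// ltW.
  by case/andP: (phi01 (simplex_proj (fun i => Z i w))).
have mG : measurable_fun setT G.
  apply: measurable_funM; last exact: (measurableT_comp mphi mV).
  by case: bg => /continuous_measurable_fun m _; exact: (measurableT_comp m mS).
have P01 w : 0 <= \prod_(i < k) g i (Z i w) <= 1.
  by rewrite prodr_ge0 ?prodr_ile1// => i _; case/andP: (g01 i (Z i w)).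
have mP : measurable_fun setT (fun w => \prod_(i < k) g i (Z i w)).
  by apply: measurable_prod_bigop => i; exact: (measurableT_comp (mg i)).
have n1 (x : R) : 0 <= x <= 1 -> `|x| <= 1 by move=> /andP[? ?]; rewrite ger0_norm.
have iP := bounded_prob_integrable Q' mP (fun w => n1 _ (P01 w)).
have iG := bounded_prob_integrable Q' mG (fun w => n1 _ (G01 w)).
rewrite -RintegralB//.
pose r z : R := Num.min 1 (2 * `|1 - (z / A) ^+ 2|).
have mr : measurable_fun setT (fun w => r (S w)).
  by case: br => /continuous_measurable_fun m _; exact: (measurableT_comp m mS).
have r01 w : 0 <= r (S w) <= 1 by rewrite le_min ler01 mulr_ge0//= ge_min lexx.
have ir := bounded_prob_integrable Q' mr (fun w => n1 _ (r01 w)).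
have mB : measurable_fun setT (fun w => \prod_(i < k) g i (Z i w) - G w) by exact: measurable_funB.
have iB : Q'.-integrable setT (EFin \o (fun w => \prod_(i < k) g i (Z i w) - G w)).
  apply: (@bounded_prob_integrable _ _ _ Q' _ 2 mB) => w.
  rewrite (le_trans (ler_normB _ _))// (natrD R 1 1).
  by apply: lerD; apply: n1; [exact: P01|exact: G01].
apply: (le_trans (le_normr_Rintegral measurableT iB)).
under [leRHS]eq_Rintegral do rewrite mulr1.
apply: le_Rintegral => //.
  apply: (@bounded_prob_integrable _ _ _ Q' _ 2); first exact: measurableT_comp.
  move=> w; rewrite normr_id (le_trans (ler_normB _ _))// (natrD R 1 1).
  by apply: lerD; apply: n1; [exact: P01|exact: G01].
move=> w _.
have PE : \prod_(i < k) g i (Z i w) = expR (- (s * centred_square A (S w))) *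
    expR (- ((S w / A) ^+ 2 * (s * Dstat A (simplex_proj (fun i => Z i w)) (fun i => a i / A)))).
  rewrite -expR_sum sumrN -mulr_sumr sum_centred_square// -expRD; congr expR.
  rewrite -/A -/(S w); ring.
set x := s * Dstat _ _ _ in PE.
have x0 : 0 <= x by rewrite mulr_ge0// Dstat_ge0// ltW.
rewrite /G PE /phi -/x -mulrBr normrM (ger0_norm (expR_ge0 _)).
have e1 : expR (- (s * centred_square A (S w))) <= 1.
  by rewrite expN_le1// mulr_ge0// divr_ge0 ?sqr_ge0// ltW.
rewrite (le_trans (ler_piMl (normr_ge0 _) e1))// /r le_min; apply/andP; split.
  have q0 := sqr_ge0 (S w / A).
  have := expN_le1 x0; have := expN_le1 (mulr_ge0 q0 x0).
  have := expR_ge0 (- x); have := expR_ge0 (- ((S w / A) ^+ 2 * x)).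
  by rewrite ler_norml; lra.
by rewrite distrC dist_expN_le// sqr_ge0.
Qed.

End DirichletLaplace.

(** * The chi-squared limit *)

Section Chi2.
Context (R : realType).
Local Notation leb := (@lebesgue_measure R).

(** chi^2 with nu degrees of freedom is twice a Gamma(nu / 2) variable; the power of 2 makes the
    kernels agree exactly. *)
Let chi2_density (nu : nat) (t : R) := 2 `^ (nu%:R / 2 - 1) * pos_gamma (nu%:R / 2) (2^-1 * t).

Lemma chi2_kernel_restrict nu : (chi2_kernel nu) \_ `]0, +oo[%classic = chi2_density nu.
Proof.
apply/funext => t; rewrite patchE /chi2_density /pos_gamma pmulr_rgt0 ?invr_gt0//.
case: ifPn => [|]; rewrite ?inE ?notin_setE/= in_itv/= andbT => t0; last first.
  by rewrite ifF ?mulr0//; exact/negP.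
rewrite t0 /chi2_kernel /gamma_kernel mulrA -powRM//; last first.
  by rewrite mulr_ge0 ?invr_ge0// ltW.
by rewrite mulrA divff ?mul1r//; congr (_ * expR (- _)); rewrite mulrC.
Qed.

Lemma integral_pos_gamma_half (a : R) (f : R -> R) : measurable_fun setT f ->
  (forall z, 0 <= f z) ->
  (\int[leb]_t (f t * pos_gamma a (2^-1 * t))%:E =
   2%:E * \int[leb]_z (f (2 * z)%R * pos_gamma a z)%:E)%E.
Proof.
move=> mf f0; have h0 : 0 < 2^-1 :> R by rewrite invr_gt0.
have mlin (c : R) : measurable_fun setT (fun z : R => c * z) by exact: measurable_funM.
rewrite (@ge0_integral_affine R 0 2^-1 (fun z => (f (2 * z) * pos_gamma a z)%:E) h0).
- rewrite -ge0_integralZl//.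
  + apply: eq_integral => t _; rewrite -!EFinM add0r mulrA divff// mul1r.
    by rewrite mulrA divff// mul1r.
  + apply: measurable_funeM; apply/measurable_EFinP; apply: measurable_funM.
      apply: (measurableT_comp mf); apply: measurable_funM => //.
      exact: measurable_funD.
    apply: (measurableT_comp (measurable_pos_gamma a)).
    exact: measurable_funD.
  + by move=> t _; rewrite -EFinM lee_fin mulr_ge0 ?(ltW h0)// mulr_ge0// pos_gamma_ge0.
- apply/measurable_EFinP; apply: measurable_funM; last exact: measurable_pos_gamma.
  exact: (measurableT_comp mf).
- by move=> y; rewrite lee_fin mulr_ge0// pos_gamma_ge0.
Qed.

Lemma chi2_expectE nu :
  chi2_expect nu = weighted_expectation leb (chi2_density nu) id.
Proof.
apply/funext => f; rewrite /chi2_expect /weighted_expectation.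
rewrite !(Rintegral_mkcond leb `]0, +oo[) chi2_kernel_restrict; congr (_ / _).
apply: eq_Rintegral => t _; rewrite -chi2_kernel_restrict !patchE.
by case: ifP => //; rewrite mulr0.
Qed.

Lemma integral_chi2_density nu : (0 < nu)%N ->
  (\int[leb]_t (chi2_density nu t)%:E =
   (2 `^ (nu%:R / 2 - 1) * (2 * Gammaf (nu%:R / 2)))%:E)%E.
Proof.
move=> nu0; have a0 : 0 < nu%:R / 2 :> R by rewrite divr_gt0// ltr0n.
under eq_integral do rewrite /chi2_density.
have p0 (z : R) : 0 <= (cst (2 `^ (nu%:R / 2 - 1)) : R -> R) z by exact: powR_ge0.
rewrite (integral_pos_gamma_half _ (measurable_cst _) p0).
under eq_integral do rewrite /= EFinM.
have mpg : measurable_fun setT (fun z : R => (pos_gamma (nu%:R / 2) z)%:E).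
  by apply/measurable_EFinP; exact: measurable_pos_gamma.
have pg0 (z : R) : (0 <= (pos_gamma (nu%:R / 2) z)%:E)%E by rewrite lee_fin pos_gamma_ge0.
rewrite ge0_integralZl//.
by rewrite integral_pos_gamma// -!EFinM mulrCA.
Qed.

Let chi2_mass_gt0 nu : (0 < nu)%N -> 0 < 2 `^ (nu%:R / 2 - 1) * (2 * Gammaf (nu%:R / 2)) :> R.
Proof.
move=> nu0; rewrite mulr_gt0 ?powR_gt0// mulr_gt0// Gammaf_gt0//.
by rewrite divr_gt0// ltr0n.
Qed.

Let chi2_density_ge0 nu t : 0 <= chi2_density nu t.
Proof. by rewrite mulr_ge0 ?powR_ge0// pos_gamma_ge0. Qed.

Let measurable_chi2_density nu : measurable_fun setT (chi2_density nu).
Proof.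
apply: measurable_funM => //; apply: (measurableT_comp (measurable_pos_gamma _)).
exact: measurable_funM.
Qed.

Lemma nneg_expectation_chi2 nu : (0 < nu)%N -> nneg_expectation (@chi2_expect R nu).
Proof.
move=> nu0; rewrite chi2_expectE; apply: nneg_expectation_weighted.
- exact: chi2_density_ge0.
- apply/integrableP; split.
    by apply/measurable_EFinP; exact: measurable_chi2_density.
  under eq_integral do rewrite /= ger0_norm//.
  by rewrite integral_chi2_density// ltry.
- exact: measurable_id.
- move=> t; rewrite /chi2_density /pos_gamma; case: ifP => [|_]; last first.
    by rewrite mulr0 eqxx.
  by rewrite pmulr_rgt0 ?invr_gt0// => /ltW.
- by rewrite /Rintegral integral_chi2_density//; exact: chi2_mass_gt0.
Qed.

Lemma chi2_expect_expN nu (s : R) : (0 < nu)%N -> 0 <= s ->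
  chi2_expect nu (fun t => expR (- (s * t))) = (1 + 2 * s) `^ (- (nu%:R / 2)).
Proof.
move=> nu0 s0; have a0 : 0 < nu%:R / 2 :> R by rewrite divr_gt0// ltr0n.
rewrite chi2_expectE /weighted_expectation /Rintegral integral_chi2_density//=.
pose c : R := 2 `^ (nu%:R / 2 - 1).
have c0 : 0 < c by rewrite powR_gt0.
have G0 := Gammaf_gt0 a0.
have mf : measurable_fun setT (fun t : R => expR (- (s * t)) * c).
  by apply: measurable_funM => //; apply: continuous_measurable_fun; exact: continuous_expNM.
have f0 (z : R) : 0 <= expR (- (s * z)) * c by rewrite mulr_ge0 ?expR_ge0// ltW.
under eq_integral do rewrite /chi2_density mulrA.
rewrite (integral_pos_gamma_half _ mf f0).
have s20 : 0 <= 2 * s by rewrite mulr_ge0.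
have := @ge0_integral_pos_gamma_tilt R (nu%:R / 2) (2 * s) (cst c) s20 (measurable_cst _) (fun=> ltW c0).
have -> : (\int[leb]_z (cst c z * expR (- (2 * s * z)) * pos_gamma (nu%:R / 2) z)%:E =
    \int[leb]_z (expR (- (s * (2 * z))) * c * pos_gamma (nu%:R / 2) z)%:E)%E.
  apply: eq_integral => z _; rewrite /= (mulrC c); congr (expR (- _) * _ * _)%:E; ring.
move=> ->; under eq_integral do rewrite /= EFinM.
have mpg : measurable_fun setT (fun z : R => (pos_gamma (nu%:R / 2) z)%:E).
  by apply/measurable_EFinP; exact: measurable_pos_gamma.
have pg0 (z : R) : (0 <= (pos_gamma (nu%:R / 2) z)%:E)%E by rewrite lee_fin pos_gamma_ge0.
rewrite ge0_integralZl//; try by rewrite lee_fin ltW.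
rewrite integral_pos_gamma// -!EFinM /= -/c; field.
by rewrite !gt_eqF.
Qed.

Lemma cvg_powR_1D2 (b : R) : (1 + 2 * s) `^ (- b) @[s --> (0 : R)^'+] --> (1 : R).
Proof.
rewrite -[X in _ --> X](_ : (1 + 2 * 0) `^ (- b) = 1); last by rewrite mulr0 addr0 powR1.
apply: cvg_at_right_filter.
have p : 0 < 1 + 2 * 0 :> R by rewrite mulr0 addr0.
apply: (@continuous_comp _ _ _ (fun s : R => 1 + 2 * s) (fun x => x `^ (- b))).
  by apply: cvgD; [exact: cvg_cst|apply: cvgM; [exact: cvg_cst|exact: cvg_id]].
apply: differentiable_continuous; apply/derivable1_diffP.
exact: (@ex_derive _ _ _ _ _ _ _ (is_derive1_powR (- b) p)).
Qed.

Lemma chi2_expect_expN_cvg nu : (0 < nu)%N ->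
  chi2_expect nu (fun t => expR (- (s * t))) @[s --> (0 : R)^'+] --> (1 : R).
Proof.
move=> nu0; apply: cvg_trans (@cvg_powR_1D2 (nu%:R / 2)).
apply: near_eq_cvg; near=> s.
by rewrite chi2_expect_expN//; near: s; exact: nbhs_right_ge.
Unshelve. all: by end_near. Qed.

End Chi2.

Lemma cvg_big_prod (R : realType) (I : Type) (r : seq I) (f : I -> nat -> R) (l : I -> R) :
  (forall i, f i n @[n --> \oo] --> l i) ->
  (fun n => \prod_(i <- r) f i n) @ \oo --> \prod_(i <- r) l i.
Proof.
move=> fl; elim: r => [|i r IH].
  by rewrite big_nil; under eq_fun do rewrite big_nil; exact: cvg_cst.
rewrite big_cons; under eq_fun do rewrite big_cons.
by apply: cvgM; [exact: fl|exact: IH].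
Qed.

Section DirichletLimit.
Context (R : realType) (k : nat) d (T : measurableType d) (Q : probability T R).
Variables (a : nat -> 'I_k -> R) (Y : nat -> T -> 'I_k -> R).
Hypotheses (k2 : (2 <= k)%N) (a0 : forall n i, 0 < a n i).
Hypothesis any : forall i, a n i @[n --> \oo] --> +oo.
Hypothesis dY : forall n, is_dirichlet Q (Y n) (a n).

Let A n := \sum_(i < k) a n i.
Let D n w := Dstat (A n) (Y n w) (fun i => a n i / A n).

Let k0 : (0 < k)%N. Proof. exact: ltn_trans k2. Qed.

Let aA n i : a n i <= A n.
Proof. by rewrite /A (bigD1 i)//= lerDl sumr_ge0// => j _; exact: ltW. Qed.

Let A0 n : 0 < A n.
Proof. exact: lt_le_trans (aA n (Ordinal k0)). Qed.

Let Ay : A n @[n --> \oo] --> +oo.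
Proof.
apply/cvgryPge => M; have /cvgryPge/(_ M) := any (Ordinal k0).
by apply: filterS => n h; exact: le_trans h (aA _ _).
Qed.

(** With c = (1 + 2s)^(-1/2), [P] tends to c^k and [G] to c, while P - G E is bounded by r -> 0. As
    c > 0, dividing is legitimate for large n and E tends to c^(k-1). *)
Lemma dirichlet_Dstat_laplace (s : R) : 0 <= s ->
  Rintegral Q setT (fun w => expR (- (s * D n w))) @[n --> \oo] -->
  chi2_expect k.-1 (fun t => expR (- (s * t))).
Proof.
move=> s0; have s1 : 0 < 1 + 2 * s by rewrite ltr_wpDr// mulr_ge0.
have k10 : (0 < k.-1)%N by rewrite -ltnS prednK.
pose c := (1 + 2 * s) `^ (- 2^-1).
have c0 : 0 < c by exact: powR_gt0.
pose P n := \prod_(i < k) gamma_expectation (a n i)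
  (fun z => expR (- (s * centred_square (a n i) z))).
pose G n := gamma_expectation (A n) (fun z => expR (- (s * centred_square (A n) z))).
pose r n := gamma_expectation (A n) (fun z => Num.min 1 (2 * `|1 - (z / A n) ^+ 2|)).
pose E n := Rintegral Q setT (fun w => expR (- (s * D n w))).
have cP : P @ \oo --> c ^+ k.
  have : (fun n => \prod_(i < k) gamma_expectation (a n i)
      (fun z => expR (- (s * centred_square (a n i) z)))) @ \oo --> \prod_(i < k) c.
    apply: cvg_big_prod => i.
    exact: (@gamma_centred_square_cvg R (a ^~ i) s s0 (a0 ^~ i) (any i)).
  by rewrite prodr_const card_ord.
have cG : G @ \oo --> c by exact: gamma_centred_square_cvg.
have cr : r @ \oo --> (0 : R) by exact: gamma_ratio_cvg.
have ineq n : `|P n - G n * E n| <= r n.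
  by apply: dirichlet_laplace_ineq.
have cGE : (fun n => G n * E n) @ \oo --> c ^+ k.
  have c1 : (fun n => P n - G n * E n) @ \oo --> (0 : R).
    apply: norm_cvg0; apply: (@squeeze_cvgr _ _ _ _ (cst 0) r) => //.
      by near=> n; rewrite normr_ge0/= ineq.
    exact: cvg_cst.
  have -> : (fun n => G n * E n) = (fun n => P n - (P n - G n * E n)).
    by apply/funext => n; ring.
  by rewrite -[c ^+ k]subr0; exact: cvgB.
have -> : chi2_expect k.-1 (fun t => expR (- (s * t))) = c ^+ k / c.
  rewrite chi2_expect_expN// -[in c ^+ k](prednK k0) exprS mulrAC divff ?gt_eqF// mul1r.
  rewrite /c -powR_mulrn ?powR_ge0// -powRrM; congr (_ `^ _); ring.
have Gi : (fun n => (G n)^-1) @ \oo --> c^-1 by apply: cvgV => //; exact: lt0r_neq0.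
apply: cvg_trans (cvgM cGE Gi); apply: near_eq_cvg; near=> n.
have Gn0 : G n != 0.
  near: n; have /cvgrPdist_lt/(_ _ c0) := cG; apply: filterS => n.
  by move=> h; apply/eqP => G0; move: h; rewrite G0 subr0 gtr0_norm// ltxx.
by rewrite /= mulrAC divff ?mul1r.
Unshelve. all: by end_near. Qed.

End DirichletLimit.

(** * Comparison of the two divergences *)

Section KLBound.
Context (R : realType) (k : nat).

Lemma KLdiv_Dstat_dist (A K L : R) (p h : 'I_k -> R) : 0 < A -> 0 < L ->
  (forall i, L <= A * h i) -> (forall i, 0 <= p i) ->
  \sum_(i < k) p i = 1 -> \sum_(i < k) h i = 1 -> Dstat A p h <= K ->
  `|2 * A * KLdiv p h - Dstat A p h| <= K * Num.sqrt (K / L).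
Proof.
move=> A0 L0 LA p0 p1 h1 DK.
have Ah0 i : 0 < A * h i by exact: lt_le_trans (LA i).
have h0 i : 0 < h i by rewrite -(pmulr_rgt0 _ A0).
pose y i := p i / h i.
have y0 i : 0 <= y i by rewrite divr_ge0// ltW.
have DE : Dstat A p h = \sum_(i < k) A * h i * (y i - 1) ^+ 2.
  rewrite /Dstat mulr_sumr; apply: eq_bigr => i _; rewrite /y.
  by field; rewrite gt_eqF.
have -> : 2 * A * KLdiv p h - Dstat A p h =
    \sum_(i < k) A * h i * (2 * y i * ln (y i) - (y i ^+ 2 - 1)).
  (* Adding this vanishing first-order term turns (y - 1)^2 into y^2 - 1, the form required by
     [entropy_third_order]. *)
  have e0 : \sum_(i < k) 2 * A * (p i - h i) = 0.
    by rewrite -mulr_sumr sumrB p1 h1 subrr mulr0.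
  rewrite -[LHS]subr0 -[X in _ - X]e0 DE /KLdiv mulr_sumr -sumrB -sumrB.
  apply: eq_bigr => i _.
  have pE : p i = y i * h i by rewrite /y divfK// gt_eqF.
  rewrite -/(y i) pE; ring.
have D0 i : 0 <= A * h i * (y i - 1) ^+ 2 by rewrite mulr_ge0 ?sqr_ge0// ltW.
(* A single term of D is at least L (y i - 1)^2, so D <= K bounds every ratio; one factor of the
   cube is spent on this. *)
have yK i : `|y i - 1| <= Num.sqrt (K / L).
  rewrite -sqrtr_sqr ler_wsqrtr// ler_pdivlMr// (le_trans _ DK)// DE (bigD1 i)//=.
  rewrite (@le_trans _ _ (A * h i * (y i - 1) ^+ 2))//.
    by rewrite mulrC ler_wpM2r ?sqr_ge0.
  by rewrite lerDl sumr_ge0.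
rewrite (le_trans (ler_norm_sum _ _ _))//.
apply: (@le_trans _ _ (Dstat A p h * Num.sqrt (K / L))); last first.
  by rewrite ler_wpM2r// sqrtr_ge0.
rewrite DE mulr_suml; apply: ler_sum => i _.
rewrite normrM (gtr0_norm (Ah0 i)) -[leRHS]mulrA ler_wpM2l ?(ltW (Ah0 i))//.
rewrite (le_trans (entropy_third_order (y0 i)))// exprSr real_normK ?num_real//.
by rewrite ler_wpM2l ?sqr_ge0.
Qed.

End KLBound.

(** * Transfer of limits between two nearby sequences, with tightness read off Laplace transforms *)

Section Slutsky.
Context (R : realType) d (T : measurableType d) (Q : probability T R).
Variables (D K : nat -> T -> R) (l : R -> R).
Hypotheses (mD : forall n, measurable_fun setT (D n)) (mK : forall n, measurable_fun setT (K n)).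
Hypothesis D0 : forall n w, 0 <= D n w.
Hypothesis lD : forall s, 0 <= s ->
  Rintegral Q setT (fun w => expR (- (s * D n w))) @[n --> \oo] --> l s.
Hypothesis l1 : l s @[s --> (0 : R)^'+] --> (1 : R).
Hypothesis KD : forall M e, 0 < M -> 0 < e -> \forall n \near \oo,
  forall w, D n w <= M -> `|K n w - D n w| <= e.

(** Majorant of the indicator of D > M, because e^(-1) <= 1/2; its mean is an affine function of the
    Laplace transform at 1 / M. *)
Let tl (M : R) n w := 2 * (1 - expR (- (M^-1 * D n w))).

Let tl01 M n w : 0 < M -> 0 <= tl M n w <= 2.
Proof.
move=> M0; have e1 : expR (- (M^-1 * D n w)) <= 1.
  by apply: expN_le1; rewrite mulr_ge0// invr_ge0 ltW.
by have := expR_ge0 (- (M^-1 * D n w)); rewrite /tl => ?; apply/andP; split; lra.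
Qed.

Let tl_ge1 M n w : 0 < M -> M < D n w -> 1 <= tl M n w.
Proof.
move=> M0 MD; rewrite /tl.
have : expR (- (M^-1 * D n w)) <= expR (- 1).
  by rewrite ler_expR lerN2 -(mulVf (lt0r_neq0 M0)) ler_wpM2l ?invr_ge0 ?ltW.
have : expR (- 1) <= 2^-1 :> R.
  by rewrite expRN lef_pV2 ?posrE ?expR_gt0// (le_trans _ (expR_ge1Dx 1)).
by move=> h1 h2; lra.
Qed.

Let mexp s n : measurable_fun setT (fun w => expR (- (s * D n w))).
Proof.
apply: (measurableT_comp _ (mD n) : measurable_fun setT ((fun x : R => expR (- (s * x))) \o D n)).
by apply: continuous_measurable_fun; exact: continuous_expNM.
Qed.

Let mtl M n : measurable_fun setT (tl M n).
Proof. by apply: measurable_funM => //; apply: measurable_funB => //; exact: mexp. Qed.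

Let itl M n : 0 < M -> Q.-integrable setT (EFin \o tl M n).
Proof.
move=> M0; apply: (@bounded_prob_integrable _ _ _ Q _ 2 (mtl M n)) => w.
by have /andP[t0 t2] := tl01 n w M0; rewrite ger0_norm.
Qed.

Let tail (e : R) : 0 < e -> exists2 M, 0 < M &
  \forall n \near \oo, Rintegral Q setT (tl M n) <= e.
Proof.
move=> e0; have e40 : 0 < e / 4 by rewrite divr_gt0.
(* The cutoff is M = 1 / s; the two errors e / 4 are then doubled by the factor 2 in [tl]. *)
have [s s0 ls] : exists2 s, 0 < s & `|1 - l s| < e / 4.
  move/cvgrPdist_lt : l1 => /(_ _ e40) H.
  near (0 : R)^'+ => s; exists s; near: s => //.
  exact: nbhs_right_gt.
exists s^-1; first by rewrite invr_gt0.
have /cvgrPdist_lt/(_ _ e40) := lD (ltW s0); apply: filterS => n hn.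
have -> : Rintegral Q setT (tl s^-1 n) =
    2 * (1 - Rintegral Q setT (fun w => expR (- (s * D n w)))).
  have i1 : Q.-integrable setT (EFin \o (fun _ : T => 1 : R)).
    by apply: (@bounded_prob_integrable _ _ _ Q _ 1) => // w; rewrite normr1.
  have i2 : Q.-integrable setT (EFin \o (fun w => expR (- (s * D n w)))).
    apply: (@bounded_prob_integrable _ _ _ Q _ 1 (mexp s n)) => w.
    by rewrite ger0_norm ?expR_ge0// expN_le1// mulr_ge0// ltW.
  rewrite -[X in X - _](Rintegral_prob_cst Q 1) -RintegralB// -RintegralZl//.
    by apply: eq_Rintegral => w _; rewrite /tl invrK.
  exact: (@integrableB _ _ _ Q _ measurableT _ _ i1 i2).
by move: hn ls; rewrite !ltr_norml => /andP[? ?] /andP[? ?]; lra.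
Unshelve. all: by end_near. Qed.

Lemma slutsky_prob : cvg_prob0 Q (fun n w => K n w - D n w).
Proof.
move=> eps eps0.
have mB n : measurable [set w | eps < `|K n w - D n w|].
  have m : measurable_fun setT (fun w => `|K n w - D n w|).
    by apply: measurableT_comp => //; exact: measurable_funB.
  have := m measurableT _ (measurable_itv `]eps, +oo[).
  rewrite setTI; congr measurable; apply/seteqP; split => w /=.
    by rewrite in_itv/= andbT.
  by rewrite in_itv/= andbT.
apply/fine_cvgP; split.
  by near=> n; rewrite fin_num_measure.
apply/cvgrPdist_le => /= e e0.
have [M M0 HM] := tail e0.
have e20 : 0 < eps / 2 by rewrite divr_gt0.
near=> n; rewrite sub0r normrN ger0_norm ?fine_ge0//.
have hM : Rintegral Q setT (tl M n) <= e by near: n.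
have hK : forall w, D n w <= M -> `|K n w - D n w| <= eps / 2.
  by near: n; exact: KD.
rewrite (le_trans _ hM)// /Rintegral fine_le ?fin_num_measure//.
  by apply: integrable_fin_num => //; exact: itl.
rewrite -[X in Q X]setIT -integral_indic//; apply: ge0_le_integral => //=.
- by apply/measurable_EFinP; exact: measurable_indic.
- by apply/measurable_EFinP; exact: mtl.
- move=> w _; rewrite lee_fin indicE; case: (boolP (w \in _)) => [|_]; last first.
    by have /andP[] := tl01 n w M0.
  rewrite inE/= => ew; apply: tl_ge1 => //; rewrite ltNge; apply/negP => /hK h.
  by have := lt_le_trans ew h; lra.
Unshelve. all: by end_near. Qed.

(** Where D <= M, uniform continuity of f on [0, M] applies to the nearby values of D and K;
    elsewhere the difference is at most 2N, which is absorbed by 2N [tl]. *)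
Lemma slutsky_dist (f : R -> R) (c : R) : continuous f -> (exists M, forall t, `|f t| <= M) ->
  Rintegral Q setT (fun w => f (D n w)) @[n --> \oo] --> c ->
  Rintegral Q setT (fun w => f (K n w)) @[n --> \oo] --> c.
Proof.
move=> cf [N fN] fD.
have N0 : 0 <= N by exact: le_trans (fN 0).
have mf : measurable_fun setT f by exact: continuous_measurable_fun.
have mfD n : measurable_fun setT (fun w => f (D n w)) by exact: measurableT_comp.
have mfK n : measurable_fun setT (fun w => f (K n w)) by exact: measurableT_comp.
have N1 : 0 < N + 1 by rewrite ltr_wpDl.
apply/cvgrPdist_le => /= e e0.
have e20 : 0 < e / 4 by rewrite divr_gt0.
have e30 : 0 < e / (8 * (N + 1)) by rewrite divr_gt0// mulr_gt0.
have [M M0 HM] := tail e30.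
have [r r0 hr] := @segment_unif_continuous R f 0 M _ e20 (fun x _ => cf x).
have r20 : 0 < r / 2 by rewrite divr_gt0.
near=> n.
have hM : Rintegral Q setT (tl M n) <= e / (8 * (N + 1)) by near: n.
have hK : forall w, D n w <= M -> `|K n w - D n w| <= r / 2 by near: n; exact: KD.
have hD : `|c - Rintegral Q setT (fun w => f (D n w))| <= e / 4.
  by near: n; move/cvgrPdist_le : fD => /(_ _ e20).
have iD := bounded_prob_integrable Q (mfD n) (fun w => fN (D n w)).
have iK := bounded_prob_integrable Q (mfK n) (fun w => fN (K n w)).
have it := itl n M0.
have mdiff : measurable_fun setT (fun w => f (D n w) - f (K n w)) by exact: measurable_funB.
have diff2 w : `|f (D n w) - f (K n w)| <= 2 * N.
  by rewrite (le_trans (ler_normB _ _))// mulr2n mulrDl !mul1r lerD.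
have idiff := bounded_prob_integrable Q mdiff diff2.
have key : `|Rintegral Q setT (fun w => f (D n w)) - Rintegral Q setT (fun w => f (K n w))|
    <= e / 4 + 2 * N * Rintegral Q setT (tl M n).
  rewrite -RintegralB// (le_trans (le_normr_Rintegral measurableT idiff))//.
  have ic : Q.-integrable setT (EFin \o (fun _ : T => e / 4)).
    by apply: (@bounded_prob_integrable _ _ _ Q _ `|e / 4|).
  have itN : Q.-integrable setT (EFin \o (fun w => 2 * N * tl M n w)).
    exact: (@integrableZl _ _ _ Q _ measurableT (2 * N) _ it).
  rewrite -[X in X + _](Rintegral_prob_cst Q (e / 4)) -RintegralZl// -RintegralD//.
  apply: le_Rintegral => //.
  - apply: (@bounded_prob_integrable _ _ _ Q _ (2 * N)); first exact: measurableT_comp.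
    by move=> w; rewrite normr_id.
  - exact: (@integrableD _ _ _ Q _ measurableT _ _ ic itN).
  - move=> w _; have /andP[t0 _] := tl01 n w M0.
    have [DM|DM] := leP (D n w) M.
      apply: (@le_trans _ _ (e / 4)); last by rewrite lerDl mulr_ge0// mulr_ge0.
      apply/ltW/hr; first by rewrite D0.
      by rewrite distrC (le_lt_trans (hK w DM))//; lra.
    rewrite (le_trans (diff2 w))// ler_wpDl ?(ltW e20)//.
    by rewrite ler_peMr ?mulr_ge0// tl_ge1.
have : 2 * N * Rintegral Q setT (tl M n) <= e / 4.
  apply: (@le_trans _ _ (2 * (N + 1) * (e / (8 * (N + 1))))).
    apply: ler_pM => //; rewrite ?mulr_ge0//; last by lra.
    by apply: Rintegral_ge0 => w _; have /andP[] := tl01 n w M0.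
  by rewrite le_eqVlt; apply/orP; left; apply/eqP; field; rewrite gt_eqF.
move: key hD; rewrite !ler_norml => /andP[? ?] /andP[? ?] ?.
by apply/andP; split; lra.
Unshelve. all: by end_near. Qed.

End Slutsky.

(** * Visits of the observations to the cells *)

Section Visits.
Context (R : realType) dX (X : measurableType dX) (F : probability X R).
Context d0 (Om0 : measurableType d0) (Q0 : probability Om0 R).
Variables (Xs : nat -> Om0 -> X) (B : set X).
Hypotheses (iid : iid_seq Q0 Xs F) (mB : measurable B) (FB : (0 < F B)%E).

Let mX n : measurable_fun setT (Xs n). Proof. by case: iid. Qed.

Let avoid n := \bigcap_(m in [set m | (n <= m)%N]) (Xs m @^-1` (~` B)).

Let mavoid n : measurable (avoid n).
Proof.
apply: bigcap_measurable; first by exists n => /=.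
by move=> m _; rewrite -[X in measurable X]setTI; apply: mX => //; exact: measurableC.
Qed.

Let avoid_le n r : (Q0 (avoid n) <= ((1 - fine (F B)) ^+ r)%:E)%E.
Proof.
(* [iid_seq] speaks of initial blocks, so the first n observations are left unconstrained and the
   next r avoid B. *)
pose C (i : 'I_(n + r)) : set X := if (i < n)%N then setT else ~` B.
have mC i : measurable (C i) by rewrite /C; case: ifP => // _; exact: measurableC.
have [_ /(_ _ C mC) H] := iid.
apply: (@le_trans _ _ (Q0 (\bigcap_(i in [set: 'I_(n + r)]) (Xs i @^-1` C i)))).
  apply: le_measure; rewrite ?inE//.
    apply: fin_bigcap_measurable; first exact: finite_finset.
    by move=> i _; rewrite -[X in measurable X]setTI; apply: mX.
  move=> w Hw i _ /=; rewrite /C; case: ltnP => // ni.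
  exact: (Hw i).
rewrite H big_split_ord/=.
rewrite big1 ?mul1e; last first.
  by move=> i _; rewrite /C /= ltn_ord; exact: probability_setT.
rewrite (eq_bigr (fun=> (1 - fine (F B))%:E)); last first.
  move=> i _; rewrite /C /= ltnNge leq_addr/=.
  rewrite probability_setC// EFinB fineK ?fin_num_measure//.
by rewrite prodEFin prodr_const card_ord.
Qed.

(** Avoiding B from time n onwards has probability at most (1 - F B)^r for every r, hence zero; then
    countably many n are combined. *)
Lemma ae_infinitely_many_visits :
  {ae Q0, forall w, forall n, exists2 m, (n <= m)%N & B (Xs m w)}.
Proof.
apply: ae_foralln => n; exists (avoid n); split.
- exact: mavoid.
- apply/eqP; rewrite eq_le measure_ge0 andbT.
  have f1 : 0 < fine (F B) <= 1.
    rewrite -!lte_fin -lee_fin fineK ?fin_num_measure// FB.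
    exact: probability_le1.
  have q1 : `|1 - fine (F B)| < 1 by rewrite ger0_norm; lra.
  have c := cvg_expr q1.
  have Qf : Q0 (avoid n) \is a fin_num by exact: fin_num_measure.
  have H : fine (Q0 (avoid n)) <= 0.
    apply: (ler_cvg_to (cvg_cst (fine (Q0 (avoid n)))) c).
    near=> r => /=; rewrite -lee_fin (fineK Qf); exact: avoid_le.
  by move: H; rewrite -lee_fin (fineK Qf).
- move=> w /= nB m nm /= BX; apply: nB; by exists m.
Unshelve. all: by end_near. Qed.

End Visits.

Lemma visits_count_cvg (R : realType) (X : Type) (x : nat -> X) (B : set X) (c : R) :
  (forall n, exists2 m, (n <= m)%N & B (x m)) ->
  c + \sum_(j < m) \1_B (x j) @[m --> \oo] --> +oo.
Proof.
move=> vis.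
have nd (m n : nat) : (m <= n)%N ->
    \sum_(j < m) \1_B (x j) <= \sum_(j < n) \1_B (x j) :> R.
  move=> /subnK <-; rewrite addnC; elim: (n - m)%N => [|r IH]; first by rewrite addn0.
  by rewrite addnS big_ord_recr/= (le_trans IH)// lerDl.
have ex K : exists m, K%:R <= \sum_(j < m) \1_B (x j) :> R.
  elim: K => [|K [m Km]]; first by exists 0%N; rewrite big_ord0.
  have [n mn Bn] := vis m; exists n.+1.
  rewrite big_ord_recr/= indicE mem_set// -natr1 lerD//.
  exact: le_trans Km (nd _ _ mn).
apply/cvgryPge => M.
have [m hm] := ex (Num.truncn (M - c)).+1.
exists m => // n /= mn; rewrite -lerBlDl (le_trans _ (nd _ _ mn))//.
by rewrite (le_trans _ hm)//; apply: ltW; exact: truncnS_gt.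
Qed.

Lemma sum_mpartition (R : realType) dX (X : measurableType dX) (P : probability X R)
    (k : nat) (A : 'I_k -> set X) : is_mpartition A ->
  \sum_(i < k) fine (P (A i)) = 1.
Proof.
move=> [mA [dA UA]].
have tA : trivIset setT A by apply/trivIsetP => i j _ _ ij; exact: dA.
have H := measure_bigsetU_ord P predT mA tA.
have UE : \big[setU/set0]_(i < k) A i = setT.
  rewrite -subTset -UA => x [i _ Aix]; rewrite (bigD1 i)//=; by left.
apply: EFin_inj; rewrite -sumEFin.
rewrite (eq_bigr (fun i => P (A i))); last by move=> i _; rewrite fineK// fin_num_measure.
by rewrite -H UE; exact: probability_setT.
Qed.

(** * Both limits for Dirichlet vectors whose parameters all diverge *)

Section DirichletDivergences.
Context (R : realType) (k : nat) d (T : measurableType d) (Q : probability T R).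
Variables (a : nat -> 'I_k -> R) (Y : nat -> T -> 'I_k -> R).
Hypotheses (k2 : (2 <= k)%N) (a0 : forall n i, 0 < a n i).
Hypothesis any : forall i, a n i @[n --> \oo] --> +oo.
Hypothesis dY : forall n, is_dirichlet Q (Y n) (a n).
Hypotheses (Y0 : forall n w i, 0 <= Y n w i) (Y1 : forall n w, \sum_(i < k) Y n w i = 1).

Let A n := \sum_(i < k) a n i.
Let h n i := a n i / A n.
Let D n w := Dstat (A n) (Y n w) (h n).
Let K n w := 2 * A n * KLdiv (Y n w) (h n).

Let k0 : (0 < k)%N. Proof. exact: ltn_trans k2. Qed.
Let k10 : (0 < k.-1)%N. Proof. by rewrite -ltnS prednK. Qed.

Let A0 n : 0 < A n.
Proof.
exact: sum_ord_gt0.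
Qed.

Let h0 n i : 0 < h n i. Proof. exact: divr_gt0. Qed.

Let mY n i : measurable_fun setT (fun w => Y n w i).
Proof. by case: (dY n). Qed.

Let mD n : measurable_fun setT (D n). Proof. exact: measurable_Dstat. Qed.

Let D0 n w : 0 <= D n w.
Proof.
by apply: Dstat_ge0 => [|i]; [exact: (ltW (A0 n))|exact: (ltW (h0 n i))].
Qed.

Let mK n : measurable_fun setT (K n).
Proof.
apply: measurable_funM => //; apply: measurable_sum_bigop => i.
apply: measurable_funM => //; apply: (measurableT_comp (@measurable_ln R)).
exact: measurable_funM.
Qed.

Let KD M e : 0 < M -> 0 < e -> \forall n \near \oo,
  forall w, D n w <= M -> `|K n w - D n w| <= e.
Proof.
(* Solves M sqrt (M / L) = e, the bound of [KLdiv_Dstat_dist] with K = M. *)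
move=> M0 e0; pose L := M / (e / M) ^+ 2.
have eM : 0 < e / M by exact: divr_gt0.
have L0 : 0 < L by rewrite divr_gt0// exprn_gt0.
have La : \forall n \near \oo, forall i, L <= a n i.
  by apply: filter_forall => i; have /cvgryPge/(_ L) := any i.
apply: filterS La => n La w Dw.
have An0 : A n != 0 by rewrite gt_eqF.
have h1 : \sum_(i < k) h n i = 1 by rewrite -mulr_suml; exact: (divff An0).
have LA i : L <= A n * h n i by rewrite mulrC (divfK An0).
have := KLdiv_Dstat_dist (A0 n) L0 LA (Y0 n w) (Y1 n w) h1 Dw.
have -> : M / L = (e / M) ^+ 2.
  by rewrite /L; field; rewrite (gt_eqF M0) (gt_eqF e0).
by rewrite sqrtr_sqr (gtr0_norm eM) [M * _]mulrC divfK// gt_eqF.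
Qed.

Lemma dirichlet_Dstat_chi2 : cvg_dist_chi2 Q D k.-1.
Proof.
move=> f cf [M fM].
have bf : bounded_nneg f by split => //; exists M.
have lap := dirichlet_Dstat_laplace k2 a0 any dY.
have E n g : Rintegral Q setT (fun w => g (D n w)) =
    weighted_expectation Q (fun=> 1) (D n) g.
  rewrite /weighted_expectation Rintegral_prob_cst divr1.
  by apply: eq_Rintegral => w _; rewrite mulr1.
under eq_fun do rewrite E.
apply: (@laplace_continuity R (fun n => weighted_expectation Q (fun=> 1) (D n))
  (@chi2_expect R k.-1)) => //.
- move=> n; apply: nneg_expectation_weighted => //.
    by apply: (@bounded_prob_integrable _ _ _ Q _ 1) => // w; rewrite normr1.
  by rewrite Rintegral_prob_cst.
- exact: nneg_expectation_chi2.
- by move=> s s0; under eq_fun do rewrite -E; exact: lap.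
- exact: chi2_expect_expN_cvg.
Qed.

Lemma dirichlet_KL_chi2 :
  cvg_prob0 Q (fun n w => K n w - D n w) /\ cvg_dist_chi2 Q K k.-1.
Proof.
have lD := dirichlet_Dstat_laplace k2 a0 any dY.
have l1 := @chi2_expect_expN_cvg R _ k10.
split; first exact: (slutsky_prob mD mK D0 lD l1 KD).
move=> f cf bf.
apply: (slutsky_dist mD mK D0 lD l1 KD cf bf).
exact: dirichlet_Dstat_chi2.
Qed.

End DirichletDivergences.

Theorem theorem4p3 (R : realType) (dX : measure_display) (X : measurableType dX)
    (alpha : R) (H F : probability X R)
    (d0 : measure_display) (Om0 : measurableType d0) (Q0 : probability Om0 R)
    (Xs : nat -> Om0 -> X)
    (d : measure_display) (Om : measurableType d) (Q : probability Om R)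
    (Pst : Om0 -> nat -> Om -> probability X R)
    (k : nat) (A : 'I_k -> set X) :
  0 < alpha ->
  iid_seq Q0 Xs F ->
  (forall (w0 : Om0) (m : nat),
     is_DP Q (Pst w0 m) (alpha + m%:R) (Hstar alpha H (fun j => Xs j w0) m)) ->
  (2 <= k)%N ->
  is_mpartition A ->
  (forall i, (0 < F (A i))%E) ->
  let p := fun (w0 : Om0) (m : nat) (w : Om) (i : 'I_k) =>
             fine (Pst w0 m w (A i)) in
  let h := fun (w0 : Om0) (m : nat) (i : 'I_k) =>
             Hstar alpha H (fun j => Xs j w0) m (A i) in
  let D := fun (w0 : Om0) (m : nat) (w : Om) =>
             Dstat (alpha + m%:R) (p w0 m w) (h w0 m) in
  let KL2 := fun (w0 : Om0) (m : nat) (w : Om) =>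
             2 * (alpha + m%:R) * KLdiv (p w0 m w) (h w0 m) in
  {ae Q0, forall w0 : Om0,
     cvg_dist_chi2 Q (D w0) k.-1 /\
     cvg_prob0 Q (fun m w => KL2 w0 m w - D w0 m w) /\
     cvg_dist_chi2 Q (KL2 w0) k.-1}.
Proof.
move=> alpha0 iid DP k2 pA FA p h D KL2.
have [mA [dA UA]] := pA.
have visits : {ae Q0, forall w0, forall i : 'I_k, forall n,
    exists2 m, (n <= m)%N & A i (Xs m w0)}.
  by apply: filter_forall => i; exact: (ae_infinitely_many_visits iid (mA i) (FA i)).
apply: filterS visits => w0 vis.
have am0 m : 0 < alpha + m%:R by rewrite ltr_wpDr.
(* The Dirichlet parameters: the prior mass of the cell plus the number of observations in it. *)
pose a m i := (alpha + m%:R) * h w0 m i.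
have aE m i : a m i = alpha * fine (H (A i)) + \sum_(j < m) \1_(A i) (Xs j w0).
  by rewrite /a /h /Hstar mulrC divfK// gt_eqF.
have ay i : a m i @[m --> \oo] --> +oo.
  under eq_fun do rewrite aE.
  exact: (@visits_count_cvg R X (fun j => Xs j w0) (A i)).
have sum_a m : \sum_(i < k) a m i = alpha + m%:R.
  under eq_bigr do rewrite aE.
  rewrite big_split/= -mulr_sumr sum_mpartition// mulr1; congr (_ + _).
  (* Each observation lies in exactly one cell of the partition. *)
  rewrite exchange_big/= (eq_bigr (fun=> 1)); last first.
    move=> j _; have : (\bigcup_(i in [set: 'I_k]) A i) (Xs j w0) by rewrite UA.
    move=> [i _ Ai]; rewrite (bigD1 i)//= indicE mem_set// big1 ?addr0// => i' ii'.
    rewrite indicE memNset// => Ai'; have := dA i' i ii'.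
    by rewrite -subset0 => /(_ (Xs j w0)); apply.
  by rewrite sumr_const card_ord.
(* A cell with H (A i) = 0 has parameter 0 until its first visit, where the Gamma law degenerates to
   a point mass. The first N indices are therefore dropped and the limits shifted back at the
   end. *)
have [N _ HN] : \forall m \near \oo, forall i, 1 <= a m i.
  by apply: filter_forall => i; have /cvgryPge/(_ 1) := ay i.
pose a' n := a (n + N)%N; pose Y' n := p w0 (n + N)%N.
have a'0 n i : 0 < a' n i.
  by apply: (lt_le_trans ltr01); apply: HN; rewrite /= leq_addl.
have a'y i : a' n i @[n --> \oo] --> +oo.
  by have := ay i; rewrite -(cvg_shiftn N).
have dY n : is_dirichlet Q (Y' n) (a' n).
  by have [_ /(_ k A pA)] := DP w0 (n + N)%N.
have Y0 n w i : 0 <= Y' n w i by rewrite fine_ge0.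
have Y1 n w : \sum_(i < k) Y' n w i = 1 by exact: sum_mpartition.
have hE m i : a m i / \sum_(j < k) a m j = h w0 m i.
  by rewrite sum_a /a mulrC mulKf// gt_eqF.
have DE n : (fun w => Dstat (\sum_(i < k) a' n i) (Y' n w) (fun i => a' n i / \sum_(j < k) a' n j)) =
    D w0 (n + N)%N.
  apply/funext => w; rewrite /D sum_a; congr (Dstat _ _ _).
  by apply/funext => i; rewrite -(sum_a (n + N)%N) hE.
have KE n : (fun w => 2 * (\sum_(i < k) a' n i) *
    KLdiv (Y' n w) (fun i => a' n i / \sum_(j < k) a' n j)) = KL2 w0 (n + N)%N.
  apply/funext => w; rewrite /KL2 sum_a; congr (_ * KLdiv _ _).
  by apply/funext => i; rewrite -(sum_a (n + N)%N) hE.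
have c1 := dirichlet_Dstat_chi2 k2 a'0 a'y dY.
have [c2 c3] := dirichlet_KL_chi2 k2 a'0 a'y dY Y0 Y1.
split; last split.
- move=> f cf bf; rewrite -(cvg_shiftn N).
  apply: cvg_trans (c1 f cf bf); apply: near_eq_cvg; near=> n => /=.
  by apply: eq_Rintegral => w _; rewrite -(congr1 (@^~ w) (DE n)).
- move=> e e0; rewrite -(cvg_shiftn N).
  apply: cvg_trans (c2 e e0); apply: near_eq_cvg; near=> n => /=.
  congr (Q _); apply/seteqP; split => w /=;
    by rewrite -(congr1 (@^~ w) (DE n)) -(congr1 (@^~ w) (KE n)).
- move=> f cf bf; rewrite -(cvg_shiftn N).
  apply: cvg_trans (c3 f cf bf); apply: near_eq_cvg; near=> n => /=.
  by apply: eq_Rintegral => w _; rewrite -(congr1 (@^~ w) (KE n)).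
Unshelve. all: by end_near. Qed.
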